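(* Let $n=3$, and let $v_\infty\in\mathbb{R}^{4,1}$ be such that $(\sigma,v_\infty)$ is nowhere zero for a never-zero section $\sigma$ of $\Lambda$. Then $\Lambda$ is a constrained Willmore surface admitting a polynomial conserved quantity $p(\lambda)$ of type $1$ (that is, for some multiplier $q$, $p(\lambda)$ is a polynomial conserved quantity of type $1$ of $(\Lambda,q)$) with $p(1)=v_\infty$ if and only if the surface $\sigma_\infty$ defined by $\Lambda$ in $S_{v_\infty}$ is a constant mean curvature surface. Furthermore, if $p(\lambda)=p_{-1}\lambda^{-1}+p_0+p_1\lambda$ is a polynomial conserved quantity of type $1$ of $\Lambda$ with $p(1)=v_\infty$, then the constant mean curvature $H$ of $\Lambda$ in $S_{v_\infty}$ satisfies $$H^2=(v_\infty^\perp,v_\infty^\perp)=4\,(\mathrm{Re}(p_1),\mathrm{Re}(p_1)),$$ where $v_\infty^\perp$ is the orthogonal projection of $v_\infty$ onto $S^\perp$.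
   Context: Ambient setting. Let $n\ge 3$ and let $\mathbb{R}^{n+1,1}$ be Lorentzian space of dimension $n+2$, with inner product $(\,,\,)$, extended complex bilinearly to $\mathbb{C}^{n+2}=(\mathbb{R}^{n+1,1})^{\mathbb{C}}$. Identify $\wedge^2\mathbb{R}^{n+1,1}$ with $o(\mathbb{R}^{n+1,1})$ by $(u\wedge v)(w)=(u,w)v-(v,w)u$. Let $\mathcal{L}$ be the light-cone (nonzero null vectors) and $\mathbb{P}(\mathcal{L})$ its projectivisation, the conformal $n$-sphere. Let $\Lambda:\Sigma\to\mathbb{P}(\mathcal{L})$ be an immersion of an oriented surface (a ''surface''), viewed as a null line subbundle of the trivial bundle $\Sigma\times\mathbb{R}^{n+1,1}$; trivial bundles are underlined. $\Sigma$ carries the conformal structure induced by $\Lambda$ (the class of $g_\sigma(X,Y)=(\mathrm{d}\sigma(X),\mathrm{d}\sigma(Y))$, $\sigma$ a never-zero section of $\Lambda$) and the corresponding complex structure. Bundles and their complexifications are not distinguished notationally. Set $\Lambda^{1,0}=\Lambda\oplus\mathrm{d}\sigma(T^{1,0}\Sigma)$, $\Lambda^{0,1}=\Lambda\oplus\mathrm{d}\sigma(T^{0,1}\Sigma)$, $\Lambda^{(1)}=\Lambda^{1,0}+\Lambda^{0,1}$. The central sphere congruence is the rank $4$ subbundle $S=\Lambda^{(1)}\oplus\langle\triangle\sigma\rangle$, of signature $(3,1)$, with $\triangle$ the Laplacian of $g_\sigma$. Write $\mathrm{d}=\mathcal{D}+\mathcal{N}$ for the trivial flat connection, where $\mathcal{D}$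 is the sum of the connections induced by $\mathrm{d}$ on $S$ and $S^\perp$. Superscripts $1,0$ and $0,1$ denote type components. Constrained Willmore surfaces. $(\Lambda,q)$ is a constrained Willmore surface (and $q$ a multiplier) if $q\in\Omega^1(\Lambda\wedge\Lambda^{(1)})$ is a real form with $\mathrm{d}^{\mathcal{D}}q=0$ and $\mathrm{d}^{\mathcal{D}}{*\mathcal{N}}=2[q\wedge *\mathcal{N}]$ (where $[\omega_1\wedge\omega_2](X,Y)=[\omega_1(X),\omega_2(Y)]-[\omega_1(Y),\omega_2(X)]$); $\Lambda$ is a constrained Willmore surface if some such $q$ exists. Set, for $\lambda\in\mathbb{C}\setminus\{0\}$, $$\mathrm{d}^\lambda_q=\mathcal{D}+\lambda\mathcal{N}^{1,0}+\lambda^{-1}\mathcal{N}^{0,1}+(\lambda^2-1)q^{1,0}+(\lambda^{-2}-1)q^{0,1}.$$ Polynomial conserved quantities. For $d\in\mathbb{N}_0$, a polynomial conserved quantity of type $d$ of a constrained Willmore surface $(\Lambda,q)$ is a Laurent polynomial $p(\lambda)=\sum_{k=-d}^d p_k\lambda^k$ with $p_k\in\Gamma(\underline{\mathbb{C}}^{n+2})$ such that $p_{-k}=\overline{p_k}$ for all $k$; $p_d\in\Gamma(S^\perp)$; $p_k\in\Gamma(S^\perp)$ if $k,d$ have the same parity and $p_k\in\Gamma(S)$ otherwise; $p(1)\neq0$; and $\mathrm{d}^\lambda_q p(\lambda)=0$ for all $\lambda\in\mathbb{C}\setminus\{0\}$. Space-forms. For nonzero $v_\infty\in\mathbb{R}^{n+1,1}$,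 $S_{v_\infty}=\{v\in\mathcal{L}:(v,v_\infty)=-1\}$ with the induced metric is an $n$-dimensional space-form of sectional curvature $-(v_\infty,v_\infty)$. The surface defined by $\Lambda$ in $S_{v_\infty}$ is $\sigma_\infty=-\frac{1}{(\sigma,v_\infty)}\sigma:\Sigma\to S_{v_\infty}$. For $n=3$ its mean curvature $H$ is half the trace of the second fundamental form with respect to a unit normal (so defined up to sign). The theory is local: restriction to a suitable non-empty open subset of $\Sigma$ is understood throughout. *)

(* Defs.v *)
From mathcomp Require Import all_boot all_order all_algebra.
From mathcomp Require Import all_classical all_reals all_analysis.
From mathcomp Require Export complex.

Set Implicit Arguments.
Unset Strict Implicit.
Unset Printing Implicit Defensive.

Import Order.TTheory GRing.Theory Num.Theory numFieldNormedType.Exports.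

Local Open Scope classical_set_scope.
Local Open Scope ring_scope.
Local Open Scope complex_scope.

(** * Smooth maps on open subsets of the plane *)

Definition coord_vec (R : realType) (a : 'I_2) : 'rV[R]_2 := delta_mx 0 a.

Fixpoint Ck_on (R : realType) (V : normedModType R) (k : nat)
    (U : set 'rV[R]_2) (f : 'rV[R]_2 -> V) : Prop :=
  match k with
  | 0%N => forall y, U y -> {for y, continuous f}
  | k'.+1 => (forall y, U y -> differentiable f y) /\
             (forall a, Ck_on k' U (fun y => 'D_(coord_vec R a) f y))
  end.

Definition Cinf_on (R : realType) (V : normedModType R)
    (U : set 'rV[R]_2) (f : 'rV[R]_2 -> V) : Prop := forall k, Ck_on k U f.

(** * Oriented surfaces *)

(* A nonempty connected smooth oriented 2-manifold, given by an oriented smooth atlas.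
   [phi c] is only meaningful on [dom c] and [psi c] on the image of [dom c]. *)
Record oriented_surface (R : realType) := OrientedSurface {
  point :> topologicalType;
  chart : Type;
  dom : chart -> set point;
  phi : chart -> point -> 'rV[R]_2;
  psi : chart -> 'rV[R]_2 -> point;
  surface_hausdorff : hausdorff_space point;
  surface_second_countable : @second_countable point;
  surface_nonempty : [set: point] !=set0;
  surface_connected : connected [set: point];
  dom_cover : forall x, exists c, dom c x;
  dom_open : forall c, open (dom c);
  image_open : forall c, open (phi c @` dom c);
  phiK : forall c x, dom c x -> psi c (phi c x) = x;
  phi_continuous : forall c x, dom c x -> {for x, continuous (phi c)};
  psi_continuous : forall c x, dom c x -> {for phi c x, continuous (psi c)};
  transition_smooth : forall c d,
    Cinf_on (phi c @` (dom c `&` dom d)) (phi d \o psi c);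
  transition_oriented : forall c d x, dom c x -> dom d x ->
    0 < \det (\matrix_(a, b)
                'D_(coord_vec R a) (phi d \o psi c) (phi c x) 0 b)
}.

Section Calculus.
Variables (R : realType) (M : oriented_surface R).

(* The partial derivative of [f] in the [a]-th coordinate of the chart [c]. *)
Definition pd (V : normedModType R) (c : chart M) (a : 'I_2) (f : M -> V)
    (x : M) : V := 'D_(coord_vec R a) (f \o psi c) (phi c x).

Definition smooth (V : normedModType R) (f : M -> V) : Prop :=
  forall c, Cinf_on (phi c @` dom c) (f \o psi c).

(* [transition c d x a b] is the a-th partial derivative, in the coordinates
   of [c], of the b-th coordinate of [d]. *)
Definition transition (c d : chart M) (x : M) : 'M[R]_2 :=
  \matrix_(a, b) pd c a (phi d) x 0 b.

(* A smooth [V]-valued 1-form, given by its values [om c x a] on the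
   coordinate fields of the charts. *)
Definition is_form (V : normedModType R) (om : chart M -> M -> 'I_2 -> V) :=
  (forall c a, Cinf_on (phi c @` dom c) (fun y => om c (psi c y) a)) /\
  (forall c d x a, dom c x -> dom d x ->
     om c x a = \sum_b transition c d x a b *: om d x b).

End Calculus.

(** * Lorentzian space and its complexification *)

(* Vectors of R^{n+1,1} and of its complexification are columns of length
   n + 2; the last coordinate is the timelike one. *)
Definition lor (K : pzRingType) (n : nat) (u v : 'cV[K]_n.+2) : K :=
  \sum_(i < n.+1) u (widen_ord (leqnSn n.+1) i) 0 *
                  v (widen_ord (leqnSn n.+1) i) 0
  - u ord_max 0 * v ord_max 0.

Definition wedge (K : pzRingType) (n : nat) (u v w : 'cV[K]_n.+2)
  : 'cV[K]_n.+2 := lor u w *: v - lor v w *: u.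

Definition lightcone (R : realType) (n : nat) : set 'cV[R]_n.+2 :=
  [set u | u != 0 /\ lor u u = 0].

Section Complexification.
Variables (R : realType) (m k : nat).
Definition cplx (A : 'M[R]_(m, k)) : 'M[R[i]]_(m, k) :=
  map_mx (fun r : R => r%:C) A.
Definition mxRe (A : 'M[R[i]]_(m, k)) : 'M[R]_(m, k) :=
  map_mx (fun z : R[i] => complex.Re z) A.
Definition mxIm (A : 'M[R[i]]_(m, k)) : 'M[R]_(m, k) :=
  map_mx (fun z : R[i] => complex.Im z) A.
Definition mxconj (A : 'M[R[i]]_(m, k)) : 'M[R[i]]_(m, k) :=
  map_mx (fun z : R[i] => conjc z) A.
End Complexification.

Section OrthogonalProjection.
Variables (R : realType) (n : nat).
Local Notation CV := 'cV[R[i]]_n.+2.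

Definition orthogonal_to (U : {vspace CV}) (u : CV) : Prop :=
  forall s, s \in U -> lor s u = 0.

(* The orthogonal projection of [u] onto [U]; it is well defined as soon as
   [U] is nondegenerate. *)
Definition orth_proj (U : {vspace CV}) (u : CV) : CV :=
  xget 0 [set s | s \in U /\ orthogonal_to U (u - s)].

End OrthogonalProjection.

(** * Surfaces in the conformal n-sphere *)

Section ConformalSurface.
Variables (R : realType) (M : oriented_surface R) (n : nat).
Local Notation RV := 'cV[R]_n.+2.
Local Notation CV := 'cV[R[i]]_n.+2.

(* [sigma] is a never-zero section of a null line bundle Lambda = <sigma>
   immersed in the projectivised light-cone: the last clause is the injectivity
   of d sigma modulo Lambda. *)
Definition immersed_null_section (sigma : M -> RV) : Prop :=
  [/\ smooth sigma,
      forall x, lightcone (sigma x) &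
      forall c x, dom c x ->
        free [:: sigma x; pd c 0 sigma x; pd c 1 sigma x]].

Variable sigma : M -> RV.

Definition csmooth (w : M -> CV) : Prop :=
  smooth (fun x => mxRe (w x)) /\ smooth (fun x => mxIm (w x)).

(* The trivial flat connection on C^{n+2}-valued maps. *)
Definition cpd (c : chart M) (a : 'I_2) (w : M -> CV) (x : M) : CV :=
  cplx (pd c a (fun y => mxRe (w y)) x) +
  'i%C *: cplx (pd c a (fun y => mxIm (w y)) x).

Definition metric (c : chart M) (x : M) : 'M[R]_2 :=
  \matrix_(a, b) lor (pd c a sigma x) (pd c b sigma x).

Definition area (c : chart M) (x : M) : R := Num.sqrt (\det (metric c x)).

(* The rotation by a positive right angle: J d_a = \sum_b cstruct c x a b d_b.
   It only depends on the conformal class of the metric. *)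
Definition cstruct (c : chart M) (x : M) (a b : 'I_2) : R :=
  (if b == 0 then - metric c x a 1 else metric c x a 0) / area c x.

(* The types of a vector-valued 1-form [om] at a point, and its Hodge star:
   om^{1,0} = (om - i om J) / 2, om^{0,1} = (om + i om J) / 2, *om = - om J. *)
Definition formJ (c : chart M) (x : M) (om : 'I_2 -> CV) (a : 'I_2) : CV :=
  \sum_b (cstruct c x a b)%:C *: om b.
Definition part10 (c : chart M) (x : M) (om : 'I_2 -> CV) (a : 'I_2) : CV :=
  2^-1 *: (om a - 'i%C *: formJ c x om a).
Definition part01 (c : chart M) (x : M) (om : 'I_2 -> CV) (a : 'I_2) : CV :=
  2^-1 *: (om a + 'i%C *: formJ c x om a).

(* Laplace-Beltrami operator of the metric of [sigma], in coordinates. *)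
Definition laplacian (c : chart M) (f : M -> RV) (x : M) : RV :=
  (area c x)^-1 *:
    \sum_a pd c a
      (fun y => \sum_b (area c y * invmx (metric c y) a b) *: pd c b f y) x.

Definition csigma (x : M) : CV := cplx (sigma x).
Definition dsigma (c : chart M) (x : M) (a : 'I_2) : CV :=
  cplx (pd c a sigma x).

(* T^{1,0} is spanned by the (d_a - i J d_a) / 2, so d sigma (T^{1,0}) is
   spanned by the values of the (1,0)-part of d sigma. *)
Definition Lambda10 (c : chart M) (x : M) : {vspace CV} :=
  (<[csigma x]> + \sum_a <[part10 c x (dsigma c x) a]>)%VS.
Definition Lambda01 (c : chart M) (x : M) : {vspace CV} :=
  (<[csigma x]> + \sum_a <[part01 c x (dsigma c x) a]>)%VS.
Definition Lambda1 (c : chart M) (x : M) : {vspace CV} :=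
  (Lambda10 c x + Lambda01 c x)%VS.

Definition central_sphere (c : chart M) (x : M) : {vspace CV} :=
  (Lambda1 c x + <[cplx (laplacian c sigma x)]>)%VS.

Definition projS (c : chart M) (x : M) (u : CV) : CV :=
  orth_proj (central_sphere c x) u.
Definition projSperp (c : chart M) (x : M) (u : CV) : CV := u - projS c x u.

(* End(C^{n+2})-valued 1-forms are manipulated, in a chart, as pairs of
   operators on C^{n+2}-valued maps. *)
Definition opform := 'I_2 -> (M -> CV) -> (M -> CV).

(* d = D + N *)
Definition Dconn (c : chart M) : opform := fun a w x =>
  projS c x (cpd c a (fun y => projS c y (w y)) x) +
  projSperp c x (cpd c a (fun y => projSperp c y (w y)) x).
Definition Nform (c : chart M) : opform := fun a w x =>
  cpd c a w x - Dconn c a w x.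
Definition starN (c : chart M) : opform := fun a w x =>
  - formJ c x (fun b => Nform c b w x) a.

(* The values on (d_0, d_1) of d^D A, for the connection induced by D on
   endomorphisms, and of [A /\ B]. *)
Definition dD (c : chart M) (A : opform) (w : M -> CV) (x : M) : CV :=
  (Dconn c 0 (A 1 w) x - A 1 (Dconn c 0 w) x) -
  (Dconn c 1 (A 0 w) x - A 0 (Dconn c 1 w) x).
Definition bracket (A B : opform) (w : M -> CV) (x : M) : CV :=
  (A 0 (B 1 w) x - B 1 (A 0 w) x) - (A 1 (B 0 w) x - B 0 (A 1 w) x).

(* Real endomorphism-valued forms. *)
Definition endform := chart M -> M -> 'I_2 -> 'M[R]_n.+2.
Definition opq (q : endform) (c : chart M) : opform := fun a w x =>
  cplx (q c x a) *m w x.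

(** * Constrained Willmore surfaces *)

(* (Lambda, q) is a constrained Willmore surface.
   [q] takes values in Lambda /\ Lambda^(1) = {sigma /\ u | u in Lambda^(1)},
   as Lambda has rank 1. *)
Definition constrained_willmore (q : endform) : Prop :=
  [/\ is_form q,
      forall c x a, dom c x ->
        exists2 u, u \in Lambda1 c x &
          forall w, cplx (q c x a) *m w = wedge (csigma x) u w,
      forall c w x, csmooth w -> dom c x -> dD c (opq q c) w x = 0 &
      forall c w x, csmooth w -> dom c x ->
        dD c (starN c) w x = 2 *: bracket (opq q c) (starN c) w x].

Definition dlambda (q : endform) (lam : R[i]) (c : chart M) : opform :=
  fun a w x =>
    let N b := Nform c b w x in
    let Q b := opq q c b w x in
    Dconn c a w x + lam *: part10 c x N a + lam^-1 *: part01 c x N a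
    + (lam ^+ 2 - 1) *: part10 c x Q a + (lam ^- 2 - 1) *: part01 c x Q a.

(* A Laurent polynomial \sum_(-d <= k <= d) p_k lambda^k is given by its
   coefficients; those outside the range are ignored. *)
Definition laurent_eval (d : nat) (p : int -> M -> CV) (lam : R[i]) (x : M)
  : CV :=
  \sum_(j < (d.*2).+1) (lam ^ (j%:Z - d%:Z)) *: p (j%:Z - d%:Z) x.

Definition conserved_quantity (q : endform) (d : nat) (p : int -> M -> CV)
  : Prop :=
  [/\ forall k : int, (`|k| <= d)%N ->
        csmooth (p k) /\ (forall x, p (- k) x = mxconj (p k x)),
      forall c x, dom c x -> orthogonal_to (central_sphere c x) (p d x),
      forall (k : int) c x, (`|k| <= d)%N -> dom c x ->
        if odd `|k|%N == odd d then orthogonal_to (central_sphere c x) (p k x)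
        else p k x \in central_sphere c x,
      laurent_eval d p 1 <> (fun=> 0) &
      forall (lam : R[i]) c a x, lam != 0 -> dom c x ->
        dlambda q lam c a (laurent_eval d p lam) x = 0].

(** * Surfaces in space-forms *)

Definition space_form (v : RV) : set RV :=
  [set u | lightcone u /\ lor u v = -1].

Definition sigma_inf (v : RV) (x : M) : RV :=
  - (lor (sigma x) v)^-1 *: sigma x.

End ConformalSurface.

Section MeanCurvature.
Variables (R : realType) (M : oriented_surface R).
Local Notation RV := 'cV[R]_5.
Variable v : RV.

(* A unit normal field along [f : M -> space_form v]. The tangent space of
   space_form v at u is the orthogonal complement of u and v. *)
Definition unit_normal (f nu : M -> RV) : Prop :=
  smooth nu /\
  forall c x, dom c x ->
    [/\ lor (nu x) (nu x) = 1, lor (nu x) (f x) = 0, lor (nu x) v = 0 &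
        forall a, lor (nu x) (pd c a f x) = 0].

(* The Levi-Civita connection of space_form v is the tangential part of the
   flat one, so that its normal component along [nu] is that of d_a d_b f. *)
Definition second_ff (f nu : M -> RV) (c : chart M) (x : M) : 'M[R]_2 :=
  \matrix_(a, b) lor (pd c a (pd c b f) x) (nu x).

Definition mean_curvature (f nu : M -> RV) (c : chart M) (x : M) : R :=
  2^-1 * \tr (invmx (metric f c x) *m second_ff f nu c x).

Definition has_cmc (f : M -> RV) (H : R) : Prop :=
  exists2 nu, unit_normal f nu &
    forall c x, dom c x -> mean_curvature f nu c x = H.

End MeanCurvature.

(* Main.v *)
(* Let [f] be the surface in the space-form, [nu] its unit normal, [H] its mean
   curvature.  The unit section of [S^perp] is the mean curvature sphere
   [N = nu + H f], for which [(N, v) = - H] and the form [N] of [d = D + N] is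
   [wedge N (d N)].

   If [p] is a conserved quantity with [p(1) = v], then [p_1] and [p_(-1)] are
   multiples of [N] and [p_0] is orthogonal to [N], so that
   [v^perp = p_1 + p_(-1) = - H N].  Writing [p_1 = phi N], we have
   [Re phi = - H / 2].  Pairing the [lambda ^ 2]-coefficient of
   [d^lambda_q p(lambda) = 0] with [p_0] kills the skew form [q] and leaves
   [phi (d H)^(1,0) = 0].  Hence [d (H ^ 2) = 0], and [H] is constant as the
   surface is connected.

   Conversely, if [H] is constant, then [d N] is tangent to [f], symmetric and
   trace-free.  Take [q = wedge f (k d N)] and
   [p(lambda) = k N lambda^-1 + (v + H N) + k N lambda] with [k = - H / 2].  Then
   [d^D q = 0] expresses that [d N] is trace-free and closed.  As [J] is parallel,
   the covariant exterior derivative of the rotation of [d N] by [J] is a multiple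
   of [f], and comparing coefficients gives the constrained Willmore equation. *)

Require Import Defs.
From mathcomp Require Import all_boot all_order all_algebra.
From mathcomp Require Import all_classical all_reals all_analysis.
From mathcomp Require Import ring lra.
Set Implicit Arguments.
Unset Strict Implicit.
Unset Printing Implicit Defensive.
Import Order.TTheory GRing.Theory Num.Theory numFieldNormedType.Exports.
Local Open Scope classical_set_scope.
Local Open Scope ring_scope.
Local Open Scope complex_scope.

(** * Calculus in the plane *)

Lemma near_eq_differentiable (R : realType) (V W : normedModType R)
    (f g : V -> W) (a : V) :
  {near a, f =1 g} -> differentiable f a -> differentiable g a.
Proof.
move=> fg /diff_locallyP [dfc dfE]; have fga : f a = g a by exact: nbhs_singleton fg.
have dgE : g \o shift a = cst (g a) + 'd f a +o_ 0 id.
  apply/eqaddoP => e e0; move/eqaddoP: dfE => /(_ e e0) dfE.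
  move: fg; rewrite (near_shift 0 a) subr0 => fg.
  near=> h; rewrite [X in `|X|](_ : _ = (f \o shift a - (cst (f a) + 'd f a)) h); first last.
    rewrite !fctE /= -fga; congr (_ - _).
    by have := near fg h; rewrite /= => <-.
  by near: h.
have dg := diff_unique dfc dgE.
by apply/diff_locallyP; rewrite dg.
Unshelve. all: by end_near. Qed.

Lemma differentiable_mxP (R : realType) (V : normedModType R) (m n : nat)
    (f : V -> 'M[R]_(m, n)) (x : V) :
  differentiable f x <-> forall i j, differentiable (fun y => f y i j : R) x.
Proof.
split=> [df i j|df].
  exact: (differentiable_comp df (differentiable_coord (f x) i j)).
have -> : f = fun y => \sum_i (\sum_j f y i j *: delta_mx i j).
  by apply/funext => y; exact: matrix_sum_delta.
have sumE k (F : 'I_k -> V -> 'M[R]_(m, n)) :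
    (fun y => \sum_i F i y) = \sum_i F i.
  by rewrite fct_sumE.
rewrite (sumE _ (fun i y => \sum_j f y i j *: delta_mx i j)).
apply: differentiable_sum => i.
rewrite (sumE _ (fun j y => f y i j *: delta_mx i j)).
by apply: differentiable_sum => j; exact: differentiableZl.
Qed.

Section SmoothPlane.
Variables (R : realType) (U : set 'rV[R]_2).
Hypothesis oU : open U.
Implicit Types (V : normedModType R) (y : 'rV[R]_2).
Local Notation D a f := (fun y => 'D_(coord_vec R a) f y).

Lemma nbhs_eq_on V (f g : 'rV[R]_2 -> V) y :
  (forall z, U z -> f z = g z) -> U y -> {near y, f =1 g}.
Proof. by move=> fg Uy; near=> z; apply: fg; near: z; exact: open_nbhs_nbhs.
Unshelve. all: by end_near. Qed.

Lemma Ck_on_eq V k (f g : 'rV[R]_2 -> V) :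
  (forall z, U z -> f z = g z) -> Ck_on k U f -> Ck_on k U g.
Proof.
elim: k f g => [|k IH] f g fg /=.
  move=> cf y Uy; apply: (cvg_trans _ (_ : f @ y --> g y)).
    exact: near_eq_cvg (nbhs_eq_on fg Uy).
  by rewrite -fg//; exact: cf.
move=> [df Cf]; split=> [y Uy|a].
  by apply: near_eq_differentiable (df y Uy); exact: nbhs_eq_on.
apply: IH (Cf a) => z Uz; apply: near_eq_derive; exact: nbhs_eq_on.
Qed.

Lemma Ck_onW V k (f : 'rV[R]_2 -> V) : Ck_on k.+1 U f -> Ck_on k U f.
Proof.
elim: k f => [f [df _] y Uy|k IH f [df Cf]].
  exact/differentiable_continuous/df.
by split=> // a; exact: IH.
Qed.

Lemma Cinf_onP V (f : 'rV[R]_2 -> V) : Cinf_on U f <->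
  (forall y, U y -> differentiable f y) /\ (forall a, Cinf_on U (D a f)).
Proof.
split=> [Cf|[df Cf] [|k]].
- split=> [|a k]; first by have [df _] := Cf 1%N; exact: df.
  by have [_ Df] := Cf k.+1; exact: Df.
- by move=> y Uy; exact/differentiable_continuous/df.
- by split=> // a; exact: Cf.
Qed.

Lemma Ck_on_cst V k (v : V) : Ck_on k U (cst v).
Proof.
elim: k v => [|k IH] v; first by move=> y _; exact: cst_continuous.
split=> [y _|a]; first exact: differentiable_cst.
rewrite (_ : D a _ = cst 0); first exact: IH.
by apply/funext => y; rewrite derive_cst.
Qed.

Lemma Ck_onD V k (f g : 'rV[R]_2 -> V) :
  Ck_on k U f -> Ck_on k U g -> Ck_on k U (f + g).
Proof.
elim: k f g => [f g cf cg y Uy|k IH f g [df Cf] [dg Cg]].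
  by apply: continuousD; [exact: cf|exact: cg].
split=> [y Uy|a]; first by apply: differentiableD; [exact: df|exact: dg].
apply: Ck_on_eq (IH _ _ (Cf a) (Cg a)) => y Uy.
by rewrite deriveD//; apply: diff_derivable; [exact: df|exact: dg].
Qed.

Lemma Ck_onN V k (f : 'rV[R]_2 -> V) : Ck_on k U f -> Ck_on k U (- f).
Proof.
elim: k f => [f cf y Uy|k IH f [df Cf]].
  by apply: continuousN; exact: cf.
split=> [y Uy|a]; first by apply: differentiableN; exact: df.
by apply: Ck_on_eq (IH _ (Cf a)) => y Uy; rewrite deriveN//; exact/diff_derivable/df.
Qed.

Lemma Ck_onM k (f g : 'rV[R]_2 -> R) :
  Ck_on k U f -> Ck_on k U g -> Ck_on k U (f * g).
Proof.
elim: k f g => [f g cf cg y Uy|k IH f g Cf Cg].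
  by apply: continuousM; [exact: cf|exact: cg].
have [df Df] := Cf; have [dg Dg] := Cg.
split=> [y Uy|a]; first by apply: differentiableM; [exact: df|exact: dg].
have := Ck_onD (IH _ _ (Ck_onW Cf) (Dg a)) (IH _ _ (Ck_onW Cg) (Df a)).
apply: Ck_on_eq => y Uy; rewrite deriveM//; apply: diff_derivable;
  by [exact: df|exact: dg].
Qed.

Lemma Ck_onV k (f : 'rV[R]_2 -> R) :
  (forall y, U y -> f y != 0) -> Ck_on k U f -> Ck_on k U (fun y => (f y)^-1).
Proof.
move=> f0; elim: k => [cf y Uy|k IH Cf].
  by apply: continuousV; [exact: f0|exact: cf].
have [df Df] := Cf.
split=> [y Uy|a]; first by apply: differentiableV; [exact: df|exact: f0].
have IH' := IH (Ck_onW Cf).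
apply: Ck_on_eq (Ck_onM (Ck_on_cst k (-1 : R)) (Ck_onM (Ck_onM IH' IH') (Df a))).
move=> y Uy; rewrite deriveV//; last 2 first.
- exact: f0.
- exact/diff_derivable/df.
by rewrite !fctE /= mulN1r scaleNr expr2 invfM.
Qed.

Lemma differentiable_sqrt (f : 'rV[R]_2 -> R) y : 0 < f y ->
  differentiable f y -> differentiable (fun z => Num.sqrt (f z)) y.
Proof.
move=> f0 df; apply: (differentiable_comp (g := @Num.sqrt R)) => //.
apply/derivable1_diffP; by have [] := is_derive1_sqrt f0.
Qed.

Lemma derive_sqrt2 (f : 'rV[R]_2 -> R) y v : 0 < f y ->
  differentiable f y ->
  'D_v (fun z => Num.sqrt (f z)) y = (2 * Num.sqrt (f y))^-1 * 'D_v f y.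
Proof.
move=> f0 df; set g := fun z => _.
have dg : differentiable g y by exact: differentiable_sqrt.
have s0 : Num.sqrt (f y) != 0 by rewrite gt_eqF// sqrtr_gt0.
have <- : 'D_v (g * g) y = 'D_v f y.
  apply: near_eq_derive.
  have := (differentiable_continuous df).
  move=> /cvgrPdist_lt /(_ _ f0) H; near=> z.
  rewrite /g fctE -expr2 sqr_sqrtr//.
  have : `|f y - f z| < f y by near: z.
  by rewrite ltr_norml => /andP[_]; lra.
rewrite deriveM; [|exact: diff_derivable..].
by rewrite /g /GRing.scale /=; field.
Unshelve. all: by end_near. Qed.

Lemma Ck_on_sqrt k (f : 'rV[R]_2 -> R) :
  (forall y, U y -> 0 < f y) -> Ck_on k U f ->
  Ck_on k U (fun y => Num.sqrt (f y)).
Proof.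
move=> f0; elim: k => [cf y Uy|k IH Cf].
  by apply: continuous_comp; [exact: cf|exact: sqrt_continuous].
have [df Df] := Cf.
split=> [y Uy|a]; first by apply: differentiable_sqrt; [exact: f0|exact: df].
have IH' := IH (Ck_onW Cf).
have s0 y : U y -> 2 * Num.sqrt (f y) != 0.
  by move=> Uy; rewrite mulf_neq0 ?pnatr_eq0// gt_eqF// sqrtr_gt0 f0.
apply: Ck_on_eq (Ck_onM (Ck_onV s0 (Ck_onM (Ck_on_cst k (2 : R)) IH')) (Df a)).
by move=> y Uy; rewrite derive_sqrt2//; [exact: f0|exact: df].
Qed.

Lemma derive_mxE m n (f : 'rV[R]_2 -> 'M[R]_(m, n)) y v i j :
  differentiable f y -> 'D_v f y i j = 'D_v (fun z => f z i j) y.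
Proof. by move=> df; rewrite derive_mx ?mxE//; exact: diff_derivable. Qed.

Lemma Ck_on_mxP m n k (f : 'rV[R]_2 -> 'M[R]_(m, n)) :
  Ck_on k U f <-> forall i j, Ck_on k U (fun y => f y i j : R).
Proof.
elim: k f => [|k IH] f; split.
- move=> cf i j y Uy.
  apply: (@continuous_comp _ _ _ f (fun A : 'M[R]_(m, n) => A i j : R) y (cf y Uy)).
  exact: coord_continuous.
- move=> cf y Uy; suff : f z @[z --> y] --> f y by [].
  apply: (@cvgrPdist_le _ _ _ (nbhs y) _ f (f y)).2 => e e0.
  near=> z; rewrite /Num.Def.normr/= mx_normrE (bigmax_le _ (ltW e0))//= => i _.
  rewrite !mxE/=; move: i; near: z; apply: filter_forall => /= i.
  exact: ((cvgrPdist_le _ _).1 (cf i.1 i.2 y Uy)).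
- move=> [df Cf] i j; split=> [y Uy|a].
    by have /differentiable_mxP := df y Uy.
  apply: Ck_on_eq ((IH _).1 (Cf a) i j) => z Uz.
  by rewrite derive_mxE//; exact: df.
- move=> Cf; have df y : U y -> differentiable f y.
    by move=> Uy; apply/differentiable_mxP => i j; case: (Cf i j) => + _; exact.
  split=> // a; apply/IH => i j.
  have [_ Df] := Cf i j; apply: Ck_on_eq (Df a) => z Uz.
  by rewrite derive_mxE//; exact: df.
Unshelve. all: by end_near. Qed.

Lemma is_derive_line (f : 'rV[R]_2 -> R) y v (t : R) :
  derivable f (y + t *: v) v ->
  is_derive t 1 (fun s : R => f (y + s *: v)) ('D_v f (y + t *: v)).
Proof.
move=> df; have E (h : R) : h^-1 *: (((fun s : R => f (y + s *: v)) \o shift t)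
    (h *: (1 : R)) - f (y + t *: v)) =
    h^-1 *: ((f \o shift (y + t *: v)) (h *: v) - f (y + t *: v)).
  by rewrite /= scaler1 scalerDl addrCA addrA.
apply: DeriveDef; first by rewrite /derivable; under eq_fun do rewrite E.
by rewrite /derive; under eq_fun do rewrite E.
Qed.

Lemma MVT_line (f : 'rV[R]_2 -> R) y v (h : R) : 0 < h ->
  (forall t, t \in `[0, h] -> derivable f (y + t *: v) v) ->
  exists2 t, t \in `[0, h] & f (y + h *: v) - f y = h * 'D_v f (y + t *: v).
Proof.
move=> h0 df; pose g t := f (y + t *: v).
have dg t : t \in `[0, h] -> is_derive t 1 g ('D_v f (y + t *: v)).
  by move=> th; apply: is_derive_line; exact: df.
have [t th E] := MVT h0 (fun t th => dg t (subset_itv_oo_cc th))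
  (derivable_within_continuous (fun t th => @ex_derive _ _ _ _ _ _ _ (dg t th))).
exists t; first exact: subset_itv_oo_cc.
by move: E; rewrite /g scale0r addr0 subr0 mulrC.
Qed.

Lemma is_derive_translate (f : 'rV[R]_2 -> R) w y v :
  derivable f (y + w) v ->
  is_derive y v (fun z => f (z + w)) ('D_v f (y + w)).
Proof.
move=> df; have E (h : R) : h^-1 *: (((fun z => f (z + w)) \o shift y)
    (h *: v) - f (y + w)) = h^-1 *: ((f \o shift (y + w)) (h *: v) - f (y + w)).
  by rewrite /= addrA.
apply: DeriveDef; first by rewrite /derivable; under eq_fun do rewrite E.
by rewrite /derive; under eq_fun do rewrite E.
Qed.

Lemma mixed_difference (f : 'rV[R]_2 -> R) y u v (h : R) : 0 < h ->
  (forall s t, s \in `[0, h] -> t \in `[0, h] ->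
     let z := y + s *: u + t *: v in
     derivable f z u /\ derivable (fun x => 'D_u f x) z v) ->
  exists s t, [/\ s \in `[0, h], t \in `[0, h] &
    f (y + h *: u + h *: v) - f (y + h *: u) - (f (y + h *: v) - f y) =
    h ^+ 2 * 'D_v (fun x => 'D_u f x) (y + s *: u + t *: v)].
Proof.
move=> h0 df; pose g z := f (z + h *: v) - f z.
have hh : h \in `[0, h] by rewrite in_itv /= lexx ltW.
have z0 : 0 \in `[0, h] by rewrite in_itv /= lexx ltW.
have dg s : s \in `[0, h] -> is_derive (y + s *: u) u g
    ('D_u f (y + s *: u + h *: v) - 'D_u f (y + s *: u)).
  move=> sh; have [d1 _] := df s h sh hh; have [d2 _] := df s 0 sh z0.
  rewrite scale0r addr0 in d2.
  have i1 := is_derive_translate d1.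
  have i2 : is_derive (y + s *: u) u f ('D_u f (y + s *: u)) by exact: derivableP.
  exact: is_deriveB i1 i2.
have [s sh E] := MVT_line h0 (fun s sh => @ex_derive _ _ _ _ _ _ _ (dg s sh)).
have [t th E'] := MVT_line h0 (fun t th => (df s t sh th).2).
exists s, t; split => //.
rewrite expr2 -mulrA -E'.
have dgE := @derive_val _ _ _ _ _ _ _ (dg s sh).
by rewrite -dgE -E /g addrAC.
Qed.

Lemma dist_halves (e p p' q r : R) : p = p' ->
  `|q - p| < e / 2 -> `|r - p'| < e / 2 -> `|r - q| <= e.
Proof.
move=> <- H3 H4; apply: le_trans (ler_distD p _ _) _.
by rewrite [leRHS]splitr lerD// ltW// distrC.
Qed.

Lemma schwarz (f : 'rV[R]_2 -> R) y (a b : 'I_2) : Cinf_on U f -> U y ->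
  D a (D b f) y = D b (D a f) y.
Proof.
move=> Cf Uy.
have dD c z : U z -> differentiable (D c f) z.
  by move=> Uz; have /Cinf_onP[_ /(_ c) /Cinf_onP[+ _]] := Cf; exact.
have df z : U z -> differentiable f z by have /Cinf_onP[+ _] := Cf; exact.
have cD c d : {for y, continuous (D d (D c f))}.
  have /Cinf_onP[_ /(_ c) /Cinf_onP[_ /(_ d)]] := Cf.
  by move=> /Cinf_onP[+ _] => /(_ y Uy); exact: differentiable_continuous.
apply/eqP; rewrite -subr_eq0 -normr_le0; apply/ler_addgt0Pl => e e0; rewrite addr0.
have e20 : 0 < e / 2 by rewrite divr_gt0.
have : \forall z \near y, U z /\ `|D a (D b f) y - D a (D b f) z| < e / 2 /\
                           `|D b (D a f) y - D b (D a f) z| < e / 2.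
  have N0 : \forall z \near y, U z by exact: open_nbhs_nbhs.
  have N1 := @cvgr_dist_lt _ _ _ (nbhs y) _ (D a (D b f)) _ (cD b a) _ e20.
  have N2 := @cvgr_dist_lt _ _ _ (nbhs y) _ (D b (D a f)) _ (cD a b) _ e20.
  exact: filterI N0 (filterI (N1 (nbhs_filter y)) (N2 (nbhs_filter y))).
move=> /nbhs_ballP[d /= d0 Hd].
pose n := `|coord_vec R a| + `|coord_vec R b| + 1.
have n0 : 0 < n by rewrite /n ltr_wpDl// addr_ge0.
pose h := d / n / 2; have h0 : 0 < h by rewrite !divr_gt0.
have inb s t : s \in `[0, h] -> t \in `[0, h] ->
    ball y d (y + s *: coord_vec R a + t *: coord_vec R b).
  rewrite !in_itv /= => /andP[s0 sh] /andP[t0 th].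
  rewrite -ball_normE /ball_ /= opprD addrA opprD addrA subrr sub0r.
  rewrite -opprD normrN (le_lt_trans (ler_normD _ _))// !normrZ !ger0_norm//.
  apply: (@le_lt_trans _ _ (h * n)); last first.
    by rewrite /h mulrAC divfK ?gt_eqF//; lra.
  rewrite /n mulrDr mulr1 mulrDr -addrA lerD ?ler_wpM2r//.
  by rewrite (le_trans (ler_wpM2r _ th))// lerDl ltW.
have [|s [t [sh th E1]]] := @mixed_difference f y (coord_vec R a) (coord_vec R b) h h0.
  move=> s t sh th z; have [Uz _] := Hd _ (inb _ _ sh th).
  by split; apply: diff_derivable; [exact: df|exact: dD].
have inb' s' t' : s' \in `[0, h] -> t' \in `[0, h] ->
    ball y d (y + s' *: coord_vec R b + t' *: coord_vec R a).
  by move=> sh' th'; rewrite addrAC; exact: inb.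
have [|s' [t' [sh' th' E2]]] := @mixed_difference f y (coord_vec R b) (coord_vec R a) h h0.
  move=> s' t' sh' th' z; have [Uz _] := Hd _ (inb' _ _ sh' th').
  by split; apply: diff_derivable; [exact: df|exact: dD].
have [_ [_ H1]] := Hd _ (inb _ _ sh th).
have [_ [H2 _]] := Hd _ (inb' _ _ sh' th').
have h20 : h ^+ 2 != 0 by rewrite expf_neq0// gt_eqF.
have E0 (p q r t0 : R) : p - q - (r - t0) = p - r - (q - t0) by ring.
have := etrans (esym E1) (etrans (E0 _ _ _ _) _).
rewrite [y + h *: coord_vec R a + _]addrAC => /(_ _ E2) /(mulfI h20) E.
exact: dist_halves E H1 H2.
Qed.

Lemma derive_coordE V (f : 'rV[R]_2 -> V) y v : differentiable f y ->
  'D_v f y = \sum_a v 0 a *: D a f y.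
Proof.
move=> df; rewrite deriveE// {1}(row_sum_delta v) linear_sum /=.
by apply: eq_bigr => a _; rewrite linearZ /= deriveE.
Qed.

Lemma derive_chain V (f : 'rV[R]_2 -> V) (g : 'rV[R]_2 -> 'rV[R]_2) y v :
  differentiable g y -> differentiable f (g y) ->
  'D_v (f \o g) y = \sum_a ('D_v g y) 0 a *: D a f (g y).
Proof.
move=> dg df; rewrite deriveE; last exact: differentiable_comp.
by rewrite diff_comp//= -derive_coordE// deriveE// deriveE.
Qed.

Lemma locally_constant (f : 'rV[R]_2 -> R) y :
  (forall z, U z -> differentiable f z) ->
  (forall a z, U z -> D a f z = 0) -> U y -> \forall z \near y, f z = f y.
Proof.
move=> df Df0 Uy.
have : \forall z \near y, U z by exact: open_nbhs_nbhs.
move=> /nbhs_ballP[d /= d0 Hd]; apply/nbhs_ballP; exists d => //= z yz.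
have seg t : t \in `[0, 1] -> U (y + t *: (z - y)).
  rewrite in_itv /= => /andP[t0 t1]; apply: Hd.
  rewrite -ball_normE /ball_ /= opprD addrA subrr sub0r normrN normrZ ger0_norm//.
  move: yz; rewrite -ball_normE /ball_ /= distrC; apply: le_lt_trans.
  by rewrite ler_piMl.
have [|t t01] := @MVT_line f y (z - y) 1 ltr01.
  by move=> t /seg Ut; apply: diff_derivable; exact: df.
rewrite scale1r subrKC derive_coordE; last exact/df/seg.
rewrite big1 ?mulr0; first by move/eqP; rewrite subr_eq0 => /eqP.
by move=> a _; rewrite Df0 ?scaler0//; exact: seg.
Qed.

End SmoothPlane.

(** * Calculus on a surface *)

Fact partial_key : unit. Proof. exact: tt. Qed.

(* [pd], locked: otherwise failing unifications unfold it down to limits. *)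
Definition partial (R : realType) (M : oriented_surface R) (V : normedModType R) :
    chart M -> 'I_2 -> (M -> V) -> M -> V :=
  locked_with partial_key (@pd R M V).

Lemma partialE (R : realType) (M : oriented_surface R) (V : normedModType R)
    (c : chart M) (a : 'I_2) (f : M -> V) : partial c a f = pd c a f.
Proof. by rewrite /partial unlock. Qed.

Section SurfaceCalculus.
Variables (R : realType) (M : oriented_surface R) (c : chart M).
Implicit Types (V : normedModType R) (x : M) (a b : 'I_2).

Definition smooth_in V (f : M -> V) : Prop :=
  Cinf_on (phi c @` dom c) (f \o psi c).

Lemma chart_image x : dom c x -> (phi c @` dom c) (phi c x).
Proof. by move=> cx; exists x. Qed.
Hint Resolve chart_image : core.

Let oU : open (phi c @` dom c). Proof. exact: image_open. Qed.

Lemma comp_psi_eq V (f g : M -> V) : (forall x, dom c x -> f x = g x) ->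
  forall y, (phi c @` dom c) y -> (f \o psi c) y = (g \o psi c) y.
Proof. by move=> fg _ [x cx <-] /=; rewrite phiK//; exact: fg. Qed.

Lemma smooth_in_eq V (f g : M -> V) :
  (forall x, dom c x -> f x = g x) -> smooth_in f -> smooth_in g.
Proof.
by move=> fg Cf k; exact: (Ck_on_eq oU (comp_psi_eq fg) (Cf k)).
Qed.

Lemma partial_eq V (f g : M -> V) a x : (forall x, dom c x -> f x = g x) ->
  dom c x -> partial c a f x = partial c a g x.
Proof.
move=> fg cx; rewrite !partialE; apply: near_eq_derive.
exact: (nbhs_eq_on oU (comp_psi_eq fg) (chart_image cx)).
Qed.

Lemma smooth_in_diff V (f : M -> V) x :
  smooth_in f -> dom c x -> differentiable (f \o psi c) (phi c x).
Proof. by move=> /Cinf_onP[+ _] cx; apply; exact: chart_image. Qed.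

Lemma smooth_in_derivable V (f : M -> V) x v :
  smooth_in f -> dom c x -> derivable (f \o psi c) (phi c x) v.
Proof. by move=> sf cx; exact/diff_derivable/smooth_in_diff. Qed.

Lemma smooth_in_partial V (f : M -> V) a : smooth_in f -> smooth_in (partial c a f).
Proof.
move=> /Cinf_onP[_ /(_ a) Cf] k; apply: Ck_on_eq (Cf k) => //.
by move=> _ [x cx <-]; rewrite partialE /pd /= phiK.
Qed.

Lemma smooth_in_cst V (v : V) : smooth_in (fun=> v).
Proof. by move=> k; exact: Ck_on_cst. Qed.

Lemma smooth_inD V (f g : M -> V) :
  smooth_in f -> smooth_in g -> smooth_in (fun x => f x + g x).
Proof. by move=> Cf Cg k; exact: (Ck_onD oU (Cf k) (Cg k)). Qed.

Lemma smooth_inM (f g : M -> R) :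
  smooth_in f -> smooth_in g -> smooth_in (fun x => f x * g x).
Proof. by move=> Cf Cg k; exact: (Ck_onM oU (Cf k) (Cg k)). Qed.

Lemma smooth_inV (f : M -> R) : (forall x, dom c x -> f x != 0) ->
  smooth_in f -> smooth_in (fun x => (f x)^-1).
Proof.
move=> f0 Cf k; apply: (Ck_onV oU _ (Cf k)) => _ [x cx <-] /=.
by rewrite phiK//; exact: f0.
Qed.

Lemma smooth_in_sqrt (f : M -> R) : (forall x, dom c x -> 0 < f x) ->
  smooth_in f -> smooth_in (fun x => Num.sqrt (f x)).
Proof.
move=> f0 Cf k; apply: (Ck_on_sqrt oU _ (Cf k)) => _ [x cx <-] /=.
by rewrite phiK//; exact: f0.
Qed.

Lemma smooth_in_mxP m n (f : M -> 'M[R]_(m, n)) :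
  smooth_in f <-> forall i j, smooth_in (fun x => f x i j).
Proof.
split=> [Cf i j k|Cf k]; first exact: (Ck_on_mxP oU k (f \o psi c)).1 (Cf k) i j.
by apply/(Ck_on_mxP oU k (f \o psi c)) => i j; exact: Cf.
Qed.

Lemma smooth_in_sum (I : Type) (r : seq I) (F : I -> M -> R) :
  (forall i, smooth_in (F i)) -> smooth_in (fun x => \sum_(i <- r) F i x).
Proof.
move=> CF; elim: r => [|i r IH].
  by under eq_fun do rewrite big_nil; exact: smooth_in_cst.
by under eq_fun do rewrite big_cons; exact: smooth_inD.
Qed.

Lemma smooth_in_prod (I : Type) (r : seq I) (F : I -> M -> R) :
  (forall i, smooth_in (F i)) -> smooth_in (fun x => \prod_(i <- r) F i x).
Proof.
move=> CF; elim: r => [|i r IH].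
  by under eq_fun do rewrite big_nil; exact: smooth_in_cst.
by under eq_fun do rewrite big_cons; exact: smooth_inM.
Qed.

Lemma smooth_in_mulmx m n p (f : M -> 'M[R]_(m, n)) (g : M -> 'M[R]_(n, p)) :
  smooth_in f -> smooth_in g -> smooth_in (fun x => f x *m g x).
Proof.
move=> /smooth_in_mxP Cf /smooth_in_mxP Cg; apply/smooth_in_mxP => i j.
under eq_fun do rewrite mxE.
by apply: smooth_in_sum => k; exact: smooth_inM.
Qed.

Lemma smooth_inZ m n (h : M -> R) (f : M -> 'M[R]_(m, n)) :
  smooth_in h -> smooth_in f -> smooth_in (fun x => h x *: f x).
Proof.
move=> Ch /smooth_in_mxP Cf; apply/smooth_in_mxP => i j.
by under eq_fun do rewrite mxE; exact: smooth_inM.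
Qed.

Lemma smooth_inN V (f : M -> V) : smooth_in f -> smooth_in (fun x => - f x).
Proof. by move=> Cf k; exact: (Ck_onN oU (Cf k)). Qed.

Lemma smooth_in_trmx m n (f : M -> 'M[R]_(m, n)) :
  smooth_in f -> smooth_in (fun x => (f x)^T).
Proof.
move=> /smooth_in_mxP Cf; apply/smooth_in_mxP => i j.
by under eq_fun do rewrite mxE; exact: Cf.
Qed.

Section PartialDerivatives.
Variables (x : M) (a : 'I_2).
Hypothesis cx : dom c x.

Lemma partial_cst V (v : V) : partial c a (fun=> v) x = 0.
Proof. by rewrite partialE /pd /comp derive_cst. Qed.

Lemma partialD V (f g : M -> V) : smooth_in f -> smooth_in g ->
  partial c a (fun y => f y + g y) x = partial c a f x + partial c a g x.
Proof. move=> Cf Cg; rewrite !partialE.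
exact: (@deriveD _ _ _ (f \o psi c) (g \o psi c) _ _
  (smooth_in_derivable Cf cx) (smooth_in_derivable Cg cx)). Qed.

Lemma partialN V (f : M -> V) : smooth_in f ->
  partial c a (fun y => - f y) x = - partial c a f x.
Proof. move=> Cf; rewrite !partialE.
exact: (@deriveN _ _ _ (f \o psi c) _ _ (smooth_in_derivable Cf cx)). Qed.

Lemma partialM (f g : M -> R) : smooth_in f -> smooth_in g ->
  partial c a (fun y => f y * g y) x = partial c a f x * g x + f x * partial c a g x.
Proof.
move=> Cf Cg; rewrite !partialE /pd.
have := @deriveM _ _ (f \o psi c) (g \o psi c) _ (coord_vec R a)
  (smooth_in_derivable Cf cx) (smooth_in_derivable Cg cx).
by rewrite /= !phiK// => E; rewrite [LHS]E addrC [g x *: _]mulrC.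
Qed.

Lemma partial_sum n (f : 'I_n -> M -> R) : (forall i, smooth_in (f i)) ->
  partial c a (fun y => \sum_i f i y) x = \sum_i partial c a (f i) x.
Proof.
move=> Cf; under eq_bigr do rewrite partialE.
rewrite partialE /pd; have := @derive_sum _ _ _ n (fun i => f i \o psi c)
  (phi c x) (coord_vec R a) (fun i => smooth_in_derivable (Cf i) cx).
by move=> <-; rewrite fct_sumE.
Qed.

Lemma partial_mxE m n (f : M -> 'M[R]_(m, n)) i j : smooth_in f ->
  partial c a f x i j = partial c a (fun y => f y i j) x.
Proof. by move=> Cf; rewrite !partialE /pd derive_mxE//; exact: smooth_in_diff. Qed.

Lemma partial_mulmx m n p (f : M -> 'M[R]_(m, n)) (g : M -> 'M[R]_(n, p)) :
  smooth_in f -> smooth_in g ->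
  partial c a (fun y => f y *m g y) x = partial c a f x *m g x + f x *m partial c a g x.
Proof.
move=> Cf Cg; have [Cf' Cg'] := ((smooth_in_mxP _).1 Cf, (smooth_in_mxP _).1 Cg).
apply/matrixP => i j; rewrite partial_mxE; last exact: smooth_in_mulmx.
under eq_fun do rewrite mxE.
rewrite partial_sum => [|k]; last exact: smooth_inM.
rewrite !mxE -big_split /=; apply: eq_bigr => k _.
by rewrite partialM// -!partial_mxE.
Qed.

Lemma partialZ m n (h : M -> R) (f : M -> 'M[R]_(m, n)) :
  smooth_in h -> smooth_in f ->
  partial c a (fun y => h y *: f y) x = partial c a h x *: f x + h x *: partial c a f x.
Proof.
move=> Ch Cf; have Cf' := (smooth_in_mxP _).1 Cf.
apply/matrixP => i j; rewrite partial_mxE; last exact: smooth_inZ.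
under eq_fun do rewrite mxE.
by rewrite partialM// !mxE -partial_mxE.
Qed.

Lemma partial_trmx m n (f : M -> 'M[R]_(m, n)) : smooth_in f ->
  partial c a (fun y => (f y)^T) x = (partial c a f x)^T.
Proof.
move=> Cf; apply/matrixP => i j; rewrite partial_mxE; last exact: smooth_in_trmx.
by under eq_fun do rewrite mxE; rewrite mxE -partial_mxE.
Qed.

Lemma partial_comm m n (f : M -> 'M[R]_(m, n)) b : smooth_in f ->
  partial c a (partial c b f) x = partial c b (partial c a f) x.
Proof.
move=> Cf; have Cf' := (smooth_in_mxP _).1 Cf.
apply/matrixP => i j.
have E d e : partial c d (partial c e f) x i j =
             'D_(coord_vec R d) ('D_(coord_vec R e) ((fun y => f y i j) \o psi c)) (phi c x).
  rewrite partialE /pd derive_mxE; last exact: smooth_in_diff (smooth_in_partial e Cf) cx.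
  apply: near_eq_derive; apply: (nbhs_eq_on oU); last exact: chart_image.
  move=> _ [z cz <-] /=; rewrite phiK// partialE.
  exact: derive_mxE (smooth_in_diff Cf cz).
exact: etrans (E a b) (etrans (schwarz oU a b (Cf' i j) (chart_image cx)) (esym (E b a))).
Qed.

End PartialDerivatives.

End SurfaceCalculus.

Section GlobalCalculus.
Variables (R : realType) (M : oriented_surface R).

Lemma partial_transition (V : normedModType R) (c d : chart M) (f : M -> V) a x :
  smooth_in d f -> dom c x -> dom d x ->
  partial c a f x = \sum_b transition c d x a b *: partial d b f x.
Proof.
move=> Cf cx dx.
have cpx : (phi c @` (dom c `&` dom d)) (phi c x) by exists x.
have df : differentiable (f \o psi d) ((phi d \o psi c) (phi c x)).
  by rewrite /= phiK//; exact: smooth_in_diff.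
have dT : differentiable (phi d \o psi c) (phi c x).
  by have /Cinf_onP[+ _] := @transition_smooth _ M c d; apply.
have := derive_chain (coord_vec R a) dT df; rewrite /= phiK// => E.
under eq_bigr do rewrite partialE.
rewrite partialE /pd.
transitivity ('D_(coord_vec R a) ((f \o psi d) \o (phi d \o psi c)) (phi c x)).
  apply: near_eq_derive; near=> y; rewrite /= phiK//; near: y.
  apply: (psi_continuous cx); rewrite phiK//.
  by apply: open_nbhs_nbhs; split => //; exact: dom_open.
by rewrite [LHS]E; apply: eq_bigr => b _; rewrite /transition mxE.
Unshelve. all: by end_near. Qed.

Lemma constant_of_partial0 (f : M -> R) : smooth f ->
  (forall c a x, dom c x -> partial c a f x = 0) -> forall x y, f x = f y.
Proof.
move=> Cf f0; have loc x : \forall z \near x, f z = f x.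
  have [c cx] := dom_cover x.
  have oc := @image_open _ M c.
  have H : \forall y \near phi c x, (f \o psi c) y = (f \o psi c) (phi c x).
    apply: (locally_constant oc); last exact: chart_image.
    - by have /Cinf_onP[] := Cf c.
    - by move=> a _ [z cz <-]; rewrite -(f0 c a z cz) partialE.
  have Hz : \forall z \near x, f (psi c (phi c z)) = f (psi c (phi c x)).
    exact: (phi_continuous cx H).
  near=> z; have cz : dom c z.
    by near: z; apply: open_nbhs_nbhs; split => //; exact: dom_open.
  have : f (psi c (phi c z)) = f (psi c (phi c x)) by near: z.
  by rewrite !phiK.
have op (P : R -> Prop) : open [set z | P (f z)].
  rewrite openE => z Pz; rewrite /interior /=; near=> w.
  rewrite /=; have -> : f w = f z by near: w; exact: loc.
  exact: Pz.
move=> x y.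
suff E : [set z | f z = f x] = setT.
  by have : [set z | f z = f x] y by rewrite E.
apply: (@surface_connected _ M); first by exists x.
- by exists [set z | f z = f x]; rewrite ?setTI//; exact: (op (fun t => t = f x)).
- exists [set z | f z = f x]; rewrite ?setTI// -openC.
  exact: (op (fun t => t <> f x)).
Unshelve. all: by end_near. Qed.

End GlobalCalculus.

Section ComplexCalculus.
Variables (R : realType) (M : oriented_surface R) (n : nat).
Local Notation RV := 'cV[R]_n.+2.
Local Notation CV := 'cV[R[i]]_n.+2.

Definition cvec (r s : RV) : CV := cplx r + 'i%C *: cplx s.

Lemma cvecK (w : CV) : cvec (mxRe w) (mxIm w) = w.
Proof.
by apply/matrixP => i j; rewrite !mxE -complexE.
Qed.

Lemma mxRe_cvec r s : mxRe (cvec r s) = r.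
Proof. by apply/matrixP => i j; rewrite !mxE /= mul0r mulr0 subr0 addr0. Qed.

Lemma mxIm_cvec r s : mxIm (cvec r s) = s.
Proof. by apply/matrixP => i j; rewrite !mxE /= mul0r mul1r !add0r. Qed.

Lemma cvecE (w : CV) : exists r s, w = cvec r s.
Proof. by exists (mxRe w), (mxIm w); rewrite cvecK. Qed.

Lemma cplxE (r : RV) : cplx r = cvec r 0.
Proof. by rewrite /cvec [cplx 0]raddf0 scaler0 addr0. Qed.

Lemma cvecD r s r' s' : cvec r s + cvec r' s' = cvec (r + r') (s + s').
Proof. by rewrite /cvec ![cplx (_ + _)]raddfD scalerDr addrACA. Qed.

Lemma cvecN r s : - cvec r s = cvec (- r) (- s).
Proof. by rewrite /cvec ![cplx (- _)]raddfN scalerN opprD. Qed.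

Lemma cvecB2 r1 r2 r3 r4 s1 s2 s3 s4 :
  (cvec r1 s1 - cvec r2 s2) - (cvec r3 s3 - cvec r4 s4) =
  cvec (r1 - r2 - (r3 - r4)) (s1 - s2 - (s3 - s4)).
Proof. by rewrite !(cvecN, cvecD). Qed.

Lemma cvecZ (k : R) r s : k%:C *: cvec r s = cvec (k *: r) (k *: s).
Proof. by rewrite /cvec /cplx !map_mxZ scalerDr !scalerA mulrC. Qed.

Lemma cvecZi r s : 'i%C *: cvec r s = cvec (- s) r.
Proof.
rewrite /cvec [cplx (- _)]raddfN scalerDr scalerA -expr2 sqr_i scaleN1r.
by rewrite addrC.
Qed.

Lemma cvecZc (l : R[i]) r s : l *: cvec r s =
  cvec (complex.Re l *: r - complex.Im l *: s) (complex.Re l *: s + complex.Im l *: r).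
Proof.
rewrite {1}[l]complexE scalerDl cvecZ ['i%C * _]mulrC -scalerA cvecZi cvecZ cvecD.
by rewrite scalerN.
Qed.

Lemma cvec_mulmx (A : 'M[R]_n.+2) r s : cplx A *m cvec r s = cvec (A *m r) (A *m s).
Proof. by rewrite /cvec /cplx !map_mxM mulmxDr -scalemxAr. Qed.

Lemma cpd_cvec c a (r s : M -> RV) x :
  cpd c a (fun y => cvec (r y) (s y)) x = cvec (partial c a r x) (partial c a s x).
Proof.
rewrite /cpd !partialE; under eq_fun do rewrite mxRe_cvec.
by under [in X in _ + X]eq_fun do rewrite mxIm_cvec.
Qed.

Definition csmooth_in c (w : M -> CV) : Prop :=
  smooth_in c (fun x => mxRe (w x)) /\ smooth_in c (fun x => mxIm (w x)).

Lemma csmooth_in_cvec c (w : M -> CV) (r s : M -> RV) :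
  smooth_in c r -> smooth_in c s -> (forall x, w x = cvec (r x) (s x)) ->
  csmooth_in c w.
Proof.
move=> Cr Cs wE; split; [move: Cr|move: Cs]; apply: smooth_in_eq => x _;
  by rewrite wE ?mxRe_cvec ?mxIm_cvec.
Qed.

Lemma csmooth_inD c (w w' : M -> CV) :
  csmooth_in c w -> csmooth_in c w' -> csmooth_in c (fun x => w x + w' x).
Proof.
move=> [C1 C2] [C1' C2'].
apply: (csmooth_in_cvec (smooth_inD C1 C1') (smooth_inD C2 C2')) => x.
by rewrite -cvecD !cvecK.
Qed.

Lemma csmooth_inZ c (l : R[i]) (w : M -> CV) :
  csmooth_in c w -> csmooth_in c (fun x => l *: w x).
Proof.
move=> [C1 C2]; have Cl (k : R) := @smooth_in_cst _ _ c _ k.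
apply: (csmooth_in_cvec
  (smooth_inD (smooth_inZ (Cl (complex.Re l)) C1) (smooth_inN (smooth_inZ (Cl (complex.Im l)) C2)))
  (smooth_inD (smooth_inZ (Cl (complex.Re l)) C2) (smooth_inZ (Cl (complex.Im l)) C1))) => x.
by rewrite -cvecZc cvecK.
Qed.

Lemma cpdD c a (w w' : M -> CV) x : dom c x ->
  csmooth_in c w -> csmooth_in c w' ->
  cpd c a (fun y => w y + w' y) x = cpd c a w x + cpd c a w' x.
Proof.
move=> cx [C1 C2] [C1' C2'].
have -> : (fun y => w y + w' y) =
    fun y => cvec (mxRe (w y) + mxRe (w' y)) (mxIm (w y) + mxIm (w' y)).
  by apply/funext => y; rewrite -cvecD !cvecK.
rewrite cpd_cvec (partialD a cx C1 C1') (partialD a cx C2 C2') -cvecD.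
by rewrite /cpd -!partialE.
Qed.

Lemma cpdZ c a (l : R[i]) (w : M -> CV) x : dom c x -> csmooth_in c w ->
  cpd c a (fun y => l *: w y) x = l *: cpd c a w x.
Proof.
move=> cx [C1 C2]; have Cl (k : R) := @smooth_in_cst _ _ c _ k.
have -> : (fun y => l *: w y) = fun y => cvec
    (complex.Re l *: mxRe (w y) - complex.Im l *: mxIm (w y))
    (complex.Re l *: mxIm (w y) + complex.Im l *: mxRe (w y)).
  by apply/funext => y; rewrite -cvecZc !cvecK.
have pZ (k : R) (u : M -> RV) : smooth_in c u ->
    partial c a (fun y => k *: u y) x = k *: partial c a u x.
  by move=> Cu; rewrite (partialZ a cx (Cl k) Cu) partial_cst scale0r add0r.
have CZ (k : R) (u : M -> RV) : smooth_in c u -> smooth_in c (fun y => k *: u y).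
  by move=> Cu; exact: (smooth_inZ (Cl k) Cu).
rewrite cpd_cvec (partialD a cx (CZ _ _ C1) (smooth_inN (CZ _ _ C2))).
rewrite (partialD a cx (CZ _ _ C2) (CZ _ _ C1)) (partialN a cx (CZ _ _ C2)) !pZ//.
by rewrite -cvecZc /cpd -!partialE.
Qed.

End ComplexCalculus.

Section LaurentPolynomials.

Lemma poly7_eq0 (K : numFieldType) (e : nat -> K) :
  (forall l : K, l != 0 -> \sum_(j < 7) e j * l ^+ j = 0) ->
  forall j, (j < 7)%N -> e j = 0.
Proof.
move=> e0 j j7; pose P := \poly_(i < 7) e i.
suff P0 : P = 0 by have := coef_poly 7 e j; rewrite -/P P0 coef0 j7.
apply/eqP; apply: contraT => Pn0.
pose rs : seq K := [seq i.+1%:R | i <- iota 0 7].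
have : (size rs < size P)%N.
  apply: max_poly_roots => //.
    apply/allP => _ /mapP[i _ ->]; rewrite /root horner_poly e0 ?pnatr_eq0//.
  rewrite map_inj_uniq ?iota_uniq// => i k /eqP.
  by rewrite eqr_nat eqSS => /eqP.
by rewrite size_map size_iota ltnNge size_poly.
Qed.

Lemma laurent_coef2 (K : numFieldType)
    (d1 d2 d3 n1 n2 n3 m1 m2 m3 q1 q2 q3 r1 r2 r3 : K) :
  (forall l, l != 0 ->
    (l^-1 * d1 + d2 + l * d3) + l * (l^-1 * n1 + n2 + l * n3) +
    l^-1 * (l^-1 * m1 + m2 + l * m3) +
    (l ^+ 2 - 1) * (l^-1 * q1 + q2 + l * q3) +
    (l ^- 2 - 1) * (l^-1 * r1 + r2 + l * r3) = 0) -> n3 + q2 = 0.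
Proof.
move=> E; pose e j := [:: r1; m1 + r2; d1 + m2 - q1 + r3 - r1;
  d2 + n1 + m3 - q2 - r2; d3 + n2 + q1 - q3 - r3; n3 + q2; q3]`_j.
apply: (@poly7_eq0 _ e _ 5) => // l l0.
rewrite !big_ord_recl big_ord0 /= /bump /= !add1n /e /=.
rewrite -[RHS](mulr0 (l ^+ 3)) -[X in _ = _ * X](E l l0); field; exact: l0.
Qed.

End LaurentPolynomials.

(** * Lorentzian linear algebra *)

Fact ip_key : unit. Proof. exact: tt. Qed.

(* [lor], locked for the same reason as [partial]. *)
Definition ip (K : pzRingType) (n : nat) : 'cV[K]_n.+2 -> 'cV[K]_n.+2 -> K :=
  locked_with ip_key (@lor K n).

Lemma ipE (K : pzRingType) (n : nat) (u v : 'cV[K]_n.+2) : ip u v = lor u v.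
Proof. by rewrite /ip unlock. Qed.

Section Lorentz.
Variables (K : comPzRingType) (n : nat).
Implicit Types (u v w : 'cV[K]_n.+2) (k : K).

Definition lorentz_mx : 'M[K]_n.+2 :=
  diag_mx (\row_j (if j == ord_max then -1 else 1)).

Lemma lorE u v : ip u v = (u^T *m lorentz_mx *m v) 0 0.
Proof.
rewrite ipE mxE big_ord_recr /= /lor; congr (_ + _).
  apply: eq_bigr => i _; rewrite /lorentz_mx mul_mx_diag !mxE.
  case: eqP => [E|_]; last by rewrite mulr1.
  by have := congr1 val E; rewrite /= => E'; have := ltn_ord i; rewrite E' ltnn.
by rewrite /lorentz_mx mul_mx_diag !mxE eqxx mulrN1 mulNr.
Qed.

Lemma lorC u v : ip u v = ip v u.
Proof. by rewrite !ipE /lor; congr (_ - _); [apply: eq_bigr => i _|]; rewrite mulrC. Qed.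

Lemma lorDr u v w : ip u (v + w) = ip u v + ip u w.
Proof. by rewrite !lorE mulmxDr mxE. Qed.

Lemma lorDl u v w : ip (u + v) w = ip u w + ip v w.
Proof. by rewrite lorC lorDr !(lorC w). Qed.

Lemma lorZr k u v : ip u (k *: v) = k * ip u v.
Proof. by rewrite !lorE -scalemxAr mxE. Qed.

Lemma lorZl k u v : ip (k *: u) v = k * ip u v.
Proof. by rewrite lorC lorZr lorC. Qed.

Lemma lorNr u v : ip u (- v) = - ip u v.
Proof. by rewrite -scaleN1r lorZr mulN1r. Qed.

Lemma lorNl u v : ip (- u) v = - ip u v.
Proof. by rewrite lorC lorNr lorC. Qed.

Lemma lor0r u : ip u 0 = 0.
Proof. by rewrite -(scale0r 0) lorZr mul0r. Qed.

Lemma lor0l u : ip 0 u = 0.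
Proof. by rewrite lorC lor0r. Qed.

Definition lor_lin := (lorDl, lorDr, lorNl, lorNr, lorZl, lorZr).

Lemma lor_suml (I : finType) (F : I -> 'cV[K]_n.+2) v :
  ip (\sum_i F i) v = \sum_i ip (F i) v.
Proof. by elim/big_rec2: _ => [|i x y _ <-]; rewrite ?lor0l ?lorDl. Qed.

Definition wip u v w : 'cV[K]_n.+2 := ip u w *: v - ip v w *: u.

Lemma wedgeE u v w : wedge u v w = wip u v w.
Proof. by rewrite /wip !ipE. Qed.

Definition wip_mx u v : 'M[K]_n.+2 :=
  v *m (u^T *m lorentz_mx) - u *m (v^T *m lorentz_mx).

Lemma mul_wip_mx u v w : wip_mx u v *m w = wip u v w.
Proof.
rewrite mulmxBl -!mulmxA !(mulmxA _ lorentz_mx w).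
by rewrite [X in v *m X]mx11_scalar [X in u *m X]mx11_scalar -!lorE !mul_mx_scalar.
Qed.

Lemma wipDr u v w w' : wip u v (w + w') = wip u v w + wip u v w'.
Proof. by rewrite /wip !lorDr !scalerDl opprD addrACA. Qed.

Lemma wipZr u v k w : wip u v (k *: w) = k *: wip u v w.
Proof. by rewrite /wip !lorZr scalerBr !scalerA. Qed.

Lemma wip_comm p q u w r :
  wip p q (wip u w r) - wip u w (wip p q r) =
  wip (wip p q u) w r + wip u (wip p q w) r.
Proof.
rewrite /wip !lor_lin (lorC u p) (lorC u q) (lorC w p) (lorC w q).
by apply/matrixP => i j; rewrite !mxE; ring.
Qed.

Lemma lor_eq0 u : (forall v, ip u v = 0) -> u = 0.
Proof.
move=> u0; apply/matrixP => i j; rewrite ord1 mxE.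
have := u0 (lorentz_mx *m delta_mx i 0); rewrite lorE -!mulmxA mulmxA.
have LL : lorentz_mx *m lorentz_mx = 1%:M.
  rewrite /lorentz_mx mulmx_diag -diag_const_mx; congr diag_mx.
  by apply/rowP => j'; rewrite !mxE; case: ifP; rewrite ?mulrNN mulr1.
rewrite mulmxA -[_ *m lorentz_mx *m lorentz_mx]mulmxA LL mulmx1 mxE (bigD1 i)//= big1.
  by rewrite !mxE !eqxx mulr1 addr0.
by move=> k ki; rewrite !mxE (negPf ki) /= mulr0.
Qed.

End Lorentz.

Section LorentzReal.
Variables (R : realType) (n : nat).
Local Notation RV := 'cV[R]_n.+2.
Implicit Types (u v w r s : RV).

Lemma lor_cplx u v : ip (cplx u) (cplx v) = (ip u v)%:C.
Proof.
rewrite !ipE /lor rmorphB rmorphM rmorph_sum /=; congr (_ - _).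
  by apply: eq_bigr => i _; rewrite !mxE rmorphM.
by rewrite !mxE.
Qed.

Lemma lor_cvec r s u : ip (cvec r s) (cplx u) = ip r u +i* ip s u.
Proof.
by rewrite /cvec lorDl lorZl !lor_cplx [RHS]complexE.
Qed.

Lemma wedge_cvec u v r s :
  wedge (cplx u) (cplx v) (cvec r s) = cvec (wedge u v r) (wedge u v s).
Proof.
rewrite /wedge -!ipE -[cvec (_ - _) _]cvecD -[cvec (- _) _]cvecN; congr (_ - _).
  rewrite lorC lor_cvec [X in X *: _]complexE /= scalerDl.
  by rewrite cplxE -scalerA !cvecZ cvecZi cvecD !scaler0 oppr0 addr0 add0r !(lorC u).
rewrite lorC lor_cvec [X in X *: _]complexE /= scalerDl.
by rewrite cplxE -scalerA !cvecZ cvecZi cvecD !scaler0 oppr0 addr0 add0r !(lorC v).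
Qed.

Lemma lightcone_last s : lightcone s -> s ord_max 0 != 0.
Proof.
move=> [s0 ss]; apply/negP => /eqP E; move/eqP: s0; apply.
move: ss; rewrite /lor E mulr0 subr0 => H.
apply/matrixP => i j; rewrite ord1 mxE.
have [/eqP->//|ni] := boolP (i == ord_max).
have iP : (i < n.+1)%N.
  by rewrite ltn_neqAle -ltnS ltn_ord andbT; apply: contra ni => /eqP E'; apply/eqP/val_inj.
have -> : i = widen_ord (leqnSn n.+1) (Ordinal iP) by apply/val_inj.
have Hi (k : 'I_n.+1) : true ->
    0 <= s (widen_ord (leqnSn n.+1) k) 0 * s (widen_ord (leqnSn n.+1) k) 0.
  by rewrite -expr2 sqr_ge0.
have /eqP := H; rewrite psumr_eq0// => /allP /(_ (Ordinal iP)).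
by rewrite mem_index_enum => /(_ isT) /=; rewrite mulf_eq0 orbb => /eqP.
Qed.

(* Subtracting from [w] the multiple of [s] with the same timelike coordinate
   leaves a spacelike vector of the same Lorentzian square. *)
Lemma lor_perp_null s w : lightcone s -> ip s w = 0 ->
  0 <= ip w w /\ (ip w w = 0 -> w = (w ord_max 0 / s ord_max 0) *: s).
Proof.
move=> ls sw; have sl := lightcone_last ls; have [_] := ls; rewrite -ipE => ss.
set k := _ / _; pose y := w - k *: s.
have yl : y ord_max 0 = 0 by rewrite !mxE /k divfK// subrr.
have -> : ip w w = ip y y.
  by rewrite /y !lor_lin ss (lorC w s) sw; ring.
have yy : ip y y = \sum_(i < n.+1) (y (widen_ord (leqnSn n.+1) i) 0) ^+ 2.
  by rewrite ipE /lor yl mulr0 subr0; apply: eq_bigr => i _; rewrite expr2.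
have Hi : forall k : 'I_n.+1, true -> 0 <= (y (widen_ord (leqnSn n.+1) k) 0) ^+ 2.
  by move=> i _; rewrite sqr_ge0.
rewrite yy; split; first by rewrite sumr_ge0.
move=> /eqP; rewrite psumr_eq0// => /allP y0.
apply/subr0_eq; rewrite -/y; apply/matrixP => i j; rewrite ord1 [RHS]mxE.
have [/eqP->//|ni] := boolP (i == ord_max).
have iP : (i < n.+1)%N.
  by rewrite ltn_neqAle -ltnS ltn_ord andbT; apply: contra ni => /eqP E'; apply/eqP/val_inj.
have -> : i = widen_ord (leqnSn n.+1) (Ordinal iP) by apply/val_inj.
by have := y0 (Ordinal iP); rewrite mem_index_enum => /(_ isT) /=; rewrite sqrf_eq0 => /eqP.
Qed.

Lemma free3_eq0 (V : vectType R) (s a b : V) x y z : free [:: s; a; b] ->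
  x *: s + y *: a + z *: b = 0 -> [/\ x = 0, y = 0 & z = 0].
Proof.
move=> /(@freeP _ _ 3 [tuple s; a; b]) fr E.
have := fr (fun i => [:: x; y; z]`_i); rewrite !big_ord_recl big_ord0 /= addr0 addrA.
by move=> /(_ E) k0; split; [have := k0 0|have := k0 1|have := k0 2].
Qed.

Lemma gram_pos s a b : lightcone s -> ip s a = 0 -> ip s b = 0 ->
  free [:: s; a; b] -> 0 < ip a a /\ 0 < ip a a * ip b b - ip a b ^+ 2.
Proof.
move=> ls sa sb fr.
have aa : 0 < ip a a.
  have [a0 aE] := lor_perp_null ls sa; rewrite lt_def a0 andbT.
  apply/eqP => /aE E; set k := _ / _ in E.
  have [|_ /eqP] := @free3_eq0 _ s a b (- k) 1 0 fr; last by rewrite oner_eq0.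
  by rewrite scale1r scale0r addr0 {1}E scaleNr addNr.
split=> //; pose w := ip a a *: b - ip a b *: a.
have sw : ip s w = 0 by rewrite /w !lor_lin sa sb !mulr0 subrr.
have ww : ip w w = ip a a * (ip a a * ip b b - ip a b ^+ 2).
  by rewrite /w !lor_lin (lorC b a); ring.
have [w0 wE] := lor_perp_null ls sw.
have : 0 < ip w w.
  rewrite lt_def w0 andbT; apply/eqP => /wE E; set k := _ / _ in E.
  have [|_ _ E'] := @free3_eq0 _ s a b (- k) (- ip a b) (ip a a) fr.
    by rewrite !scaleNr -addrA [- _ + _ *: b]addrC -/w {1}E addNr.
  by rewrite E' ltxx in aa.
by rewrite ww pmulr_rgt0.
Qed.

End LorentzReal.

Section Frame.
Variable R : realType.
Local Notation RV := 'cV[R]_5.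
Implicit Types (f v a b w : RV).

Definition frame_mx w f v a b : 'M[R]_5 :=
  col_mx w^T (col_mx (col_mx f^T v^T) (col_mx a^T b^T)) : 'M[R]_(1 + ((1 + 1) + (1 + 1)), 5).

Definition cross f v a b : RV :=
  \col_j ((if j == ord_max then -1 else 1) * cofactor (frame_mx 0 f v a b) 0 j).

Definition row5 (x0 x1 x2 x3 x4 : R) : 'rV[R]_5 :=
  row_mx x0%:M (row_mx (row_mx x1%:M x2%:M) (row_mx x3%:M x4%:M))
    : 'rV[R]_(1 + ((1 + 1) + (1 + 1))).

Lemma row5P (y : 'rV[R]_5) : exists x0 x1 x2 x3 x4, y = row5 x0 x1 x2 x3 x4.
Proof.
pose yr : 'rV[R]_(1 + ((1 + 1) + (1 + 1))) := y; rewrite -[y]/yr -[yr]hsubmxK.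
rewrite -[rsubmx yr]hsubmxK -[lsubmx (rsubmx yr)]hsubmxK -[rsubmx (rsubmx yr)]hsubmxK.
rewrite (mx11_scalar (lsubmx yr)) (mx11_scalar (lsubmx (lsubmx (rsubmx yr)))).
rewrite (mx11_scalar (rsubmx (lsubmx (rsubmx yr)))).
rewrite (mx11_scalar (lsubmx (rsubmx (rsubmx yr)))).
rewrite (mx11_scalar (rsubmx (rsubmx (rsubmx yr)))).
by do 5 eexists.
Qed.

Lemma row5_mulmx x0 x1 x2 x3 x4 w f v a b :
  row5 x0 x1 x2 x3 x4 *m frame_mx w f v a b =
  (x0 *: w + x1 *: f + x2 *: v + x3 *: a + x4 *: b)^T.
Proof.
rewrite [LHS](@mul_row_col _ 1 1 ((1 + 1) + (1 + 1)) 5) !mul_row_col !mul_scalar_mx.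
by rewrite !addrA -!linearZ -!linearD.
Qed.

Lemma row5_0 : row5 0 0 0 0 0 = 0.
Proof.
have S0 : 0%:M = 0 :> 'M[R]_1 by apply/matrixP => i j; rewrite !mxE mul0rn.
by rewrite /row5 S0 !row_mx0.
Qed.

Lemma frame_mx_mul w f v a b (u : RV) :
  ip w u = 0 -> ip f u = 0 -> ip v u = 0 -> ip a u = 0 -> ip b u = 0 ->
  frame_mx w f v a b *m (lorentz_mx R 3 *m u) = 0.
Proof.
move=> wu fu vu au bu; rewrite [LHS](@mul_col_mx _ 1 ((1 + 1) + (1 + 1)) 5 1).
rewrite !mul_col_mx !mulmxA.
have E z : ip z u = 0 -> z^T *m lorentz_mx R 3 *m u = 0.
  by move=> zu; apply/matrixP => i j; rewrite !ord1 -lorE zu mxE.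
by rewrite !E// !col_mx0.
Qed.

Lemma lor_cross w f v a b : ip w (cross f v a b) = \det (frame_mx w f v a b).
Proof.
rewrite (expand_det_row _ 0) lorE [LHS]mxE; apply: eq_bigr => j _.
rewrite /lorentz_mx mul_mx_diag [LHS]mulrC ![in LHS]mxE.
have -> : cofactor (frame_mx w f v a b) 0 j = cofactor (frame_mx 0 f v a b) 0 j.
  rewrite /cofactor; congr (_ * \det _); apply/matrixP => i k; rewrite !mxE.
  by case: splitP => // i'; rewrite (ord1 i').
have -> : frame_mx w f v a b 0 j = w j 0.
  by rewrite /frame_mx mxE; case: splitP => // i'; rewrite (ord1 i') mxE.
by case: ifP => _; ring.
Qed.

Lemma mul_lor u w : u^T *m lorentz_mx R 3 *m w = (ip u w)%:M :> 'M[R]_1.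
Proof. by rewrite lorE -mx11_scalar. Qed.

Lemma det_mx2 (A : 'M[R]_2) : \det A = A 0 0 * A 1 1 - A 0 1 * A 1 0.
Proof.
rewrite (expand_det_row _ 0) !big_ord_recl big_ord0 /cofactor !det_mx11 !mxE.
have -> : lift 0 0 = 1 :> 'I_2 by exact/val_inj.
have -> : lift 1 0 = 0 :> 'I_2 by exact/val_inj.
by rewrite /= /bump /= addn0 addr0 expr0 expr1 mul1r mulN1r mulrN.
Qed.

Lemma det_block11 (x y z t : R) :
  \det (block_mx x%:M y%:M z%:M t%:M : 'M[R]_(1 + 1)) = x * t - y * z.
Proof.
rewrite det_mx2 !mxE; case: splitP => // i; rewrite (ord1 i) => _.
case: splitP => [i'|i']; rewrite (ord1 i') => // _.
rewrite !mxE; case: splitP => j1; rewrite (ord1 j1) // => _.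
case: splitP => j2; rewrite (ord1 j2) // => _.
by rewrite !mxE.
Qed.

Lemma det_frame_mx2 w f v a b :
  ip f f = 0 -> ip f v = -1 -> ip f a = 0 -> ip f b = 0 ->
  ip v a = 0 -> ip v b = 0 ->
  ip w f = 0 -> ip w v = 0 -> ip w a = 0 -> ip w b = 0 ->
  \det (frame_mx w f v a b) ^+ 2 = ip w w * (ip a a * ip b b - ip a b ^+ 2).
Proof.
move=> ff fv fa fb va vb wf wv wa wb.
have detL : \det (lorentz_mx R 3) = -1.
  by rewrite /lorentz_mx det_diag !big_ord_recr big_ord0 /= !mxE /= !mul1r.
have : \det (frame_mx w f v a b *m lorentz_mx R 3 *m (frame_mx w f v a b)^T) =
   - (ip w w * (ip a a * ip b b - ip a b ^+ 2)).
  pose P : 'M[R]_(1 + ((1 + 1) + (1 + 1)), 5) :=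
    col_mx w^T (col_mx (col_mx f^T v^T) (col_mx a^T b^T)).
  transitivity (\det (P *m lorentz_mx R 3 *m P^T)); first by [].
  have PL : P *m lorentz_mx R 3 = col_mx (w^T *m lorentz_mx R 3) (col_mx
      (col_mx (f^T *m lorentz_mx R 3) (v^T *m lorentz_mx R 3))
      (col_mx (a^T *m lorentz_mx R 3) (b^T *m lorentz_mx R 3))).
    by rewrite /P !mul_col_mx.
  rewrite PL /P !tr_col_mx !trmxK !mul_col_row !mul_mx_row !mul_col_mx.
  rewrite !mul_lor !(lorC f w) !(lorC v w) !(lorC a w) !(lorC b w) wf wv wa wb.
  rewrite (lorC v f) !(lorC a f) !(lorC b f) !(lorC a v) !(lorC b v) ff fv fa fb va vb.
  have S0 : 0%:M = 0 :> 'M[R]_1 by apply/matrixP => i j; rewrite !mxE mul0rn.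
  have B := det_block11 0 (-1) (-1) (ip v v); rewrite S0 in B.
  rewrite !S0 !row_mx0 !col_mx0 det_ublock !block_mx0 det_ublock B det_block11 det_scalar1.
  by rewrite (lorC b a); ring.
rewrite !det_mulmx det_tr detL mulrN1 mulNr => /oppr_inj <-.
by rewrite expr2.
Qed.

Lemma frame_eq0 f v a b w x0 x1 x2 x3 x4 :
  ip f f = 0 -> ip f v = -1 -> ip f a = 0 -> ip f b = 0 ->
  ip v a = 0 -> ip v b = 0 ->
  ip w f = 0 -> ip w v = 0 -> ip w a = 0 -> ip w b = 0 ->
  0 < ip a a * ip b b - ip a b ^+ 2 ->
  x0 *: w + x1 *: f + x2 *: v + x3 *: a + x4 *: b = 0 ->
  [/\ x0 *: w = 0, x1 = 0, x2 = 0, x3 = 0 & x4 = 0].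
Proof.
move=> ff fv fa fb va vb wf wv wa wb g0 E.
have F z : ip (x0 *: w + x1 *: f + x2 *: v + x3 *: a + x4 *: b) z = 0.
  by rewrite E lor0l.
have := F f; rewrite !lor_lin ff wf (lorC v) fv (lorC a) fa (lorC b) fb => Ff.
have x20 : x2 = 0 by move: Ff; lra.
have := F v; rewrite !lor_lin fv wv (lorC a) va (lorC b) vb x20 => Fv.
have x10 : x1 = 0 by move: Fv; lra.
have := F a; rewrite !lor_lin fa wa va (lorC b) => Fa.
have := F b; rewrite !lor_lin fb wb vb => Fb.
have x30 : x3 = 0.
  apply: (mulIf (lt0r_neq0 g0)); rewrite mul0r.
  have -> : x3 * (ip a a * ip b b - ip a b ^+ 2) =
    ip b b * (x3 * ip a a + x4 * ip a b) -
    ip a b * (x3 * ip a b + x4 * ip b b) by ring.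
  by move: Fa Fb; rewrite !mulr0 !add0r => -> ->; rewrite !mulr0 subrr.
have x40 : x4 = 0.
  apply: (mulIf (lt0r_neq0 g0)); rewrite mul0r.
  have -> : x4 * (ip a a * ip b b - ip a b ^+ 2) =
    ip a a * (x3 * ip a b + x4 * ip b b) -
    ip a b * (x3 * ip a a + x4 * ip a b) by ring.
  by move: Fa Fb; rewrite !mulr0 !add0r => -> ->; rewrite !mulr0 subrr.
by move: E; rewrite x10 x20 x30 x40 !scale0r !addr0.
Qed.

Lemma frame_det_neq0 f v a b w : w != 0 ->
  ip f f = 0 -> ip f v = -1 -> ip f a = 0 -> ip f b = 0 ->
  ip v a = 0 -> ip v b = 0 ->
  ip w f = 0 -> ip w v = 0 -> ip w a = 0 -> ip w b = 0 ->
  0 < ip a a * ip b b - ip a b ^+ 2 -> \det (frame_mx w f v a b) != 0.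
Proof.
move=> w0 ff fv fa fb va vb wf wv wa wb g0.
rewrite -unitfE -[_ \is a _]/(_ \in unitmx) -row_free_unit; apply: inj_row_free => y yP.
have [y0 [y1 [y2 [y3 [y4 yE]]]]] := row5P y; move: yP.
rewrite yE row5_mulmx -[RHS](trmx0 R 5 1) => /trmx_inj E.
have [E0 -> -> -> ->] := frame_eq0 ff fv fa fb va vb wf wv wa wb g0 E.
by move/eqP: E0; rewrite scaler_eq0 (negPf w0) orbF => /eqP ->; rewrite row5_0.
Qed.

Lemma frame_perp_eq0 f v a b w u : w != 0 ->
  ip f f = 0 -> ip f v = -1 -> ip f a = 0 -> ip f b = 0 ->
  ip v a = 0 -> ip v b = 0 ->
  ip w f = 0 -> ip w v = 0 -> ip w a = 0 -> ip w b = 0 ->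
  0 < ip a a * ip b b - ip a b ^+ 2 ->
  ip w u = 0 -> ip f u = 0 -> ip v u = 0 -> ip a u = 0 -> ip b u = 0 ->
  u = 0.
Proof.
move=> w0 ff fv fa fb va vb wf wv wa wb g0 wu fu vu au bu.
have := frame_det_neq0 w0 ff fv fa fb va vb wf wv wa wb g0.
rewrite -unitfE -[_ \is a _]/(_ \in unitmx) => uP.
have PLu := frame_mx_mul wu fu vu au bu.
have Lu : lorentz_mx R 3 *m u = 0 by rewrite -(mulKmx uP (_ *m u)) PLu mulmx0.
by apply: lor_eq0 => z; rewrite lorC lorE -mulmxA Lu mulmx0 mxE.
Qed.

Lemma lor_cross_cross f v a b :
  ip f f = 0 -> ip f v = -1 -> ip f a = 0 -> ip f b = 0 ->
  ip v a = 0 -> ip v b = 0 ->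
  0 < ip a a * ip b b - ip a b ^+ 2 ->
  [/\ ip (cross f v a b) f = 0, ip (cross f v a b) v = 0,
      ip (cross f v a b) a = 0, ip (cross f v a b) b = 0 &
      ip (cross f v a b) (cross f v a b) = ip a a * ip b b - ip a b ^+ 2].
Proof.
move=> ff fv fa fb va vb g0; set X := cross f v a b.
have X0 x1 x2 x3 x4 z : z = x1 *: f + x2 *: v + x3 *: a + x4 *: b -> ip X z = 0.
  move=> zE; rewrite lorC lor_cross; apply/eqP/det0P.
  exists (row5 (-1) x1 x2 x3 x4).
    apply/eqP => E; have := congr1 (fun A : 'rV_5 => A 0 0) E.
    rewrite /row5 !mxE; case: splitP => // i _; rewrite (ord1 i) mxE => /eqP.
    by rewrite oppr_eq0 oner_eq0.
  by rewrite row5_mulmx -!addrA (addrA (x1 *: f)) -!addrA zE -!addrA scaleN1r addNr trmx0.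
have Xf : ip X f = 0 by apply: (X0 1 0 0 0); rewrite !scale0r !addr0 scale1r.
have Xv : ip X v = 0 by apply: (X0 0 1 0 0); rewrite !scale0r !addr0 add0r scale1r.
have Xa : ip X a = 0 by apply: (X0 0 0 1 0); rewrite !scale0r !addr0 !add0r scale1r.
have Xb : ip X b = 0 by apply: (X0 0 0 0 1); rewrite !scale0r !add0r scale1r.
split => //.
have [w w0 [wf wv wa wb]] : exists2 w : RV, w != 0 &
    [/\ ip w f = 0, ip w v = 0, ip w a = 0 & ip w b = 0].
  pose A := lorentz_mx R 3 *m row_mx (row_mx f v) (row_mx a b).
  have kA : kermx A != 0.
    rewrite -mxrank_eq0 mxrank_ker subn_eq0 -ltnNge.
    exact: (leq_ltn_trans (rank_leq_col _)).
  exists (nz_row (kermx A))^T.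
    by rewrite -(trmx0 R 1 5) (inj_eq trmx_inj) nz_row_eq0.
  have : nz_row (kermx A) *m A = 0 by apply/sub_kermxP; exact: nz_row_sub.
  rewrite /A mulmxA !mul_mx_row -{1}[0]hsubmxK => /eq_row_mx [].
  rewrite -{1}[lsubmx 0]hsubmxK -{1}[rsubmx 0]hsubmxK.
  move=> /eq_row_mx [E1 E2] /eq_row_mx [E3 E4].
  by split; rewrite lorE trmxK ?E1 ?E2 ?E3 ?E4 !mxE.
have dP := frame_det_neq0 w0 ff fv fa fb va vb wf wv wa wb g0.
have d2 := det_frame_mx2 ff fv fa fb va vb wf wv wa wb.
rewrite -lor_cross -/X in dP d2.
have ww : ip w w != 0.
  by apply: contra_neq dP => ww; move/eqP: d2; rewrite ww mul0r sqrf_eq0 => /eqP.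
have XE : X = (ip w X / ip w w) *: w.
  apply/subr0_eq; apply: (frame_perp_eq0 w0 ff fv fa fb va vb wf wv wa wb g0);
    rewrite !lor_lin.
  - by rewrite divfK// subrr.
  - by rewrite (lorC f X) Xf (lorC f w) wf mulr0 subrr.
  - by rewrite (lorC v X) Xv (lorC v w) wv mulr0 subrr.
  - by rewrite (lorC a X) Xa (lorC a w) wa mulr0 subrr.
  - by rewrite (lorC b X) Xb (lorC b w) wb mulr0 subrr.
rewrite {1}XE lorZl; apply: (mulfI ww).
by rewrite mulrA [_ * (_ / _)]mulrC divfK// -d2 expr2.
Qed.

Lemma cross_transform f v a b (T : 'M[R]_2) :
  cross f v (T 0 0 *: a + T 0 1 *: b) (T 1 0 *: a + T 1 1 *: b) =
  \det T *: cross f v a b.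
Proof.
apply/subr0_eq; apply: lor_eq0 => w; rewrite lorC !lor_lin !lor_cross.
pose P : 'M[R]_(1 + ((1 + 1) + (1 + 1)), 5) :=
  col_mx w^T (col_mx (col_mx f^T v^T) (col_mx a^T b^T)).
pose B : 'M[R]_(1 + ((1 + 1) + (1 + 1))) := block_mx 1%:M 0 0 (block_mx 1%:M 0 0 T).
have TE : T *m (col_mx a^T b^T : 'M[R]_(1 + 1, 5)) =
    col_mx (T 0 0 *: a + T 0 1 *: b)^T (T 1 0 *: a + T 1 1 *: b)^T.
  apply/matrixP => i j; rewrite !mxE !big_ord_recl big_ord0 addr0 !mxE.
  have -> : lift ord0 ord0 = 1 :> 'I_2 by exact/val_inj.
  case: splitP => k; rewrite (ord1 k) // => _.
  case: splitP => l; rewrite (ord1 l) // => _.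
  case: splitP => i'; rewrite (ord1 i') !mxE => iE.
    by have -> : i = 0 by exact/val_inj.
  by have -> : i = 1 by exact/val_inj.
have E : frame_mx w f v (T 0 0 *: a + T 0 1 *: b) (T 1 0 *: a + T 1 1 *: b) = B *m P.
  rewrite /B /P !mul_block_col !mul1mx !mul0mx !addr0 !add0r.
  by rewrite TE.
have dB : \det B = \det T by rewrite /B !det_ublock !det1 !mul1r.
have -> := etrans (congr1 determinant E) (det_mulmx B P).
by rewrite dB subrr.
Qed.

End Frame.

Lemma ord2P (i : 'I_2) : i = 0 \/ i = 1.
Proof. by case: i => -[|[|//]] ?; [left|right]; exact/val_inj. Qed.

Lemma sum2E (V : nmodType) (F : 'I_2 -> V) : \sum_i F i = F 0 + F 1.
Proof.
rewrite !big_ord_recl big_ord0 addr0; congr (F _ + F _); exact/val_inj.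
Qed.

Section InverseMatrix2.
Variable R : realType.

Lemma invmx2 (A : 'M[R]_2) : \det A != 0 -> invmx A =
  (\det A)^-1 *: \matrix_(i, j) (if i == j then A (i + 1) (i + 1) else - A i j).
Proof.
move=> dA; have uA : A \in unitmx by rewrite unitmxE unitfE.
set B := _ *: _; suff AB : A *m B = 1%:M by rewrite -[B]mul1mx -(mulVmx uA) -mulmxA AB mulmx1.
have O : 1 + 1 = 0 :> 'I_2 by exact/val_inj.
rewrite /B -scalemxAr; apply/matrixP => i j; rewrite !mxE sum2E !mxE.
apply: (mulfI dA); rewrite mulrA divff// mul1r.
by rewrite det_mx2; case: (ord2P i) => ->; case: (ord2P j) => ->;
  rewrite /= ?add0r ?O /=; ring.
Qed.

Lemma mxtrace_invmx2 (A B : 'M[R]_2) : \det A != 0 ->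
  \tr (invmx A *m B) =
  (A 1 1 * B 0 0 - A 0 1 * B 1 0 - A 1 0 * B 0 1 + A 0 0 * B 1 1) / \det A.
Proof.
move=> dA; have O : 1 + 1 = 0 :> 'I_2 by exact/val_inj.
rewrite invmx2// /mxtrace sum2E !mxE !sum2E !mxE /= ?add0r O /=.
by field.
Qed.

Lemma mxtrace_conj n (T X : 'M[R]_n) : T \in unitmx ->
  \tr (invmx T *m X *m T) = \tr X.
Proof. by move=> uT; rewrite mxtrace_mulC mulmxA mulmxV// mul1mx. Qed.

Lemma mxtrace_shape_congr n (T g h : 'M[R]_n) : T \in unitmx -> g \in unitmx ->
  \tr (invmx (T *m g *m T^T) *m (T *m h *m T^T)) = \tr (invmx g *m h).
Proof.
move=> uT ug; have uTt : T^T \in unitmx by rewrite unitmx_tr.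
have uTg : T *m g *m T^T \in unitmx by rewrite !unitmx_mul uT ug uTt.
rewrite -(mxtrace_conj (invmx g *m h) uTt); congr (\tr _).
by apply: (canLR (mulKmx uTg)); rewrite -!mulmxA (mulKVmx uTt) (mulKVmx ug).
Qed.

End InverseMatrix2.

Lemma gram_transform (R : realType) (n : nat) (T : 'M[R]_2) (u w : 'I_2 -> 'cV[R]_n.+2) :
  T *m (\matrix_(a, b) ip (u a) (w b)) *m T^T =
  \matrix_(a, b) ip (\sum_i T a i *: u i) (\sum_i T b i *: w i).
Proof.
apply/matrixP => a b; rewrite [RHS]mxE [LHS]mxE !sum2E.
rewrite ![(T *m _) _ _]mxE !sum2E ![T^T _ _]mxE ![(\matrix_(a, b) _) _ _]mxE.
rewrite !lor_lin.
move: (ip (u 0) (w 0)) (ip (u 0) (w 1)) (ip (u 1) (w 0)) (ip (u 1) (w 1)).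
move: (T a 0) (T a 1) (T b 0) (T b 1) => *; ring.
Qed.

Section SmoothDeterminant.
Variables (R : realType) (M : oriented_surface R) (c : chart M).

Lemma smooth_in_det n (A : M -> 'M[R]_n) :
  (forall i j, smooth_in c (fun x => A x i j)) -> smooth_in c (fun x => \det (A x)).
Proof.
move=> CA; apply: smooth_in_sum => s; apply: smooth_inM.
  exact: smooth_in_cst.
by apply: smooth_in_prod => i; exact: CA.
Qed.

Lemma smooth_in_col_mx m1 m2 n (A : M -> 'M[R]_(m1, n)) (B : M -> 'M[R]_(m2, n)) :
  (forall i j, smooth_in c (fun x => A x i j)) ->
  (forall i j, smooth_in c (fun x => B x i j)) ->
  forall i j, smooth_in c (fun x => col_mx (A x) (B x) i j).
Proof.
move=> CA CB i j; under eq_fun do rewrite mxE.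
by case: (fintype.split i) => k; [exact: CA|exact: CB].
Qed.

Lemma smooth_in_cross (f v a b : M -> 'cV[R]_5) :
  smooth_in c f -> smooth_in c v -> smooth_in c a -> smooth_in c b ->
  smooth_in c (fun x => cross (f x) (v x) (a x) (b x)).
Proof.
move=> Cf Cv Ca Cb; apply/smooth_in_mxP => i j; under eq_fun do rewrite mxE.
have Ct (u : M -> 'cV[R]_5) : smooth_in c u ->
    forall i j, smooth_in c (fun x => (u x)^T i j).
  by move=> Cu; apply/smooth_in_mxP; exact: smooth_in_trmx.
have C0 := @smooth_in_cst _ _ c _ (0 : 'cV[R]_5).
have CF : forall i j, smooth_in c (fun x => frame_mx 0 (f x) (v x) (a x) (b x) i j).
  apply: (smooth_in_col_mx (m1 := 1) (m2 := (1 + 1) + (1 + 1))); first exact: Ct.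
  by apply: smooth_in_col_mx; apply: smooth_in_col_mx; exact: Ct.
apply: smooth_inM; first exact: smooth_in_cst.
apply: smooth_inM; first exact: smooth_in_cst.
apply: smooth_in_det => k l.
under eq_fun do rewrite [row' _ _ _ _]mxE [col' _ _ _ _]mxE.
exact: CF.
Qed.

End SmoothDeterminant.

Section LorentzCalculus.
Variables (R : realType) (M : oriented_surface R) (n : nat) (c : chart M).
Implicit Types (u w : M -> 'cV[R]_n.+2).

Lemma smooth_in_lor u w : smooth_in c u -> smooth_in c w ->
  smooth_in c (fun x => ip (u x) (w x)).
Proof.
move=> Cu Cw; have C : smooth_in c (fun x => (u x)^T *m lorentz_mx R n *m w x).
  apply: smooth_in_mulmx => //; apply: smooth_in_mulmx; last exact: smooth_in_cst.
  exact: smooth_in_trmx.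
by apply: smooth_in_eq ((smooth_in_mxP _ _).1 C 0 0) => x _; rewrite lorE.
Qed.

Lemma partial_lor a x u w : smooth_in c u -> smooth_in c w -> dom c x ->
  partial c a (fun y => ip (u y) (w y)) x =
  ip (partial c a u x) (w x) + ip (u x) (partial c a w x).
Proof.
move=> Cu Cw cx; have Cu' := smooth_in_trmx Cu.
have CL := @smooth_in_cst _ _ c _ (lorentz_mx R n).
have CuL := smooth_in_mulmx Cu' CL.
transitivity (partial c a (fun y => (u y)^T *m lorentz_mx R n *m w y) x 0 0).
  rewrite (partial_mxE a cx 0 0 (smooth_in_mulmx CuL Cw)).
  by apply: partial_eq => // y _; rewrite lorE.
rewrite (partial_mulmx a cx CuL Cw) (partial_mulmx a cx Cu' CL) partial_cst mulmx0 addr0.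
by rewrite mxE !lorE (partial_trmx a cx Cu).
Qed.

Lemma partial_lor_cst a x u w (k : R) : smooth_in c u -> smooth_in c w ->
  (forall y, dom c y -> ip (u y) (w y) = k) -> dom c x ->
  ip (partial c a u x) (w x) = - ip (u x) (partial c a w x).
Proof.
move=> Cu Cw uw cx; apply/eqP; rewrite -addr_eq0 -partial_lor//.
by rewrite (@partial_eq _ _ _ _ _ (fun=> k))// partial_cst.
Qed.

Lemma smooth_wip u w (r : M -> 'cV[R]_n.+2) :
  smooth_in c u -> smooth_in c w -> smooth_in c r ->
  smooth_in c (fun x => wip (u x) (w x) (r x)).
Proof.
move=> Cu Cw Cr; apply: smooth_inD.
  by apply: smooth_inZ => //; exact: smooth_in_lor.
by apply/smooth_inN/smooth_inZ => //; exact: smooth_in_lor.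
Qed.

Lemma partial_wip a x u w (r : M -> 'cV[R]_n.+2) :
  smooth_in c u -> smooth_in c w -> smooth_in c r -> dom c x ->
  partial c a (fun y => wip (u y) (w y) (r y)) x =
  wip (partial c a u x) (w x) (r x) + wip (u x) (partial c a w x) (r x) +
  wip (u x) (w x) (partial c a r x).
Proof.
move=> Cu Cw Cr cx; have Cur := smooth_in_lor Cu Cr; have Cwr := smooth_in_lor Cw Cr.
rewrite (partialD a cx (smooth_inZ Cur Cw) (smooth_inN (smooth_inZ Cwr Cu))).
rewrite (partialN a cx (smooth_inZ Cwr Cu)) (partialZ a cx Cur Cw) (partialZ a cx Cwr Cu).
rewrite !partial_lor// /wip.
by apply/matrixP => i j; rewrite !mxE; ring.
Qed.

End LorentzCalculus.

(** * Surfaces in a space-form and their mean curvature sphere *)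

Section SpaceFormSurface.
Variables (R : realType) (M : oriented_surface R).

Lemma metricE n (g : M -> 'cV[R]_n.+2) c x a b :
  metric g c x a b = ip (partial c a g x) (partial c b g x).
Proof. by rewrite mxE !partialE ipE. Qed.

Lemma metricC n (g : M -> 'cV[R]_n.+2) c x a b :
  metric g c x a b = metric g c x b a.
Proof. by rewrite !metricE; exact: lorC. Qed.

Variables (sigma f : M -> 'cV[R]_5) (rho : M -> R) (v : 'cV[R]_5).
Hypothesis hsigma : immersed_null_section sigma.
Hypotheses (Cf : smooth f) (Crho : smooth rho).
Hypothesis rho_neq0 : forall x, rho x != 0.
Hypothesis sigmaE : forall x, sigma x = rho x *: f x.
Hypothesis lor_fv : forall x, ip (f x) v = -1.

Lemma smooth_sigma c : smooth_in c sigma. Proof. by case: hsigma => + _ _; apply. Qed.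

Lemma lor_ff x : ip (f x) (f x) = 0.
Proof.
case: hsigma => _ /(_ x)[_ + _]; rewrite -ipE => /eqP.
by rewrite sigmaE lorZl lorZr !mulf_eq0 (negPf (rho_neq0 x)) /= => /eqP.
Qed.

Section InChart.
Variables (c : chart M).
Implicit Types (x : M) (a b : 'I_2).

Lemma lor_ffa a x : dom c x -> ip (f x) (partial c a f x) = 0.
Proof.
move=> cx; have := partial_lor_cst a (Cf c) (Cf c) (fun y _ => lor_ff y) cx.
by rewrite lorC => /eqP; rewrite -subr_eq0 opprK -mulr2n mulrn_eq0 => /eqP.
Qed.

Lemma lor_vfa a x : dom c x -> ip v (partial c a f x) = 0.
Proof.
move=> cx; rewrite lorC.
have := partial_lor_cst a (Cf c) (@smooth_in_cst _ _ c _ v) (fun y _ => lor_fv y) cx.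
by rewrite partial_cst lor0r oppr0.
Qed.

Lemma partial_sigmaE a x : dom c x ->
  partial c a sigma x = partial c a rho x *: f x + rho x *: partial c a f x.
Proof.
move=> cx; rewrite -(partialZ a cx (Crho c) (Cf c)).
by apply: partial_eq => // y _; rewrite sigmaE.
Qed.

Lemma metric_sigma x : dom c x -> metric sigma c x = rho x ^+ 2 *: metric f c x.
Proof.
move=> cx; apply/matrixP => a b; rewrite [RHS]mxE !metricE !partial_sigmaE// !lor_lin.
by rewrite (lorC (partial c a f x) (f x)) lor_ff !lor_ffa// !mulr0 !add0r mulrA expr2.
Qed.

Lemma det_metricE n (g : M -> 'cV[R]_n.+2) x : \det (metric g c x) =
  ip (partial c 0 g x) (partial c 0 g x) * ip (partial c 1 g x) (partial c 1 g x)
  - ip (partial c 0 g x) (partial c 1 g x) ^+ 2.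
Proof.
by rewrite det_mx2 (metricC g c x 1 0) !metricE expr2.
Qed.

Lemma lor_sigma_partial a x : dom c x -> ip (partial c a sigma x) (sigma x) = 0.
Proof.
move=> cx; rewrite partial_sigmaE// sigmaE !lor_lin lor_ff (lorC (partial c a f x)).
by rewrite lor_ffa// !mulr0 addr0.
Qed.

Lemma det_metric_gt0 x : dom c x -> 0 < \det (metric f c x).
Proof.
move=> cx; have [_ /(_ x) ls /(_ c x cx)] := hsigma; rewrite -!partialE => fr.
have sa a : ip (sigma x) (partial c a sigma x) = 0 by rewrite lorC lor_sigma_partial.
have [_] := gram_pos ls (sa 0) (sa 1) fr.
rewrite -det_metricE metric_sigma// detZ pmulr_rgt0// exprn_even_gt0//=.
by rewrite expf_neq0.
Qed.

Lemma area_gt0 x : dom c x -> 0 < area f c x.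
Proof. by move=> cx; rewrite sqrtr_gt0 det_metric_gt0. Qed.

Lemma area2 x : dom c x -> area f c x ^+ 2 = \det (metric f c x).
Proof. by move=> cx; rewrite sqr_sqrtr// ltW// det_metric_gt0. Qed.

Lemma area_sigma x : dom c x -> area sigma c x = rho x ^+ 2 * area f c x.
Proof.
move=> cx; rewrite /area metric_sigma// detZ sqrtrM ?sqr_ge0//.
by rewrite sqrtr_sqr ger0_norm// sqr_ge0.
Qed.

Lemma area_sigma_gt0 x : dom c x -> 0 < area sigma c x.
Proof.
move=> cx; rewrite area_sigma// mulr_gt0 ?area_gt0// exprn_even_gt0//=.
Qed.

Lemma cstruct_sigma x a b : dom c x -> cstruct sigma c x a b = cstruct f c x a b.
Proof.
move=> cx; rewrite /cstruct area_sigma// metric_sigma// ![(_ *: metric f c x) _ _]mxE.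
have r0 := rho_neq0 x.
have A0 : area f c x != 0 by rewrite gt_eqF// area_gt0.
by case: ifP => _; field; rewrite A0 r0.
Qed.

Lemma smooth_in_metric (g : M -> 'cV[R]_5) a b : smooth_in c g ->
  smooth_in c (fun x => metric g c x a b).
Proof.
move=> Cg; apply: smooth_in_eq (smooth_in_lor (smooth_in_partial a Cg) (smooth_in_partial b Cg)).
by move=> x _; rewrite metricE.
Qed.

Lemma smooth_in_det_metric (g : M -> 'cV[R]_5) : smooth_in c g ->
  smooth_in c (fun x => \det (metric g c x)).
Proof.
move=> Cg; have Cm := fun a b => smooth_in_metric a b Cg.
apply: smooth_in_eq (smooth_inD (smooth_inM (Cm 0 0) (Cm 1 1))
  (smooth_inN (smooth_inM (Cm 0 1) (Cm 1 0)))) => x _.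
by rewrite det_mx2.
Qed.

Lemma smooth_area : smooth_in c (area f c).
Proof.
apply: smooth_in_sqrt; first exact: det_metric_gt0.
exact: smooth_in_det_metric (Cf c).
Qed.

Lemma det_metric_sigma_gt0 x : dom c x -> 0 < \det (metric sigma c x).
Proof. by move=> cx; have := area_sigma_gt0 cx; rewrite sqrtr_gt0. Qed.

Lemma smooth_area_sigma : smooth_in c (area sigma c).
Proof.
apply: smooth_in_sqrt; first exact: det_metric_sigma_gt0.
exact: smooth_in_det_metric (smooth_sigma c).
Qed.

Lemma smooth_inv_metric a b : smooth_in c (fun x => invmx (metric sigma c x) a b).
Proof.
have Cm := fun a b => smooth_in_metric a b (smooth_sigma c).
have Cd := smooth_in_det_metric (smooth_sigma c).
have d0 x : dom c x -> \det (metric sigma c x) != 0.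
  by move=> cx; rewrite gt_eqF// det_metric_sigma_gt0.
have C : smooth_in c (fun x => (\det (metric sigma c x))^-1 *
    (if a == b then metric sigma c x (a + 1) (a + 1) else - metric sigma c x a b)).
  apply: smooth_inM; first exact: smooth_inV.
  by case: eqP => _; [exact: Cm|apply: smooth_inN; exact: Cm].
by apply: smooth_in_eq C => x cx; rewrite invmx2 ?d0// !mxE.
Qed.

(* Integration by parts: pairing the Laplacian with a field [T] normal to the
   surface only involves first derivatives. *)
Lemma lor_laplacian (T : M -> 'cV[R]_5) x : smooth_in c T ->
  (forall b y, dom c y -> ip (partial c b sigma y) (T y) = 0) -> dom c x ->
  ip (laplacian sigma c sigma x) (T x) =
  - \sum_a \sum_b invmx (metric sigma c x) a b *
                  ip (partial c b sigma x) (partial c a T x).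
Proof.
move=> CT sT cx; have A0 : area sigma c x != 0 by rewrite gt_eqF// area_sigma_gt0.
have Ck a b : smooth_in c (fun y => area sigma c y * invmx (metric sigma c y) a b).
  by apply: smooth_inM; [exact: smooth_area_sigma|exact: smooth_inv_metric].
pose K a y := \sum_b (area sigma c y * invmx (metric sigma c y) a b) *: partial c b sigma y.
have CK a : smooth_in c (K a).
  rewrite /K; under eq_fun do rewrite sum2E.
  by apply: smooth_inD; apply: smooth_inZ (Ck _ _) _; apply: smooth_in_partial; exact: smooth_sigma.
have KT a y : dom c y -> ip (K a y) (T y) = 0.
  by move=> cy; rewrite lor_suml big1// => b _; rewrite lorZl sT// mulr0.
have -> : laplacian sigma c sigma x = (area sigma c x)^-1 *: \sum_a partial c a (K a) x.
  congr (_ *: _); apply: eq_bigr => a _; rewrite partialE; congr (pd c a _ x).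
  by apply/funext => y; apply: eq_bigr => b _; rewrite partialE.
rewrite lorZl lor_suml.
have E a : ip (partial c a (K a) x) (T x) = - (area sigma c x * \sum_b
    invmx (metric sigma c x) a b * ip (partial c b sigma x) (partial c a T x)).
  rewrite (partial_lor_cst a (CK a) CT (KT a) cx) /K lor_suml mulr_sumr; congr (- _).
  by apply: eq_bigr => b _; rewrite lorZl mulrA.
rewrite (eq_bigr _ (fun a _ => E a)) sumrN -mulr_sumr mulrN mulrA mulVf//.
by rewrite mul1r.
Qed.

Lemma lor_laplacian_sigma x : dom c x ->
  ip (laplacian sigma c sigma x) (sigma x) = - 2.
Proof.
move=> cx; rewrite lor_laplacian//; last 2 first.
- exact: smooth_sigma.
- by move=> b y; exact: lor_sigma_partial.
congr (- _); transitivity (\tr (invmx (metric sigma c x) *m metric sigma c x)).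
  by apply: eq_bigr => a _; rewrite mxE; apply: eq_bigr => b _; rewrite metricE.
by rewrite mulVmx ?mxtrace1// unitmxE unitfE gt_eqF// det_metric_sigma_gt0.
Qed.

End InChart.

Section MeanCurvatureSphere.
Variables (nu : M -> 'cV[R]_5) (H : M -> R).
Hypothesis hnu : unit_normal v f nu.
Hypothesis CH : smooth H.
Hypothesis hH : forall c x, dom c x -> mean_curvature f nu c x = H x.

(* The mean curvature sphere of [f], a unit section of [S^perp]. *)
Definition sphere_normal := locked_with partial_key (fun x => nu x + H x *: f x).
Local Notation N := sphere_normal.

Lemma sphere_normalE x : N x = nu x + H x *: f x.
Proof. by rewrite /sphere_normal unlock. Qed.

Lemma smooth_sphere_normal : smooth N.
Proof.
move=> c; apply: smooth_in_eq (fun x _ => esym (sphere_normalE x)) _.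
by apply: smooth_inD (smooth_inZ (CH c) (Cf c)); case: hnu => + _; apply.
Qed.

Lemma unit_normalP x : [/\ ip (nu x) (nu x) = 1, ip (nu x) (f x) = 0 & ip (nu x) v = 0].
Proof. by have [c cx] := dom_cover x; rewrite !ipE; case: hnu => _ /(_ c x cx) []. Qed.

Lemma lor_NN x : ip (N x) (N x) = 1.
Proof.
have [n1 n2 _] := unit_normalP x.
by rewrite sphere_normalE !lor_lin lor_ff (lorC (f x)) n1 n2 !mulr0 !addr0.
Qed.

Lemma lor_Nf x : ip (N x) (f x) = 0.
Proof.
by have [_ n2 _] := unit_normalP x; rewrite sphere_normalE !lor_lin lor_ff n2 mulr0 addr0.
Qed.

Lemma lor_Nv x : ip (N x) v = - H x.
Proof.
by have [_ _ n3] := unit_normalP x; rewrite sphere_normalE !lor_lin lor_fv n3 mulrN1 add0r.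
Qed.

Section InChart.
Variable c : chart M.
Implicit Types (x : M) (a b : 'I_2).
Let CN : smooth_in c N := smooth_sphere_normal c.
Let Cnu : smooth_in c nu. Proof. by case: hnu => + _; apply. Qed.

Lemma lor_nufa x a : dom c x -> ip (nu x) (partial c a f x) = 0.
Proof. by move=> cx; rewrite partialE ipE; case: hnu => _ /(_ c x cx) []. Qed.

Lemma lor_Nl x w : ip (N x) w = ip (nu x) w + H x * ip (f x) w.
Proof. by rewrite sphere_normalE lorDl lorZl. Qed.

Lemma lor_Nfa x a : dom c x -> ip (N x) (partial c a f x) = 0.
Proof. by move=> cx; rewrite lor_Nl lor_nufa// lor_ffa// mulr0 addr0. Qed.

Lemma lor_NaN x a : dom c x -> ip (partial c a N x) (N x) = 0.
Proof.
move=> cx; have := partial_lor_cst a CN CN (fun y _ => lor_NN y) cx.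
by rewrite lorC => /eqP; rewrite -subr_eq0 opprK -mulr2n mulrn_eq0 => /eqP.
Qed.

Lemma lor_Naf x a : dom c x -> ip (partial c a N x) (f x) = 0.
Proof.
move=> cx; rewrite (partial_lor_cst a CN (Cf c) (fun y _ => lor_Nf y) cx).
by rewrite lor_Nfa// oppr0.
Qed.

Lemma lor_Nav x a : dom c x -> ip (partial c a N x) v = - partial c a H x.
Proof.
move=> cx; have := partial_lor a CN (@smooth_in_cst _ _ c _ v) cx.
rewrite partial_cst lor0r addr0 => <-; rewrite -(partialN a cx (CH c)).
by apply: partial_eq => // y _; exact: lor_Nv.
Qed.

Lemma second_ffE x a b :
  second_ff f nu c x a b = ip (partial c a (partial c b f) x) (nu x).
Proof. by rewrite mxE !partialE ipE. Qed.

Lemma lor_Nafb x a b : dom c x ->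
  ip (partial c a N x) (partial c b f x) = H x * metric f c x a b - second_ff f nu c x a b.
Proof.
move=> cx; have Cfb := smooth_in_partial b (Cf c).
rewrite (partial_lor_cst a CN Cfb (fun y cy => lor_Nfa b cy) cx) lor_Nl opprD addrC.
have -> : ip (f x) (partial c a (partial c b f) x) = - metric f c x a b.
  have := partial_lor_cst a (Cf c) Cfb (fun y cy => lor_ffa b cy) cx.
  by rewrite -metricE => ->; rewrite opprK.
by rewrite mulrN opprK second_ffE (lorC (nu x)).
Qed.

Lemma second_ffC x a b : dom c x -> second_ff f nu c x a b = second_ff f nu c x b a.
Proof. by move=> cx; rewrite !second_ffE (partial_comm a cx b (Cf c)). Qed.

Lemma lor_NafbC x a b : dom c x ->
  ip (partial c a N x) (partial c b f x) = ip (partial c b N x) (partial c a f x).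
Proof. by move=> cx; rewrite !lor_Nafb// metricC second_ffC. Qed.

Lemma trace_Nafb x : dom c x ->
  metric f c x 1 1 * ip (partial c 0 N x) (partial c 0 f x)
  - 2 * metric f c x 0 1 * ip (partial c 0 N x) (partial c 1 f x)
  + metric f c x 0 0 * ip (partial c 1 N x) (partial c 1 f x) = 0.
Proof.
move=> cx; rewrite !lor_Nafb//; have := hH cx.
have d0 : \det (metric f c x) != 0 by rewrite gt_eqF// det_metric_gt0.
rewrite /mean_curvature mxtrace_invmx2// (metricC f c x 1 0) (second_ffC 1 0 cx).
move: d0; rewrite det_mx2 (metricC f c x 1 0).
move: (metric f c x 0 0) (metric f c x 0 1) (metric f c x 1 1).
move: (second_ff f nu c x 0 0) (second_ff f nu c x 0 1) (second_ff f nu c x 1 1) (H x).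
move=> h00 h01 h11 k g00 g01 g11 d0 <-; field; exact: d0.
Qed.

Lemma lor_partial_sigma_N x a : dom c x -> ip (partial c a sigma x) (N x) = 0.
Proof.
move=> cx; rewrite partial_sigmaE// !lor_lin (lorC (f x)) lor_Nf.
by rewrite (lorC (partial c a f x)) lor_Nfa// !mulr0 addr0.
Qed.

Lemma lor_laplacian_N x : dom c x -> ip (laplacian sigma c sigma x) (N x) = 0.
Proof.
move=> cx; rewrite lor_laplacian//; last by move=> b y; exact: lor_partial_sigma_N.
apply/eqP; rewrite oppr_eq0; apply/eqP.
transitivity (\tr (invmx (metric sigma c x) *m
  (\matrix_(b, a) ip (partial c b sigma x) (partial c a N x)))).
  by apply: eq_bigr => a _; rewrite mxE; apply: eq_bigr => b _; rewrite [in RHS]mxE.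
have d0 : \det (metric sigma c x) != 0 by rewrite gt_eqF// det_metric_sigma_gt0.
rewrite mxtrace_invmx2// metric_sigma//.
have E a b : (\matrix_(b, a) ip (partial c b sigma x) (partial c a N x)) a b =
    rho x * ip (partial c b N x) (partial c a f x).
  rewrite mxE partial_sigmaE// lorDl !lorZl (lorC (f x)) lor_Naf// mulr0 add0r.
  by rewrite (lorC (partial c a f x)).
have G a b : (rho x ^+ 2 *: metric f c x) a b = rho x ^+ 2 * metric f c x a b by rewrite mxE.
rewrite !E !G.
have := trace_Nafb cx; rewrite (metricC f c x 1 0) (lor_NafbC 1 0 cx).
move: (metric f c x 0 0) (metric f c x 0 1) (metric f c x 1 1).
move: (ip (partial c 0 N x) (partial c 0 f x)) (ip (partial c 0 N x) (partial c 1 f x))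
  (ip (partial c 1 N x) (partial c 1 f x)).
move=> h00 h01 h11 g00 g01 g11 E0; apply/eqP; rewrite mulf_eq0; apply/orP; left; apply/eqP.
transitivity (rho x ^+ 3 * (g11 * h00 - 2 * g01 * h01 + g00 * h11)); first ring.
by rewrite E0 mulr0.
Qed.

Lemma frame_ext x (u w : 'cV[R]_5) : dom c x ->
  ip (f x) u = ip (f x) w -> ip v u = ip v w ->
  ip (N x) u = ip (N x) w ->
  (forall a, ip (partial c a f x) u = ip (partial c a f x) w) -> u = w.
Proof.
move=> cx fu vu Nu fau; apply/subr0_eq.
have [n1 n2 n3] := unit_normalP x.
have nu0 : nu x != 0 by apply/eqP => E; move: n1; rewrite E lor0l => /eqP; rewrite eq_sym oner_eq0.
have g0 := det_metric_gt0 cx; rewrite det_metricE in g0.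
apply: (frame_perp_eq0 nu0 (lor_ff x) (lor_fv x) (lor_ffa 0 cx) (lor_ffa 1 cx)
  (lor_vfa 0 cx) (lor_vfa 1 cx) n2 n3 (lor_nufa 0 cx) (lor_nufa 1 cx) g0).
- by have := lor_Nl x (u - w); rewrite !lor_lin Nu fu !subrr mulr0 addr0 => <-.
- by rewrite !lor_lin fu subrr.
- by rewrite !lor_lin vu subrr.
- by rewrite !lor_lin fau subrr.
- by rewrite !lor_lin fau subrr.
Qed.

Lemma tangent_span x (u : 'cV[R]_5) : dom c x ->
  ip (f x) u = 0 -> ip v u = 0 -> ip (N x) u = 0 ->
  exists y0 y1, u = y0 *: partial c 0 f x + y1 *: partial c 1 f x.
Proof.
move=> cx fu vu Nu; have := det_metric_gt0 cx; rewrite det_metricE.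
set E := ip _ (partial c 0 f x); set G := ip _ (partial c 1 f x).
set F := ip (partial c 0 f x) (partial c 1 f x) => d0.
set b0 := ip (partial c 0 f x) u; set b1 := ip (partial c 1 f x) u.
have dn := lt0r_neq0 d0.
exists ((G * b0 - F * b1) / (E * G - F ^+ 2)), ((E * b1 - F * b0) / (E * G - F ^+ 2)).
apply: (frame_ext cx).
- by rewrite fu lorDr !lorZr !lor_ffa// !mulr0 addr0.
- by rewrite vu lorDr !lorZr !lor_vfa// !mulr0 addr0.
- by rewrite Nu lorDr !lorZr !lor_Nfa// !mulr0 addr0.
- move=> a; rewrite lorDr !lorZr; case: (ord2P a) => ->.
    by rewrite -/b0 -/E -/F; field.
  by rewrite -/b1 -/G (lorC _ (partial c 0 f x)) -/F; field.
Qed.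

Lemma frame_cvec_eq0 x (w : 'cV[R[i]]_5) : dom c x ->
  ip w (cplx (f x)) = 0 -> ip w (cplx v) = 0 -> ip w (cplx (N x)) = 0 ->
  (forall a, ip w (cplx (partial c a f x)) = 0) -> w = 0.
Proof.
have [r [s ->]] := cvecE w.
have cE0 (p q : R) : p +i* q = 0 -> p = 0 /\ q = 0 by case.
move=> cx; rewrite !lor_cvec => /cE0[f1 f2] /cE0[v1 v2] /cE0[N1 N2] fa.
have -> : r = 0.
  apply: (frame_ext cx); rewrite ?lor0r ?(lorC _ r) // => a.
  by have := fa a; rewrite lor_cvec lor0r lorC => /cE0[].
have -> : s = 0.
  apply: (frame_ext cx); rewrite ?lor0r ?(lorC _ s) // => a.
  by have := fa a; rewrite lor_cvec lor0r (lorC s) => /cE0[].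
by rewrite -cplxE; apply/matrixP => i j; rewrite !mxE.
Qed.

Lemma csigma_Lambda1 x : csigma sigma x \in Lambda1 sigma c x.
Proof.
by rewrite /Lambda1 /Lambda10 -addvA; apply: subvP (addvSl _ _) _ _; exact: memv_line.
Qed.

Lemma dsigma_Lambda1 x a : cplx (partial c a sigma x) \in Lambda1 sigma c x.
Proof.
have <- : part10 sigma c x (dsigma sigma c x) a + part01 sigma c x (dsigma sigma c x) a =
  cplx (partial c a sigma x).
  rewrite /part10 /part01 -scalerDr addrACA addNr addr0 -mulr2n -[X in _ *: X](scaler_nat 2).
  by rewrite [LHS]scalerA mulVf ?scale1r ?pnatr_eq0// /dsigma partialE.
apply: memv_add; apply: (subvP (addvSr _ _));
  exact: (subvP (sumv_sup a (erefl _) (subvv _))) (memv_line _).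
Qed.

Lemma cplxD (r s : 'cV[R]_5) : cplx (r + s) = cplx r + cplx s.
Proof. exact: raddfD. Qed.

Lemma cplxZ (k : R) (r : 'cV[R]_5) : cplx (k *: r) = k%:C *: cplx r.
Proof. by rewrite /cplx map_mxZ. Qed.

Lemma f_Lambda1 x : cplx (f x) \in Lambda1 sigma c x.
Proof.
have -> : f x = (rho x)^-1 *: sigma x by rewrite sigmaE scalerA mulVf// scale1r.
by rewrite cplxZ memvZ// csigma_Lambda1.
Qed.

Lemma df_Lambda1 x a : dom c x -> cplx (partial c a f x) \in Lambda1 sigma c x.
Proof.
move=> cx.
have -> : partial c a f x =
    (rho x)^-1 *: (partial c a sigma x + (- partial c a rho x) *: f x).
  by rewrite partial_sigmaE// scaleNr addrAC subrr add0r scalerA mulVf// scale1r.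
by rewrite cplxZ memvZ// cplxD memvD ?dsigma_Lambda1// cplxZ memvZ// f_Lambda1.
Qed.

Lemma Lambda1_central_sphere x u :
  u \in Lambda1 sigma c x -> u \in central_sphere sigma c x.
Proof. by apply: subvP; exact: addvSl. Qed.

Lemma real_central_sphere x r : dom c x -> ip r (N x) = 0 ->
  cplx r \in central_sphere sigma c x.
Proof.
move=> cx rN; pose L := laplacian sigma c sigma x.
have Lf : ip L (f x) = - 2 / rho x.
  have := lor_laplacian_sigma cx; rewrite sigmaE lorZr => <-.
  by rewrite mulrAC divff// mul1r.
pose r1 := r - (ip r (f x) / ip L (f x)) *: L.
have Lf0 : ip L (f x) != 0 by rewrite Lf mulf_neq0 ?oppr_eq0 ?pnatr_eq0// invr_eq0.
have [||| y0 [y1 E]] := @tangent_span x (r1 + ip r1 v *: f x) cx.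
- rewrite lorDr lorZr lor_ff mulr0 addr0 lorC /r1 lorDl lorNl lorZl.
  by rewrite mulfVK// subrr.
- by rewrite lorDr lorZr (lorC v (f x)) lor_fv mulrN1 lorC subrr.
- rewrite lorDr lorZr lor_Nf mulr0 addr0 lorC /r1 lorDl lorNl lorZl rN.
  by rewrite lor_laplacian_N// mulr0 subr0.
have -> : r = (ip r (f x) / ip L (f x)) *: L + (- ip r1 v) *: f x +
    (y0 *: partial c 0 f x + y1 *: partial c 1 f x).
  by rewrite -E addrACA scaleNr addNr addr0 /r1 addrC subrK.
rewrite !cplxD (cplxZ _ L) (cplxZ _ (f x)) !(cplxZ _ (partial c _ f x)).
apply: memvD; last first.
  by apply: memvD; rewrite memvZ// Lambda1_central_sphere// df_Lambda1.
apply: memvD; last by rewrite memvZ// Lambda1_central_sphere// f_Lambda1.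
by rewrite memvZ//; apply: (subvP (addvSr _ _)); exact: memv_line.
Qed.

Lemma central_sphereP x (u : 'cV[R[i]]_5) : dom c x ->
  (u \in central_sphere sigma c x) <-> ip u (cplx (N x)) = 0.
Proof.
move=> cx; split; last first.
  have [r [s ->]] := cvecE u; rewrite lor_cvec => -[rN sN].
  by rewrite memvD ?memvZ// real_central_sphere.
have sN : ip (csigma sigma x) (cplx (N x)) = 0.
  by rewrite lor_cplx sigmaE lorZl lorC lor_Nf mulr0.
have dN a : ip (dsigma sigma c x a) (cplx (N x)) = 0.
  by rewrite /dsigma -partialE lor_cplx lor_partial_sigma_N.
have JN a : ip (formJ sigma c x (dsigma sigma c x) a) (cplx (N x)) = 0.
  by rewrite lor_suml big1// => b _; rewrite lorZl dN mulr0.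
have L10 w : w \in Lambda10 sigma c x -> ip w (cplx (N x)) = 0.
  move=> /memv_addP[_ /vlineP[k ->]] [_ /memv_sumP[vs vsP ->]] ->.
  rewrite lorDl lorZl sN mulr0 add0r lor_suml big1// => a _.
  have /vlineP[k' ->] := vsP a isT.
  by rewrite /part10 !lorZl lorDl lorNl lorZl dN JN !mulr0 subr0 !mulr0.
have L01 w : w \in Lambda01 sigma c x -> ip w (cplx (N x)) = 0.
  move=> /memv_addP[_ /vlineP[k ->]] [_ /memv_sumP[vs vsP ->]] ->.
  rewrite lorDl lorZl sN mulr0 add0r lor_suml big1// => a _.
  have /vlineP[k' ->] := vsP a isT.
  by rewrite /part01 !lorZl lorDl lorZl dN JN !mulr0 addr0 !mulr0.
move=> /memv_addP[_ /memv_addP[w1 /L10 w1N [w2 /L01 w2N ->]]] [_ /vlineP[k ->]] ->.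
by rewrite !lorDl w1N w2N lorZl lor_cplx lor_laplacian_N// mulr0 !addr0.
Qed.

Lemma orthogonal_central_sphere x (w : 'cV[R[i]]_5) : dom c x ->
  orthogonal_to (central_sphere sigma c x) w <->
  w = ip w (cplx (N x)) *: cplx (N x).
Proof.
move=> cx; split => [ow|-> s /(central_sphereP _ cx) sN]; last first.
  by rewrite -ipE lorZr sN mulr0.
have NN : ip (cplx (N x)) (cplx (N x)) = 1 by rewrite lor_cplx lor_NN.
have {}ow s : s \in central_sphere sigma c x -> ip w s = 0.
  by move=> /ow; rewrite -ipE lorC.
have oN s : ip s (cplx (N x)) = 0 -> ip (w - ip w (cplx (N x)) *: cplx (N x)) s = 0.
  move=> sN; rewrite lorDl lorNl lorZl (lorC (cplx _) s) sN mulr0 subr0.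
  by apply: ow; apply/central_sphereP.
apply/subr0_eq; apply: (frame_cvec_eq0 cx).
- by apply: oN; rewrite lor_cplx lorC lor_Nf.
- set z := w - _.
  have zN : ip z (cplx (N x)) = 0 by rewrite lorDl lorNl lorZl NN mulr1 subrr.
  have : ip z (cplx v + (H x)%:C *: cplx (N x)) = 0.
    apply: oN; rewrite lorDl lorZl NN lor_cplx lorC lor_Nv mulr1.
    by rewrite -rmorphD addNr.
  by rewrite lorDr lorZr zN mulr0 addr0.
- by rewrite lorDl lorNl lorZl NN mulr1 subrr.
- by move=> a; apply: oN; rewrite lor_cplx lorC lor_Nfa.
Qed.

Lemma projSE x u : dom c x ->
  projS sigma c x u = u - ip u (cplx (N x)) *: cplx (N x).
Proof.
move=> cx; have NN : ip (cplx (N x)) (cplx (N x)) = 1 by rewrite lor_cplx lor_NN.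
rewrite /projS /orth_proj; apply: xget_unique.
  split; first by apply/central_sphereP => //; rewrite lorDl lorNl lorZl NN mulr1 subrr.
  by apply/orthogonal_central_sphere => //; rewrite subKr lorZl NN mulr1.
move=> s [/(central_sphereP _ cx) sN /(orthogonal_central_sphere _ cx)].
rewrite lorDl lorNl sN subr0 => E.
by rewrite -[s](subKr u) E.
Qed.

Lemma projSperpE x u : dom c x ->
  projSperp sigma c x u = ip u (cplx (N x)) *: cplx (N x).
Proof. by move=> cx; rewrite /projSperp projSE// subKr. Qed.

Lemma ip_cvec_N x r s :
  ip (cvec r s) (cplx (N x)) *: cplx (N x) = cvec (ip r (N x) *: N x) (ip s (N x) *: N x).
Proof.
rewrite lor_cvec [X in X *: _]complexE /= scalerDl -scalerA cplxE !cvecZ cvecZi cvecD.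
by rewrite !scaler0 oppr0 addr0 add0r.
Qed.

(* The form [N] of the decomposition [d = D + N] is [wedge N (d N)]. *)
Definition shape a x : 'cV[R]_5 -> 'cV[R]_5 := wip (N x) (partial c a N x).

Definition Dreal a (r : M -> 'cV[R]_5) x := partial c a r x - shape a x (r x).

Lemma smooth_shape a r : smooth_in c r -> smooth_in c (fun x => shape a x (r x)).
Proof. by move=> Cr; apply: smooth_wip => //; exact: smooth_in_partial. Qed.

Lemma smooth_Dreal a r : smooth_in c r -> smooth_in c (Dreal a r).
Proof.
move=> Cr; apply: smooth_inD; first exact: smooth_in_partial.
by apply: smooth_inN; exact: smooth_shape.
Qed.

Lemma cpd_eq a (w w' : M -> 'cV[R[i]]_5) x :
  (forall y, dom c y -> w y = w' y) -> dom c x -> cpd c a w x = cpd c a w' x.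
Proof.
move=> ww' cx; rewrite /cpd -!partialE; congr (cplx _ + _ *: cplx _);
  by apply: partial_eq => // y cy; rewrite ww'.
Qed.

Section OnSection.
Variables (w : M -> 'cV[R[i]]_5) (r s : M -> 'cV[R]_5).
Hypotheses (Cr : smooth_in c r) (Cs : smooth_in c s).
Hypothesis wE : forall y, dom c y -> w y = cvec (r y) (s y).

Let smooth_perp (u : M -> 'cV[R]_5) : smooth_in c u ->
  smooth_in c (fun y => ip (u y) (N y) *: N y).
Proof. by move=> Cu; apply: smooth_inZ => //; exact: smooth_in_lor. Qed.

Let partial_perp a (u : M -> 'cV[R]_5) x : smooth_in c u -> dom c x ->
  partial c a (fun y => ip (u y) (N y) *: N y) x =
  (ip (partial c a u x) (N x) + ip (u x) (partial c a N x)) *: N x +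
  ip (u x) (N x) *: partial c a N x.
Proof.
by move=> Cu cx; rewrite (partialZ a cx (smooth_in_lor Cu CN) CN) partial_lor.
Qed.

Lemma cpdE a x : dom c x -> cpd c a w x = cvec (partial c a r x) (partial c a s x).
Proof. by move=> cx; rewrite (cpd_eq a wE cx) cpd_cvec. Qed.

Lemma DconnE a x : dom c x -> Dconn sigma c a w x = cvec (Dreal a r x) (Dreal a s x).
Proof.
move=> cx; rewrite /Dconn projSE// projSperpE//.
have P1 y : dom c y -> projS sigma c y (w y) =
    cvec (r y - ip (r y) (N y) *: N y) (s y - ip (s y) (N y) *: N y).
  by move=> cy; rewrite projSE// wE// ip_cvec_N cvecN cvecD.
have P2 y : dom c y -> projSperp sigma c y (w y) =
    cvec (ip (r y) (N y) *: N y) (ip (s y) (N y) *: N y).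
  by move=> cy; rewrite projSperpE// wE// ip_cvec_N.
rewrite (cpd_eq a P1 cx) (cpd_eq a P2 cx) !cpd_cvec !ip_cvec_N cvecN !cvecD.
have E u : smooth_in c u ->
    partial c a (fun y => u y - ip (u y) (N y) *: N y) x -
    ip (partial c a (fun y => u y - ip (u y) (N y) *: N y) x) (N x) *: N x +
    ip (partial c a (fun y => ip (u y) (N y) *: N y) x) (N x) *: N x = Dreal a u x.
  move=> Cu; rewrite (partialD a cx Cu (smooth_inN (smooth_perp Cu))).
  rewrite (partialN a cx (smooth_perp Cu)) partial_perp// /Dreal /shape.
  rewrite !lor_lin lor_NN lor_NaN//.
  rewrite /wip (lorC (N x) (u x)) (lorC (partial c a N x) (u x)).
  move: (ip _ (N x)) (ip (u x) (N x)) (ip (u x) _) => p q t.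
  by apply/matrixP => i j; rewrite !mxE; ring.
by rewrite !E.
Qed.

Lemma NformE a x : dom c x ->
  Nform sigma c a w x = cvec (shape a x (r x)) (shape a x (s x)).
Proof.
by move=> cx; rewrite /Nform DconnE// cpdE// cvecN cvecD /Dreal !subKr.
Qed.

End OnSection.

Lemma Dreal_wip a (u w r : M -> 'cV[R]_5) x :
  smooth_in c u -> smooth_in c w -> smooth_in c r -> dom c x ->
  Dreal a (fun y => wip (u y) (w y) (r y)) x - wip (u x) (w x) (Dreal a r x) =
  wip (Dreal a u x) (w x) (r x) + wip (u x) (Dreal a w x) (r x).
Proof.
move=> Cu Cw Cr cx; rewrite /Dreal partial_wip//.
have := wip_comm (N x) (partial c a N x) (u x) (w x) (r x).
rewrite -/(shape a x).
move: (shape a x) => W E.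
have -> : wip (u x) (w x) (partial c a r x - W (r x)) =
  wip (u x) (w x) (partial c a r x) - wip (u x) (w x) (W (r x)).
  by rewrite /wip !lor_lin; apply/matrixP => i j; rewrite !mxE; ring.
have -> : wip (partial c a u x - W (u x)) (w x) (r x) =
  wip (partial c a u x) (w x) (r x) - wip (W (u x)) (w x) (r x).
  by rewrite /wip !lor_lin; apply/matrixP => i j; rewrite !mxE; ring.
have -> : wip (u x) (partial c a w x - W (w x)) (r x) =
  wip (u x) (partial c a w x) (r x) - wip (u x) (W (w x)) (r x).
  by rewrite /wip !lor_lin; apply/matrixP => i j; rewrite !mxE; ring.
move: E => /eqP; rewrite subr_eq => /eqP ->.
by apply/matrixP => i j; rewrite !mxE; ring.
Qed.

Lemma Dreal_N a x : dom c x -> Dreal a N x = 0.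
Proof.
move=> cx; rewrite /Dreal /shape /wip lor_NN lor_NaN// scale1r scale0r subr0.
exact: subrr.
Qed.

Lemma Dreal_f a x : dom c x -> Dreal a f x = partial c a f x.
Proof.
by move=> cx; rewrite /Dreal /shape /wip lor_Nf lor_Naf// !scale0r !subr0.
Qed.

(** * The rotated differentials *)

Section RotatedForms.

Local Notation J := (cstruct f c).
Local Notation A := (area f c).

Lemma smooth_cstruct a b : smooth_in c (fun x => J x a b).
Proof.
apply: smooth_inM.
  by case: (b == 0); [apply: smooth_inN|]; apply: smooth_in_metric (Cf c).
apply: smooth_inV (smooth_area c) => x cx.
by rewrite gt_eqF// area_gt0.
Qed.

Definition rot_df a x := \sum_b J x a b *: partial c b f x.
Definition rot_dN a x := - \sum_b J x a b *: partial c b N x.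

Lemma smooth_rot_df a : smooth_in c (rot_df a).
Proof.
rewrite /rot_df; under eq_fun do rewrite sum2E.
by apply: smooth_inD; apply: smooth_inZ (smooth_cstruct _ _) (smooth_in_partial _ (Cf c)).
Qed.

Lemma smooth_rot_dN a : smooth_in c (rot_dN a).
Proof.
rewrite /rot_dN; under eq_fun do rewrite sum2E.
by apply/smooth_inN/smooth_inD; apply: smooth_inZ (smooth_cstruct _ _) (smooth_in_partial _ CN).
Qed.

Lemma rot_df_skew a b x : dom c x ->
  ip (rot_df a x) (partial c b f x) =
  if a == b then 0 else if a == 0 then A x else - A x.
Proof.
move=> cx; have A0 : A x != 0 by rewrite gt_eqF// area_gt0.
have A2 := area2 cx; rewrite det_mx2 in A2.
rewrite /rot_df sum2E lorDl !lorZl -!metricE /cstruct /=.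
case: (ord2P a) => ->; case: (ord2P b) => -> /=; rewrite ?(metricC f c x 1 0).
- by field.
- rewrite -[RHS](mulfK A0) -expr2 A2 (metricC f c x 1 0); field; exact: A0.
- rewrite -[A x in RHS](mulfK A0) -expr2 A2 (metricC f c x 1 0); field; exact: A0.
- by field.
Qed.

Lemma rot_df_antisym a b x : dom c x ->
  ip (rot_df a x) (partial c b f x) = - ip (rot_df b x) (partial c a f x).
Proof.
move=> cx; rewrite !rot_df_skew// eq_sym.
by case: (ord2P a) => ->; case: (ord2P b) => -> /=; rewrite ?oppr0 ?opprK.
Qed.

Lemma lor_rot_dN_df a b x : dom c x ->
  ip (rot_dN a x) (partial c b f x) = - ip (partial c a N x) (rot_df b x).
Proof.
move=> cx; have A0 : A x != 0 by rewrite gt_eqF// area_gt0.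
rewrite /rot_dN /rot_df !sum2E lorNl lorDl lorDr !lorZl !lorZr; congr (- _).
have := trace_Nafb cx; rewrite /cstruct /=.
case: (ord2P a) => ->; case: (ord2P b) => ->;
  rewrite ?(lor_NafbC 1 0 cx) ?(metricC f c x 1 0);
  move: (metric f c x 0 0) (metric f c x 0 1) (metric f c x 1 1) (A x) A0
    (ip (partial c 0 N x) (partial c 0 f x)) (ip (partial c 0 N x) (partial c 1 f x))
    (ip (partial c 1 N x) (partial c 1 f x)) => g00 g01 g11 k k0 n00 n01 n11 E.
- by [].
- apply/subr0_eq; transitivity (k^-1 * (g11 * n00 - 2 * g01 * n01 + g00 * n11)); first by field.
  by rewrite E mulr0.
- apply/subr0_eq; transitivity (- (k^-1 * (g11 * n00 - 2 * g01 * n01 + g00 * n11))); first by field.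
  by rewrite E mulr0 oppr0.
- by [].
Qed.

Lemma partial_area d x : dom c x ->
  partial c d A x = ip (partial c d (partial c 1 f) x) (rot_df 0 x) -
                    ip (rot_df 1 x) (partial c d (partial c 0 f) x).
Proof.
move=> cx; have A0 : A x != 0 by rewrite gt_eqF// area_gt0.
have Cfa a := smooth_in_partial a (Cf c).
have Cm a b : smooth_in c (fun y => ip (partial c a f y) (partial c b f y)).
  exact: smooth_in_lor.
have Em a b : partial c d (fun y => ip (partial c a f y) (partial c b f y)) x =
   ip (partial c d (partial c a f) x) (partial c b f x) +
   ip (partial c a f x) (partial c d (partial c b f) x) by rewrite partial_lor.
have : partial c d (fun y => A y * A y) x =
    partial c d (fun y => ip (partial c 0 f y) (partial c 0 f y) *
      ip (partial c 1 f y) (partial c 1 f y) -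
      ip (partial c 0 f y) (partial c 1 f y) * ip (partial c 0 f y) (partial c 1 f y)) x.
  by apply: partial_eq => // y cy; rewrite -expr2 area2// det_metricE expr2.
rewrite (partialM d cx (smooth_area c) (smooth_area c)).
rewrite (partialD d cx (smooth_inM (Cm 0 0) (Cm 1 1)) (smooth_inN (smooth_inM (Cm 0 1) (Cm 0 1)))).
rewrite (partialN d cx (smooth_inM (Cm 0 1) (Cm 0 1))).
rewrite (partialM d cx (Cm 0 0) (Cm 1 1)) (partialM d cx (Cm 0 1) (Cm 0 1)) !Em.
rewrite /rot_df !sum2E lorDr lorDl !lorZr !lorZl /cstruct /= !metricE.
rewrite !(lorC (partial c _ f x) (partial c d _ x)).
rewrite (lorC (partial c 1 f x) (partial c 0 f x)).
move: (partial c d A x) (A x) A0 (ip (partial c 0 f x) (partial c 0 f x))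
  (ip (partial c 0 f x) (partial c 1 f x)) (ip (partial c 1 f x) (partial c 1 f x)).
move: (ip (partial c d (partial c 0 f) x) (partial c 0 f x))
 (ip (partial c d (partial c 0 f) x) (partial c 1 f x))
 (ip (partial c d (partial c 1 f) x) (partial c 0 f x))
 (ip (partial c d (partial c 1 f) x) (partial c 1 f x)).
move=> p00 p01 p10 p11 dk k k0 g00 g01 g11 E.
have k2 : 2 * k != 0 by rewrite mulf_neq0 ?pnatr_eq0.
apply: (mulfI k2); transitivity (dk * k + k * dk); first ring.
rewrite E; field; exact: k0.
Qed.

(* [J] is parallel: the rotation of [d f] commutes with differentiation, up
   to components orthogonal to the surface. *)
Lemma lor_partial_rot_df b d e x : dom c x ->
  ip (partial c b f x) (partial c d (rot_df e) x) =
  - ip (rot_df b x) (partial c d (partial c e f) x).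
Proof.
move=> cx; have Cfa a := smooth_in_partial a (Cf c).
have := partial_lor d (smooth_rot_df e) (Cfa b) cx.
have -> : partial c d (fun y => ip (rot_df e y) (partial c b f y)) x =
    if e == b then 0 else if e == 0 then partial c d A x else - partial c d A x.
  rewrite (partial_eq d (fun y cy => rot_df_skew e b cy) cx).
  case: (e == b); first by rewrite partial_cst.
  by case: (e == 0); rewrite ?(partialN d cx (smooth_area c)).
rewrite (lorC (partial c d (rot_df e) x)) partial_area//.
rewrite (lorC (partial c d (partial c 1 f) x)).
case: (ord2P e) => ->; case: (ord2P b) => -> /=.
- by move/eqP; rewrite eq_sym addr_eq0 => /eqP.
- by move/eqP; rewrite eq_sym -subr_eq0 => /eqP E; apply/eqP; rewrite -subr_eq0 -E; apply/eqP; ring.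
- by move/eqP; rewrite eq_sym -subr_eq0 => /eqP E; apply/eqP; rewrite -subr_eq0 -E; apply/eqP; ring.
- by move/eqP; rewrite eq_sym addr_eq0 => /eqP.
Qed.

Lemma lor_rot_dN_Nf a x : dom c x ->
  ip (rot_dN a x) (f x) = 0 /\ ip (rot_dN a x) (N x) = 0.
Proof.
move=> cx; rewrite /rot_dN sum2E !lorNl !lorDl !lorZl !lor_Naf// !lor_NaN//.
by rewrite !mulr0 !addr0 oppr0.
Qed.

Section ConstantMeanCurvature.
Hypothesis partial_H0 : forall a x, dom c x -> partial c a H x = 0.

Lemma lor_Nav0 a x : dom c x -> ip (partial c a N x) v = 0.
Proof. by move=> cx; rewrite lor_Nav// partial_H0// oppr0. Qed.

Lemma dN_span a x : dom c x ->
  exists y0 y1, partial c a N x = y0 *: partial c 0 f x + y1 *: partial c 1 f x.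
Proof.
move=> cx; apply: tangent_span => //; rewrite lorC.
- exact: lor_Naf.
- exact: lor_Nav0.
- exact: lor_NaN.
Qed.

Lemma lor_rot_dN_v a x : dom c x -> ip (rot_dN a x) v = 0.
Proof.
move=> cx; rewrite /rot_dN sum2E lorNl lorDl !lorZl !lor_Nav0//.
by rewrite !mulr0 addr0 oppr0.
Qed.

Lemma lor_rot_dN a d e x : dom c x ->
  ip (rot_dN a x) (partial c d (partial c e f) x) =
  - ip (partial c a N x) (partial c d (rot_df e) x).
Proof.
move=> cx; have [y0 [y1 E]] := dN_span a cx.
have -> : rot_dN a x = y0 *: rot_df 0 x + y1 *: rot_df 1 x.
  have [Bf BN] := lor_rot_dN_Nf a cx.
  have rv b : ip v (rot_df b x) = 0.
    by rewrite /rot_df sum2E lorDr !lorZr !lor_vfa// !mulr0 addr0.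
  have rN b : ip (N x) (rot_df b x) = 0.
    by rewrite /rot_df sum2E lorDr !lorZr !lor_Nfa// !mulr0 addr0.
  have rf b : ip (f x) (rot_df b x) = 0.
    by rewrite /rot_df sum2E lorDr !lorZr !lor_ffa// !mulr0 addr0.
  apply: (frame_ext cx).
  - by rewrite lorC Bf lorDr !lorZr !rf !mulr0 addr0.
  - by rewrite lorC lor_rot_dN_v// lorDr !lorZr !rv !mulr0 addr0.
  - by rewrite lorC BN lorDr !lorZr !rN !mulr0 addr0.
  - move=> b; rewrite lorC lor_rot_dN_df// E lorDl !lorZl lorDr !lorZr.
    rewrite !(lorC (partial c _ f x)) (rot_df_antisym b 0 cx) (rot_df_antisym b 1 cx).
    ring.
by rewrite E !lorDl !lorZl !lor_partial_rot_df//; ring.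
Qed.

Lemma dN_symm_wip u x : dom c x ->
  wip (partial c 0 f x) (partial c 1 N x) u = wip (partial c 1 f x) (partial c 0 N x) u.
Proof.
move=> cx; have [a0 [a1 E0]] := dN_span 0 cx; have [b0 [b1 E1]] := dN_span 1 cx.
have T := trace_Nafb cx; have S := lor_NafbC 0 1 cx.
have tr : (a0 + b1) * \det (metric f c x) = 0.
  transitivity (metric f c x 1 1 * ip (partial c 0 N x) (partial c 0 f x) -
    metric f c x 0 1 * (ip (partial c 0 N x) (partial c 1 f x) +
      ip (partial c 1 N x) (partial c 0 f x)) +
    metric f c x 0 0 * ip (partial c 1 N x) (partial c 1 f x)).
    rewrite E0 E1 !lorDl !lorZl -!metricE (metricC f c x 1 0) det_mx2 (metricC f c x 1 0).
    ring.
  by rewrite -S -T; ring.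
have {}tr : b1 = - a0.
  move/eqP: tr; rewrite mulf_eq0 [X in _ || X]gt_eqF ?det_metric_gt0// orbF.
  by rewrite addrC addr_eq0 => /eqP.
rewrite E0 E1 tr /wip !lorDl !lorZl; apply/matrixP => i j; rewrite !mxE; ring.
Qed.

Lemma Dreal_dN a b x : dom c x ->
  Dreal a (partial c b N) x = partial c a (partial c b N) x +
    ip (partial c a N x) (partial c b N x) *: N x.
Proof.
move=> cx; rewrite /Dreal /shape /wip (lorC (N x)) lor_NaN// scale0r sub0r opprK.
by [].
Qed.

Lemma curl_dN x : dom c x ->
  Dreal 0 (partial c 1 N) x = Dreal 1 (partial c 0 N) x.
Proof.
by move=> cx; rewrite !Dreal_dN// (partial_comm 0 cx 1 CN) (lorC (partial c 0 N x)).
Qed.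

Lemma Dreal_rot_dN a b x : dom c x ->
  Dreal a (rot_dN b) x = partial c a (rot_dN b) x +
    ip (partial c a N x) (rot_dN b x) *: N x.
Proof.
move=> cx; have [_ BN] := lor_rot_dN_Nf b cx.
by rewrite /Dreal /shape /wip (lorC (N x)) BN scale0r sub0r opprK.
Qed.

Lemma curl_rot_dN x : dom c x ->
  Dreal 0 (rot_dN 1) x - Dreal 1 (rot_dN 0) x =
  (H x * (ip (partial c 0 N x) (rot_dN 1 x) - ip (partial c 1 N x) (rot_dN 0 x))) *: f x.
Proof.
move=> cx; have CB := smooth_rot_dN; have Cfa a := smooth_in_partial a (Cf c).
have Bf a b : ip (partial c a (rot_dN b) x) (f x) = - ip (rot_dN b x) (partial c a f x).
  exact: partial_lor_cst (CB b) (Cf c) (fun y cy => (lor_rot_dN_Nf b cy).1) cx.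
have BN a b : ip (partial c a (rot_dN b) x) (N x) = - ip (rot_dN b x) (partial c a N x).
  exact: partial_lor_cst (CB b) CN (fun y cy => (lor_rot_dN_Nf b cy).2) cx.
have Bv a b : ip (partial c a (rot_dN b) x) v = 0.
  have := partial_lor_cst a (CB b) (@smooth_in_cst _ _ c _ v) (fun y cy => lor_rot_dN_v b cy) cx.
  by rewrite partial_cst lor0r oppr0.
have Bfe a b e : ip (partial c a (rot_dN b) x) (partial c e f x) =
    - ip (partial c a (partial c b N) x) (rot_df e x).
  have := partial_lor a (CB b) (Cfa e) cx.
  rewrite (partial_eq a (fun y cy => lor_rot_dN_df b e cy) cx).
  have CNb := smooth_in_partial b CN.
  rewrite (partialN a cx (smooth_in_lor CNb (smooth_rot_df e))).
  rewrite (partial_lor a CNb (smooth_rot_df e) cx) lor_rot_dN// opprD => E.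
  by apply/esym/(addIr _ E).
rewrite !Dreal_rot_dN//; have BN01 := BN 0 1; have BN10 := BN 1 0.
move: BN01 BN10; rewrite (lorC (rot_dN 1 x)) (lorC (rot_dN 0 x)).
move: (ip (partial c 0 N x) (rot_dN 1 x)) (ip (partial c 1 N x) (rot_dN 0 x)) => n1 n2 BN01 BN10.
apply: (frame_ext cx).
- rewrite lorC (lorC (f x)) !lor_lin lor_Nf lor_ff !Bf !mulr0 !addr0 /rot_dN !sum2E.
  rewrite !lorNl !lorDl !lorZl /cstruct /= (metricC f c x 1 0).
  have T := trace_Nafb cx; rewrite (lor_NafbC 1 0 cx).
  transitivity (- (A x)^-1 * (metric f c x 1 1 * ip (partial c 0 N x) (partial c 0 f x) -
   2 * metric f c x 0 1 * ip (partial c 0 N x) (partial c 1 f x) +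
   metric f c x 0 0 * ip (partial c 1 N x) (partial c 1 f x))); last by rewrite T mulr0.
  ring.
- rewrite lorC (lorC v) !lor_lin !Bv lor_Nv lor_fv; ring.
- rewrite lorC (lorC (N x)) !lor_lin BN01 BN10 lor_NN (lorC (f x)) lor_Nf; ring.
- move=> e; rewrite lorC (lorC (partial c e f x)) !lor_lin !Bfe lor_Nfa// lor_ffa//.
  by rewrite (partial_comm 0 cx 1 CN); ring.
Qed.

End ConstantMeanCurvature.

End RotatedForms.

Lemma NformC (w : M -> 'cV[R[i]]_5) a x : csmooth_in c w -> dom c x ->
  Nform sigma c a w x = wip (cplx (N x)) (cplx (partial c a N x)) (w x).
Proof.
move=> [Cr Cs] cx; rewrite (NformE Cr Cs (fun y _ => esym (cvecK (w y))))//.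
by rewrite /shape -!wedgeE -wedge_cvec cvecK wedgeE.
Qed.

Lemma DconnC (w : M -> 'cV[R[i]]_5) a x :
  Dconn sigma c a w x = cpd c a w x - Nform sigma c a w x.
Proof. by rewrite /Nform subKr. Qed.

(** * Conserved quantities of type 1 *)

Section ConservedQuantity.
Variables (q : endform M 3) (p : int -> M -> 'cV[R[i]]_5).
Hypothesis CWq : constrained_willmore sigma q.
Hypothesis CQp : conserved_quantity sigma q 1 p.
Hypothesis p1v : forall x, laurent_eval 1 p 1 x = cplx v.

Lemma laurent_eval1 l x :
  laurent_eval 1 p l x = l^-1 *: p (- 1) x + p 0 x + l *: p 1 x.
Proof. by rewrite /laurent_eval !big_ord_recl big_ord0 /= addr0 addrA expr0z scale1r. Qed.

Lemma p_sum x : p (-1) x + p 0 x + p 1 x = cplx v.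
Proof. by rewrite -(p1v x) laurent_eval1 invr1 !scale1r. Qed.

Lemma p_conj x : p (-1) x = mxconj (p 1 x).
Proof. by case: CQp => /(_ 1 isT)[_ ->]. Qed.

Lemma csmooth_p k : (`|k| <= 1)%N -> csmooth_in c (p k).
Proof. by case: CQp => + _ _ _ _ k1 => /(_ k k1)[[C1 C2] _]; split; [exact: C1|exact: C2]. Qed.

Lemma p1_span x : dom c x -> p 1 x = ip (p 1 x) (cplx (N x)) *: cplx (N x).
Proof.
move=> cx; apply/(orthogonal_central_sphere _ cx).
by case: CQp => _ /(_ c x cx).
Qed.

Lemma pm1_span x : dom c x -> p (-1) x = ip (p (-1) x) (cplx (N x)) *: cplx (N x).
Proof.
move=> cx; apply/(orthogonal_central_sphere _ cx).
by case: CQp => _ _ /(_ (-1) c x isT cx).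
Qed.

Lemma p0_perp x : dom c x -> ip (p 0 x) (cplx (N x)) = 0.
Proof.
move=> cx; apply/(central_sphereP _ cx).
by case: CQp => _ _ /(_ 0 c x isT cx).
Qed.

Lemma lor_mxconj (w : 'cV[R[i]]_5) u :
  ip (mxconj w) (cplx u) = conjc (ip w (cplx u)).
Proof.
have [r [s ->]] := cvecE w.
have -> : mxconj (cvec r s) = cvec r (- s).
  apply/matrixP => i j; rewrite !mxE; apply/eqP; rewrite eq_complex /=.
  by rewrite !(mul0r, mul1r, mulr0, subr0, add0r, addr0) !eqxx.
by rewrite !lor_cvec lorNl.
Qed.

Lemma Re_p1 x : dom c x -> - H x = 2 * complex.Re (ip (p 1 x) (cplx (N x))).
Proof.
move=> cx; have := congr1 (fun w => complex.Re (ip w (cplx (N x)))) (p_sum x).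
rewrite !lorDl p0_perp// addr0 p_conj lor_mxconj lor_cplx (lorC v) lor_Nv.
by case: (ip _ _) => re im /= <-; ring.
Qed.

Lemma part10Z x (om : 'I_2 -> 'cV[R[i]]_5) l a :
  part10 sigma c x (fun b => l *: om b) a = l *: part10 sigma c x om a.
Proof.
rewrite /part10 scalerA mulrC -scalerA; congr (_ *: _); rewrite scalerBr; congr (_ - _).
rewrite /formJ scalerA mulrC -scalerA; congr (_ *: _); rewrite scaler_sumr.
by apply: eq_bigr => b _; rewrite !scalerA mulrC.
Qed.

Lemma part01Z x (om : 'I_2 -> 'cV[R[i]]_5) l a :
  part01 sigma c x (fun b => l *: om b) a = l *: part01 sigma c x om a.
Proof.
rewrite /part01 scalerA mulrC -scalerA; congr (_ *: _); rewrite scalerDr; congr (_ + _).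
rewrite /formJ scalerA mulrC -scalerA; congr (_ *: _); rewrite scaler_sumr.
by apply: eq_bigr => b _; rewrite !scalerA mulrC.
Qed.

Lemma part10D x (om om' : 'I_2 -> 'cV[R[i]]_5) a :
  part10 sigma c x (fun b => om b + om' b) a = part10 sigma c x om a + part10 sigma c x om' a.
Proof.
rewrite /part10 -scalerDr; congr (_ *: _).
have -> : formJ sigma c x (fun b => om b + om' b) a =
    formJ sigma c x om a + formJ sigma c x om' a.
  by rewrite /formJ -big_split; apply: eq_bigr => b _; rewrite scalerDr.
by rewrite scalerDr opprD addrACA.
Qed.

Lemma part01D x (om om' : 'I_2 -> 'cV[R[i]]_5) a :
  part01 sigma c x (fun b => om b + om' b) a = part01 sigma c x om a + part01 sigma c x om' a.
Proof.
rewrite /part01 -scalerDr; congr (_ *: _).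
have -> : formJ sigma c x (fun b => om b + om' b) a =
    formJ sigma c x om a + formJ sigma c x om' a.
  by rewrite /formJ -big_split; apply: eq_bigr => b _; rewrite scalerDr.
by rewrite scalerDr addrACA.
Qed.

Lemma part_sum x (om : 'I_2 -> 'cV[R[i]]_5) a :
  part10 sigma c x om a + part01 sigma c x om a = om a.
Proof.
rewrite /part10 /part01 -scalerDr addrACA addNr addr0 -mulr2n -[X in _ *: X](scaler_nat 2).
by rewrite scalerA mulVf ?scale1r ?pnatr_eq0.
Qed.

Lemma ip_part10 x (om : 'I_2 -> 'cV[R[i]]_5) a w :
  ip (part10 sigma c x om a) w =
  2^-1 * (ip (om a) w - 'i%C * \sum_b (cstruct sigma c x a b)%:C * ip (om b) w).
Proof.
rewrite lorZl lorDl lorNl lorZl lor_suml; congr (_ * (_ - _ * _)).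
by apply: eq_bigr => b _; rewrite lorZl.
Qed.

Lemma part10_laurent x (o1 o2 o3 : 'I_2 -> 'cV[R[i]]_5) k l a :
  part10 sigma c x (fun b => k *: o1 b + o2 b + l *: o3 b) a =
  k *: part10 sigma c x o1 a + part10 sigma c x o2 a + l *: part10 sigma c x o3 a.
Proof.
rewrite (part10D x (fun b => k *: o1 b + o2 b) (fun b => l *: o3 b)).
by rewrite (part10D x (fun b => k *: o1 b) o2) !part10Z.
Qed.

Lemma part01_laurent x (o1 o2 o3 : 'I_2 -> 'cV[R[i]]_5) k l a :
  part01 sigma c x (fun b => k *: o1 b + o2 b + l *: o3 b) a =
  k *: part01 sigma c x o1 a + part01 sigma c x o2 a + l *: part01 sigma c x o3 a.
Proof.
rewrite (part01D x (fun b => k *: o1 b + o2 b) (fun b => l *: o3 b)).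
by rewrite (part01D x (fun b => k *: o1 b) o2) !part01Z.
Qed.

Lemma ip_laurent_expand (D1 D2 D3 : 'cV[R[i]]_5)
    (N1 N2 N3 Q1 Q2 Q3 : 'I_2 -> 'cV[R[i]]_5) l a x P :
  ip (l^-1 *: D1 + D2 + l *: D3 - (l^-1 *: N1 a + N2 a + l *: N3 a)
     + l *: part10 sigma c x (fun b => l^-1 *: N1 b + N2 b + l *: N3 b) a
     + l^-1 *: part01 sigma c x (fun b => l^-1 *: N1 b + N2 b + l *: N3 b) a
     + (l ^+ 2 - 1) *: part10 sigma c x (fun b => l^-1 *: Q1 b + Q2 b + l *: Q3 b) a
     + (l ^- 2 - 1) *: part01 sigma c x (fun b => l^-1 *: Q1 b + Q2 b + l *: Q3 b) a) P =
  (l^-1 * ip (D1 - N1 a) P + ip (D2 - N2 a) P + l * ip (D3 - N3 a) P) +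
  l * (l^-1 * ip (part10 sigma c x N1 a) P + ip (part10 sigma c x N2 a) P +
       l * ip (part10 sigma c x N3 a) P) +
  l^-1 * (l^-1 * ip (part01 sigma c x N1 a) P + ip (part01 sigma c x N2 a) P +
       l * ip (part01 sigma c x N3 a) P) +
  (l ^+ 2 - 1) * (l^-1 * ip (part10 sigma c x Q1 a) P + ip (part10 sigma c x Q2 a) P +
       l * ip (part10 sigma c x Q3 a) P) +
  (l ^- 2 - 1) * (l^-1 * ip (part01 sigma c x Q1 a) P + ip (part01 sigma c x Q2 a) P +
       l * ip (part01 sigma c x Q3 a) P).
Proof.
rewrite !part10_laurent !part01_laurent.
move: (part10 sigma c x N1 a) (part10 sigma c x N2 a) (part10 sigma c x N3 a).
move: (part10 sigma c x Q1 a) (part10 sigma c x Q2 a) (part10 sigma c x Q3 a).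
move: (part01 sigma c x N1 a) (part01 sigma c x N2 a) (part01 sigma c x N3 a).
move: (part01 sigma c x Q1 a) (part01 sigma c x Q2 a) (part01 sigma c x Q3 a).
move=> *; rewrite !(lorDl, lorNl, lorZl).
ring.
Qed.

(* The coefficient of [lambda ^ 2] in [d^lambda_q p(lambda) = 0], paired with
   [p_0]: the multiplier drops out because it is skew. *)
Lemma H_dH0 a x : dom c x -> H x * partial c a H x = 0.
Proof.
move=> cx; set phi := ip (p 1 x) (cplx (N x)).
have [_ _ _ _ eqp] := CQp.
have C0 := @csmooth_p 0 isT; have C1 := @csmooth_p 1 isT; have Cm := @csmooth_p (-1) isT.
pose Nf k b := wip (cplx (N x)) (cplx (partial c b N x)) (p k x).
pose Qf k b := cplx (q c x b) *m p k x.
pose P := p 0 x.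
pose D k := ip (cpd c a (p k) x - Nf k a) P.
pose n10 k := ip (part10 sigma c x (Nf k) a) P.
pose n01 k := ip (part01 sigma c x (Nf k) a) P.
pose q10 k := ip (part10 sigma c x (Qf k) a) P.
pose q01 k := ip (part01 sigma c x (Qf k) a) P.
have E (l : R[i]) : l != 0 ->
    (l^-1 * D (-1) + D 0 + l * D 1) +
    l * (l^-1 * n10 (-1) + n10 0 + l * n10 1) +
    l^-1 * (l^-1 * n01 (-1) + n01 0 + l * n01 1) +
    (l ^+ 2 - 1) * (l^-1 * q10 (-1) + q10 0 + l * q10 1) +
    (l ^- 2 - 1) * (l^-1 * q01 (-1) + q01 0 + l * q01 1) = 0.
  move=> l0; have := congr1 (fun w => ip w P) (eqp l c a x l0 cx).
  have Cl : csmooth_in c (laurent_eval 1 p l).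
    have -> : laurent_eval 1 p l = fun y => l^-1 *: p (-1) y + p 0 y + l *: p 1 y.
      by apply/funext => y; exact: laurent_eval1.
    exact: csmooth_inD (csmooth_inD (csmooth_inZ _ Cm) C0) (csmooth_inZ _ C1).
  have cpdl : cpd c a (laurent_eval 1 p l) x =
      l^-1 *: cpd c a (p (-1)) x + cpd c a (p 0) x + l *: cpd c a (p 1) x.
    have -> : laurent_eval 1 p l = fun y => l^-1 *: p (-1) y + p 0 y + l *: p 1 y.
      by apply/funext => y; exact: laurent_eval1.
    rewrite (cpdD a cx (csmooth_inD (csmooth_inZ _ Cm) C0) (csmooth_inZ _ C1)).
    by rewrite (cpdD a cx (csmooth_inZ _ Cm) C0) !cpdZ.
  have NE b : Nform sigma c b (laurent_eval 1 p l) x = l^-1 *: Nf (-1) b + Nf 0 b + l *: Nf 1 b.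
    by rewrite NformC// laurent_eval1 /Nf !wipDr !wipZr.
  have QE b : opq q c b (laurent_eval 1 p l) x = l^-1 *: Qf (-1) b + Qf 0 b + l *: Qf 1 b.
    by rewrite /opq laurent_eval1 !mulmxDr -!scalemxAr.
  rewrite /dlambda DconnC cpdl (funext NE) (funext QE) NE.
  by rewrite lor0l ip_laurent_expand.
have F : n10 1 + q10 0 = 0.
  exact: laurent_coef2 E.
have q0 : q10 0 = 0.
  have [_ CW2 _ _] := CWq.
  have QP b : ip (Qf 0 b) P = 0.
    have [u _ uE] := CW2 c x b cx; rewrite /Qf uE wedgeE /wip lorDl lorNl !lorZl.
    by rewrite -/P mulrC subrr.
  rewrite /q10 ip_part10 QP big1 ?mulr0 ?subr0 ?mulr0// => b _; by rewrite QP mulr0.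
have NP b : ip (Nf 1 b) P = phi * (- partial c b H x)%:C.
  rewrite /Nf (p1_span cx) -/phi /wip !lorZr !lor_cplx lor_NN lor_NaN//.
  rewrite !mulr0 mulr1 scale0r subr0 lorZl; congr (_ * _).
  have -> : P = cplx v - p (-1) x - p 1 x by rewrite -(p_sum x) addrAC addrK addrAC subrr add0r.
  rewrite (pm1_span cx) (p1_span cx) !lorDr !lorNr !lorZr !lor_cplx lor_NaN//.
  by rewrite lor_Nav// !mulr0 !subr0.
have {}F : n10 1 = 0.
  exact: etrans (esym (addr0 _)) (etrans (congr1 (fun z => n10 1 + z) (esym q0)) F).
have G : n10 1 = 2^-1 * (ip (Nf 1 a) P -
    'i%C * \sum_b (cstruct sigma c x a b)%:C * ip (Nf 1 b) P) := ip_part10 x (Nf 1) a P.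
have G' : 0 = 2^-1 * (phi * (- partial c a H x)%:C -
    'i%C * ((cstruct sigma c x a 0)%:C * (phi * (- partial c 0 H x)%:C) +
            (cstruct sigma c x a 1)%:C * (phi * (- partial c 1 H x)%:C))) :> R[i].
  apply: etrans (esym F) (etrans G _); rewrite sum2E.
  congr (_ * (_ - _ * (_ * _ + _ * _)));
    [exact: NP|exact: (NP 0)|exact: (NP 1)].
have := Re_p1 cx; rewrite -/phi; move: G'.
clear; move: phi (H x) (partial c a H x) (partial c 0 H x) (partial c 1 H x).
move: (cstruct sigma c x a 0) (cstruct sigma c x a 1) => J0 J1 phi h ha h0 h1 F Re.
have {}F : phi * ((- ha) +i* (J0 * h0 + J1 * h1)) = 0.
  have n2 : (2 : R[i])^-1 != 0 by rewrite invr_eq0 pnatr_eq0.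
  apply: (mulfI n2); rewrite mulr0 F; congr (_ * _).
  rewrite [X in phi * X = _]complexE /= !rmorphD !rmorphM !rmorphN; ring.
move/eqP: F; rewrite mulf_eq0 => /orP[/eqP phi0|/eqP[/eqP]].
  by move: Re; rewrite phi0 /= mulr0 => /eqP; rewrite oppr_eq0 => /eqP ->; rewrite mul0r.
by rewrite oppr_eq0 => /eqP -> _; rewrite mulr0.
Qed.

End ConservedQuantity.

(** * The multiplier of a surface of constant mean curvature *)

Section AlgebraicForms.
Implicit Types (A B : opform M 3) (P : M -> 'cV[R]_5) (Q : 'I_2 -> M -> 'cV[R]_5).

(* [A] is the form [P /\ Q] on sections smooth in the chart. *)
Definition represents A P Q := forall a w r s,
  smooth_in c r -> smooth_in c s -> (forall y, dom c y -> w y = cvec (r y) (s y)) ->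
  forall x, dom c x ->
  A a w x = cvec (wip (P x) (Q a x) (r x)) (wip (P x) (Q a x) (s x)).

Lemma dD_represents A P Q w x : represents A P Q ->
  smooth_in c P -> (forall a, smooth_in c (Q a)) -> csmooth w -> dom c x ->
  let E u := wip (Dreal 0 P x) (Q 1 x) u + wip (P x) (Dreal 0 (Q 1) x) u -
             (wip (Dreal 1 P x) (Q 0 x) u + wip (P x) (Dreal 1 (Q 0) x) u) in
  dD sigma c A w x = cvec (E (mxRe (w x))) (E (mxIm (w x))).
Proof.
move=> AE CP CQ [/(_ c) C1 /(_ c) C2] cx E.
have wE y : dom c y -> w y = cvec (mxRe (w y)) (mxIm (w y)) by rewrite cvecK.
have DA a b : Dconn sigma c a (A b w) x =
    cvec (Dreal a (fun y => wip (P y) (Q b y) (mxRe (w y))) x)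
         (Dreal a (fun y => wip (P y) (Q b y) (mxIm (w y))) x).
  apply: DconnE => //; try exact: smooth_wip.
  by move=> y cy; exact: (AE b w _ _ C1 C2 wE y cy).
have AD a b : A b (Dconn sigma c a w) x =
    cvec (wip (P x) (Q b x) (Dreal a (fun y => mxRe (w y)) x))
         (wip (P x) (Q b x) (Dreal a (fun y => mxIm (w y)) x)).
  apply: AE => //; try exact: smooth_Dreal.
  by move=> y cy; exact: DconnE.
rewrite /dD (DA 0 1) (AD 0 1) (DA 1 0) (AD 1 0) cvecB2.
by congr cvec; congr (_ - _); apply: Dreal_wip.
Qed.

Lemma bracket_represents A B P Q P' Q' w x :
  represents A P Q -> represents B P' Q' ->
  smooth_in c P -> (forall a, smooth_in c (Q a)) ->
  smooth_in c P' -> (forall a, smooth_in c (Q' a)) -> csmooth w -> dom c x ->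
  let E u := wip (wip (P x) (Q 0 x) (P' x)) (Q' 1 x) u +
             wip (P' x) (wip (P x) (Q 0 x) (Q' 1 x)) u -
             (wip (wip (P x) (Q 1 x) (P' x)) (Q' 0 x) u +
             wip (P' x) (wip (P x) (Q 1 x) (Q' 0 x)) u) in
  bracket A B w x = cvec (E (mxRe (w x))) (E (mxIm (w x))).
Proof.
move=> AE BE CP CQ CP' CQ' [/(_ c) C1 /(_ c) C2] cx E.
have wE y : dom c y -> w y = cvec (mxRe (w y)) (mxIm (w y)) by rewrite cvecK.
have AB a b : A a (B b w) x =
    cvec (wip (P x) (Q a x) (wip (P' x) (Q' b x) (mxRe (w x))))
         (wip (P x) (Q a x) (wip (P' x) (Q' b x) (mxIm (w x)))).
  apply: (AE a (B b w) (fun y => wip (P' y) (Q' b y) (mxRe (w y)))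
                       (fun y => wip (P' y) (Q' b y) (mxIm (w y)))) => //;
    try exact: smooth_wip.
  by move=> y cy; exact: (BE b w _ _ C1 C2 wE y cy).
have BA a b : B b (A a w) x =
    cvec (wip (P' x) (Q' b x) (wip (P x) (Q a x) (mxRe (w x))))
         (wip (P' x) (Q' b x) (wip (P x) (Q a x) (mxIm (w x)))).
  apply: (BE b (A a w) (fun y => wip (P y) (Q a y) (mxRe (w y)))
                       (fun y => wip (P y) (Q a y) (mxIm (w y)))) => //;
    try exact: smooth_wip.
  by move=> y cy; exact: (AE a w _ _ C1 C2 wE y cy).
rewrite /bracket (AB 0 1) (BA 0 1) (AB 1 0) (BA 1 0) cvecB2.
by congr cvec; congr (_ - _); apply: wip_comm.
Qed.

Lemma starN_represents : represents (starN sigma c) N rot_dN.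
Proof.
move=> a w r s Cr Cs wE x cx; rewrite /starN /formJ.
under eq_bigr do rewrite (NformE Cr Cs wE _ cx) cvecZ cstruct_sigma//.
rewrite sum2E cvecD cvecN /shape /rot_dN sum2E.
by congr cvec; rewrite /wip !lor_lin; apply/matrixP => i j; rewrite !mxE; ring.
Qed.

End AlgebraicForms.

Section Converse.
Variable h : R.
Hypothesis Hh : forall x, H x = h.

Lemma partial_H0 a x : dom c x -> partial c a H x = 0.
Proof.
by move=> cx; rewrite (partial_eq a (fun y _ => Hh y) cx) partial_cst.
Qed.

Let k := - h / 2.

Definition cmc_multiplier : endform M 3 :=
  fun d x a => wip_mx (f x) (k *: partial d a N x).

Let Qf a x := k *: partial c a N x.

Lemma smooth_Qf a : smooth_in c (Qf a).
Proof. by apply: smooth_inZ (@smooth_in_cst _ _ c _ k) (smooth_in_partial a CN). Qed.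

Lemma opq_represents : represents (opq cmc_multiplier c) f Qf.
Proof.
move=> a w r s _ _ wE x cx.
by rewrite /opq wE// cvec_mulmx !mul_wip_mx.
Qed.

Lemma Dreal_Qf a b x : dom c x -> Dreal a (Qf b) x = k *: Dreal a (partial c b N) x.
Proof.
move=> cx; rewrite /Dreal /Qf (partialZ a cx (@smooth_in_cst _ _ c _ k) (smooth_in_partial b CN)).
by rewrite partial_cst scale0r add0r /shape wipZr [in RHS]scalerBr.
Qed.

Lemma dD_multiplier w x : csmooth w -> dom c x ->
  dD sigma c (opq cmc_multiplier c) w x = 0.
Proof.
move=> Cw cx; rewrite (dD_represents opq_represents (Cf c) smooth_Qf Cw cx).
have E u : wip (Dreal 0 f x) (Qf 1 x) u + wip (f x) (Dreal 0 (Qf 1) x) u -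
             (wip (Dreal 1 f x) (Qf 0 x) u + wip (f x) (Dreal 1 (Qf 0) x) u) = 0.
  rewrite !Dreal_f// !Dreal_Qf// curl_dN//.
  have wipZ p t l : wip p (l *: t) u = l *: wip p t u.
    by rewrite /wip !lorZl; apply/matrixP => i j; rewrite !mxE; ring.
  by rewrite /Qf !wipZ dN_symm_wip ?subrr//; exact: partial_H0.
by rewrite !E -cplxE; apply/matrixP => i j; rewrite !mxE.
Qed.

Lemma willmore_multiplier w x : csmooth w -> dom c x ->
  dD sigma c (starN sigma c) w x =
  2 *: bracket (opq cmc_multiplier c) (starN sigma c) w x.
Proof.
move=> Cw cx.
rewrite (dD_represents starN_represents CN smooth_rot_dN Cw cx).
rewrite (bracket_represents opq_represents starN_represents (Cf c) smooth_Qf CN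
  smooth_rot_dN Cw cx).
have -> : 2 = (2 : R)%:C :> R[i] by rewrite rmorph_nat.
rewrite cvecZ.
have E u : wip (Dreal 0 N x) (rot_dN 1 x) u + wip (N x) (Dreal 0 (rot_dN 1) x) u -
    (wip (Dreal 1 N x) (rot_dN 0 x) u + wip (N x) (Dreal 1 (rot_dN 0) x) u) =
  2 *: (wip (wip (f x) (Qf 0 x) (N x)) (rot_dN 1 x) u +
             wip (N x) (wip (f x) (Qf 0 x) (rot_dN 1 x)) u -
             (wip (wip (f x) (Qf 1 x) (N x)) (rot_dN 0 x) u +
             wip (N x) (wip (f x) (Qf 1 x) (rot_dN 0 x)) u)).
  have w0 t : wip 0 t u = 0 by rewrite /wip lor0l scale0r scaler0 subr0.
  have qN a : wip (f x) (Qf a x) (N x) = 0.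
    by rewrite /wip (lorC (f x)) lor_Nf /Qf lorZl lor_NaN// mulr0 !scale0r subr0.
  have qB a b : wip (f x) (Qf a x) (rot_dN b x) =
      (- k * ip (partial c a N x) (rot_dN b x)) *: f x.
    rewrite /wip (lorC (f x)) (lor_rot_dN_Nf b cx).1 scale0r sub0r /Qf lorZl.
    by rewrite -scaleNr mulNr.
  rewrite (Dreal_N 0 cx) (Dreal_N 1 cx) (qN 0) (qN 1).
  rewrite (w0 (rot_dN 1 x)) (w0 (rot_dN 0 x)).
  rewrite ![0 + wip (N x) _ u]add0r (qB 0 1) (qB 1 0).
  have wipB p q : wip (N x) p u - wip (N x) q u = wip (N x) (p - q) u.
    by rewrite /wip !lor_lin; apply/matrixP => i j; rewrite !mxE; ring.
  rewrite !wipB curl_rot_dN//; last exact: partial_H0.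
  rewrite Hh -scalerBl -mulrBr /wip !lorZl /k; apply/matrixP => i j; rewrite !mxE.
  by field.
exact: congr2 (E _) (E _).
Qed.

Lemma multiplier_Lambda1 x a : dom c x ->
  exists2 u, u \in Lambda1 sigma c x &
    forall w, cplx (cmc_multiplier c x a) *m w = wedge (csigma sigma x) u w.
Proof.
move=> cx; exists (cplx ((k / rho x) *: partial c a N x)).
  have [y0 [y1 ->]] := dN_span partial_H0 a cx.
  by rewrite cplxZ memvZ// cplxD !cplxZ memvD ?memvZ ?df_Lambda1.
move=> w; rewrite -(cvecK w) cvec_mulmx wedge_cvec !mul_wip_mx !wedgeE.
have r0 := rho_neq0 x.
congr cvec; rewrite sigmaE /wip !lorZl; apply/matrixP => i j; rewrite !mxE;
  by field.
Qed.

Lemma partial_vN y0 y1 a x : dom c x ->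
  partial c a (fun y => y0 *: v + y1 *: N y) x = y1 *: partial c a N x.
Proof.
move=> cx; have Cy (y : R) := @smooth_in_cst _ _ c _ y.
rewrite (partialD a cx (@smooth_in_cst _ _ c _ (y0 *: v)) (smooth_inZ (Cy y1) CN)).
by rewrite (partialZ a cx (Cy y1) CN) !partial_cst scale0r !add0r.
Qed.

Lemma wip_N_vN y0 y1 a x : dom c x ->
  wip (N x) (partial c a N x) (y0 *: v + y1 *: N x) = (y1 - h * y0) *: partial c a N x.
Proof.
move=> cx; rewrite /wip !lorDr !lorZr lor_NN lor_Nv lor_NaN// lor_Nav// partial_H0//.
by rewrite Hh; apply/matrixP => i j; rewrite !mxE; ring.
Qed.

Lemma wip_f_vN y0 y1 a x : dom c x ->
  wip (f x) (Qf a x) (y0 *: v + y1 *: N x) = (- k * y0) *: partial c a N x.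
Proof.
move=> cx; rewrite /wip !lorDr !lorZr /Qf !lorZl lor_NaN// lor_Nav// partial_H0//.
by rewrite lor_fv (lorC (f x)) lor_Nf; apply/matrixP => i j; rewrite !mxE; ring.
Qed.

Definition cmc_quantity (j : int) (x : M) : 'cV[R[i]]_5 :=
  if j == 0 then cplx (v + h *: N x) else cplx (k *: N x).

Lemma cmc_quantity_eq (l : R[i]) a x : l != 0 -> dom c x ->
  dlambda sigma cmc_multiplier l c a (laurent_eval 1 cmc_quantity l) x = 0.
Proof.
move=> l0 cx; set w := laurent_eval _ _ _.
pose m := l^-1 + l; pose r0 := h + complex.Re m * k; pose s0 := complex.Im m * k.
pose r y := 1 *: v + r0 *: N y; pose s y := 0 *: v + s0 *: N y.
have CvN (y0 y1 : R) : smooth_in c (fun y => y0 *: v + y1 *: N y).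
  by apply: smooth_inD (smooth_in_cst _ _) (smooth_inZ (smooth_in_cst _ y1) CN).
have wE y : dom c y -> w y = cvec (r y) (s y).
  move=> _; rewrite /w laurent_eval1 /cmc_quantity /=.
  have -> : l^-1 *: cplx (k *: N y) + cplx (v + h *: N y) + l *: cplx (k *: N y) =
     cplx (v + h *: N y) + m *: cplx (k *: N y).
    by rewrite addrAC -scalerDl addrC.
  rewrite !cplxE cvecZc cvecD /r /s /r0 /s0 !scaler0 subr0 add0r scale1r scale0r !add0r.
  by rewrite scalerDl addrA !scalerA.
have Cr := CvN 1 r0 : smooth_in c r; have Cs := CvN 0 s0 : smooth_in c s.
pose X b := cplx (partial c b N x).
have DE : Dconn sigma c a w x = h%:C *: X a.
  rewrite (DconnE Cr Cs wE)// /Dreal /shape !partial_vN// !wip_N_vN//.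
  rewrite mulr1 mulr0 subr0 subrr scalerBl opprB addrC subrK /X cplxE cvecZ scaler0.
  by [].
have NE b : Nform sigma c b w x = (m * k%:C) *: X b.
  rewrite (NformE Cr Cs wE)// /shape !wip_N_vN// mulr1 mulr0 subr0 /r0 addrAC subrr add0r.
  rewrite /X cplxE cvecZc scaler0 subr0 scaler0 add0r; congr (cvec (_ *: _) (_ *: _)).
    by case: (m) => p q /=; ring.
  by rewrite /s0; case: (m) => p q /=; ring.
have QE b : opq cmc_multiplier c b w x = (- k%:C) *: X b.
  rewrite (opq_represents b Cr Cs wE cx) !wip_f_vN// mulr1 mulr0 scale0r.
  by rewrite /X cplxE -rmorphN cvecZ scaler0.
rewrite /dlambda DE (funext NE) (funext QE) !part10Z !part01Z.
have := part_sum x X a; move: (part10 sigma c x X a) (part01 sigma c x X a) (X a).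
move=> X1 X2 _ <-.
have -> : h%:C = - (2 * k%:C) :> R[i].
  by rewrite -[2](rmorph_nat (real_complex R) 2) -rmorphM -rmorphN /k; congr (_%:C); field.
by apply/matrixP => i j; rewrite !mxE /m; move: (X1 i j) (X2 i j) (k%:C) => z1 z2 K; field.
Qed.

End Converse.

End InChart.

Section CMCPair.
Variable h : R.
Hypothesis Hh : forall x, H x = h.

Lemma multiplier_is_form : is_form (cmc_multiplier h).
Proof.
have CN := smooth_sphere_normal; split=> [c a|c d x a cx dx].
  have CNa := smooth_inZ (@smooth_in_cst _ _ c _ (- h / 2)) (smooth_in_partial a (CN c)).
  have CL := @smooth_in_cst _ _ c _ (lorentz_mx R 3).
  suff : smooth_in c (fun x => cmc_multiplier h c x a) by [].
  apply: smooth_inD.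
    by apply: smooth_in_mulmx => //; apply: smooth_in_mulmx => //; exact: smooth_in_trmx (Cf c).
  apply: smooth_inN; apply: smooth_in_mulmx (Cf c) _.
  by apply: smooth_in_mulmx => //; exact: smooth_in_trmx CNa.
rewrite /cmc_multiplier (partial_transition a (CN d) cx dx) !sum2E /wip_mx.
move: (transition c d x a 0) (transition c d x a 1) => t0 t1.
rewrite !linearZ /= !linearD /= !linearZ /= !mulmxDl !mulmxDr -!scalemxAl -!scalemxAr.
by rewrite !scalerN opprD addrACA.
Qed.

Lemma cmc_constrained_willmore : constrained_willmore sigma (cmc_multiplier h).
Proof.
split.
- exact: multiplier_is_form.
- by move=> c x a cx; exact: multiplier_Lambda1.
- by move=> c w x Cw cx; exact: dD_multiplier.
- by move=> c w x Cw cx; exact: willmore_multiplier.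
Qed.

Lemma cmc_quantity_sum x : laurent_eval 1 (cmc_quantity h) 1 x = cplx v.
Proof.
rewrite laurent_eval1 invr1 !scale1r /cmc_quantity /= -!cplxD; congr cplx.
by apply/matrixP => i j; rewrite !mxE; field.
Qed.

Lemma cmc_conserved_quantity : conserved_quantity sigma (cmc_multiplier h) 1 (cmc_quantity h).
Proof.
have CN := smooth_sphere_normal.
have CZ (k : R) c : smooth_in c (fun x => k *: N x).
  exact: smooth_inZ (smooth_in_cst _ k) (CN c).
have Ccplx (u : M -> 'cV[R]_5) : smooth u -> csmooth (fun x => cplx (u x)).
  move=> Cu; split=> c.
    by apply: smooth_in_eq (Cu c) => x _; rewrite cplxE mxRe_cvec.
  by apply: smooth_in_eq (@smooth_in_cst _ _ c _ 0) => x _; rewrite cplxE mxIm_cvec.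
have ort k c x : dom c x -> orthogonal_to (central_sphere sigma c x) (cplx (k *: N x)).
  move=> cx; apply/orthogonal_central_sphere => //.
  by rewrite cplxZ lorZl lor_cplx lor_NN mulr1.
split.
- move=> k _; rewrite /cmc_quantity oppr_eq0; split.
    case: eqP => _; last by apply: Ccplx => c; exact: CZ.
    by apply: Ccplx => c; apply: smooth_inD (smooth_in_cst _ v) (CZ h c).
  by move=> x; case: eqP => _; apply/matrixP => i j; rewrite !mxE /= oppr0.
- by move=> c x cx; exact: ort.
- move=> k c x k1 cx; have [->|k0] := eqVneq k 0.
    apply/central_sphereP => //; rewrite /cmc_quantity eqxx lor_cplx lorDl lorZl lor_NN.
    by rewrite (lorC v) lor_Nv Hh mulr1 addNr.
  have -> : `|k|%N = 1%N by apply/eqP; rewrite eqn_leq k1 absz_gt0.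
  by rewrite /cmc_quantity (negPf k0); exact: ort.
- move=> E; have [x _] := @surface_nonempty _ M.
  have := congr1 (fun F => ip (cplx (f x)) (F x)) E.
  rewrite cmc_quantity_sum lor_cplx lor_fv lor0r => /(congr1 (@complex.Re R)) /eqP.
  by rewrite /= oppr_eq0 oner_eq0.
- by move=> l c a x l0 cx; exact: cmc_quantity_eq.
Qed.

End CMCPair.

Lemma constant_mean_curvature (q : endform M 3) (p : int -> M -> 'cV[R[i]]_5) :
  constrained_willmore sigma q -> conserved_quantity sigma q 1 p ->
  (forall x, laurent_eval 1 p 1 x = cplx v) -> forall x y, H x = H y.
Proof.
move=> CWq CQp pv.
have HdH c a x (cx : dom c x) := H_dH0 CWq CQp pv a cx.
have H2 x y : H x * H x = H y * H y.
  apply: (constant_of_partial0 (f := fun z => H z * H z)) => [c|c a z cz].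
    by apply: smooth_inM; exact: CH.
  by rewrite (partialM a cz (CH c) (CH c)) mulrC HdH// addr0.
have [[x0 Hx0]|nH] := pselect (exists x, H x = 0).
  have H0 x : H x = 0.
    by have /eqP := H2 x x0; rewrite Hx0 mulr0 mulf_eq0 orbb => /eqP.
  by move=> x y; rewrite !H0.
apply: constant_of_partial0 CH _ => c a x cx.
have /eqP := HdH c a x cx; rewrite mulf_eq0 => /orP[/eqP Hx|/eqP//].
by case: nH; exists x.
Qed.

Lemma perp_square (q : endform M 3) (p : int -> M -> 'cV[R[i]]_5) c x :
  conserved_quantity sigma q 1 p ->
  (forall x, laurent_eval 1 p 1 x = cplx v) -> dom c x ->
  let vperp := projSperp sigma c x (cplx v) in
  (H x ^+ 2)%:C = lor vperp vperp /\
  lor vperp vperp = (4 * lor (mxRe (p 1 x)) (mxRe (p 1 x)))%:C.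
Proof.
move=> CQp pv cx vperp.
have vE : vperp = cplx (- H x *: N x).
  by rewrite /vperp projSperpE// lor_cplx (lorC v) lor_Nv cplxZ.
rewrite -!ipE vE lor_cplx lorZl lorZr lor_NN mulr1 mulrNN -expr2; split=> //.
congr (_%:C); rewrite (p1_span CQp cx).
have := Re_p1 CQp pv cx; set z := ip _ _ => Hz.
have -> : mxRe (z *: cplx (N x)) = complex.Re z *: N x.
  by rewrite cplxE cvecZc mxRe_cvec scaler0 subr0.
have -> : H x = - (2 * complex.Re z) by rewrite -Hz opprK.
by rewrite lorZl lorZr lor_NN; ring.
Qed.

End MeanCurvatureSphere.

(** * The unit normal and the mean curvature function *)

Section UnitNormal.

Definition normal_in d x : 'cV[R]_5 :=
  (area f d x)^-1 *: cross (f x) v (partial d 0 f x) (partial d 1 f x).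

Lemma normal_inP d x : dom d x ->
  [/\ ip (normal_in d x) (normal_in d x) = 1, ip (normal_in d x) (f x) = 0,
      ip (normal_in d x) v = 0 &
      forall a, ip (normal_in d x) (partial d a f x) = 0].
Proof.
move=> dx; have g0 := det_metric_gt0 dx; have A0 := area_gt0 dx.
rewrite det_metricE in g0.
have [X1 X2 X3 X4 X5] := lor_cross_cross (lor_ff x) (lor_fv x) (lor_ffa 0 dx)
  (lor_ffa 1 dx) (lor_vfa 0 dx) (lor_vfa 1 dx) g0.
rewrite /normal_in; split.
- rewrite lorZl lorZr X5 -det_metricE -area2//; field; exact: lt0r_neq0 A0.
- by rewrite lorZl X1 mulr0.
- by rewrite lorZl X2 mulr0.
- by move=> a; case: (ord2P a) => ->; rewrite lorZl ?X3 ?X4 mulr0.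
Qed.

Lemma metric_transition c d x : dom c x -> dom d x ->
  metric f c x = transition c d x *m metric f d x *m (transition c d x)^T.
Proof.
move=> cx dx; have E e : metric f e x = \matrix_(a, b) ip (partial e a f x) (partial e b f x).
  by apply/matrixP => a b; rewrite metricE mxE.
rewrite !E gram_transform; apply/matrixP => a b; rewrite !mxE.
by rewrite !(partial_transition _ (Cf d) cx dx).
Qed.

Lemma det_transition_gt0 (c d : chart M) x : dom c x -> dom d x -> 0 < \det (transition c d x).
Proof. by move=> cx dx; exact: (transition_oriented cx dx). Qed.

Lemma normal_in_eq c d x : dom c x -> dom d x -> normal_in c x = normal_in d x.
Proof.
move=> cx dx; set T := transition c d x; have T0 := det_transition_gt0 cx dx.
have A0 := area_gt0 dx.
rewrite /normal_in !(partial_transition _ (Cf d) cx dx) !sum2E -/T cross_transform.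
have -> : area f c x = \det T * area f d x.
  rewrite /area (metric_transition cx dx) !det_mulmx det_tr -/T.
  have -> : \det T * \det (metric f d x) * \det T = \det T ^+ 2 * \det (metric f d x) by ring.
  by rewrite sqrtrM ?sqr_ge0// sqrtr_sqr ger0_norm// ltW.
rewrite scalerA invfM mulrAC mulVf ?mul1r//; exact: lt0r_neq0 T0.
Qed.

Lemma exists_unit_normal : exists nu, unit_normal v f nu.
Proof.
pose ch (x : M) := sval (cid (dom_cover x)).
have chP x : dom (ch x) x := svalP (cid (dom_cover x)).
pose nu x := normal_in (ch x) x.
have nuE c x : dom c x -> nu x = normal_in c x by move=> cx; exact: normal_in_eq.
exists nu; split.
  move=> c; suff : smooth_in c nu by [].
  apply: smooth_in_eq (fun x cx => esym (nuE c x cx)) _.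
  apply: smooth_inZ.
    apply: smooth_inV (smooth_area c) => x cx; exact: lt0r_neq0 (area_gt0 cx).
  apply: smooth_in_cross (Cf c) (smooth_in_cst _ v) _ _;
    exact: smooth_in_partial (Cf c).
move=> c x cx; have [n1 n2 n3 n4] := normal_inP cx.
split; rewrite -?ipE (nuE c x cx).
- exact: n1.
- exact: n2.
- exact: n3.
- by move=> a; rewrite -ipE -partialE; exact: n4.
Qed.

Lemma mean_curvature_eq nu c d x : unit_normal v f nu -> dom c x -> dom d x ->
  mean_curvature f nu c x = mean_curvature f nu d x.
Proof.
move=> [Cnu nuP] cx dx.
have hE e : dom e x -> second_ff f nu e x =
    - \matrix_(a, b) ip (partial e a nu x) (partial e b f x).
  move=> ex; apply/matrixP => a b; rewrite second_ffE !mxE.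
  have Cfb := smooth_in_partial b (Cf e).
  have nf y : dom e y -> ip (nu y) (partial e b f y) = 0.
    by move=> ey; rewrite ipE partialE; case: (nuP e y ey).
  by rewrite (partial_lor_cst a (Cnu e) Cfb nf ex) opprK lorC.
set T := transition c d x; have T0 := lt0r_neq0 (det_transition_gt0 cx dx).
have uT : T \in unitmx by rewrite unitmxE unitfE.
have ug e : dom e x -> metric f e x \in unitmx.
  by move=> ex; rewrite unitmxE unitfE; exact: lt0r_neq0 (det_metric_gt0 ex).
have hT : second_ff f nu c x = T *m second_ff f nu d x *m T^T.
  rewrite !hE// mulmxN mulNmx gram_transform; congr (- _); apply/matrixP => a b.
  by rewrite !mxE !(partial_transition _ (Cf d) cx dx) !(partial_transition _ (Cnu d) cx dx).
rewrite /mean_curvature (metric_transition cx dx) hT.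
by congr (2^-1 * _); exact: mxtrace_shape_congr uT (ug d dx).
Qed.

Lemma smooth_mean_curvature nu c : unit_normal v f nu ->
  smooth_in c (mean_curvature f nu c).
Proof.
move=> [Cnu _]; have Cm a b := smooth_in_metric a b (Cf c).
have Ch a b : smooth_in c (fun x => second_ff f nu c x a b).
  have -> : (fun x => second_ff f nu c x a b) =
      fun x => ip (partial c a (partial c b f) x) (nu x).
    by apply/funext => x; rewrite second_ffE.
  by apply: smooth_in_lor (Cnu c); do 2 apply: smooth_in_partial; exact: Cf.
have d0 x : dom c x -> \det (metric f c x) != 0.
  by move=> cx; exact: lt0r_neq0 (det_metric_gt0 cx).
apply: smooth_in_eq (fun x cx => esym (congr1 (fun t => 2^-1 * t)
  (mxtrace_invmx2 (second_ff f nu c x) (d0 x cx)))) _.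
apply: smooth_inM; first exact: smooth_in_cst.
apply: smooth_inM; last by apply: smooth_inV => //; exact: smooth_in_det_metric (Cf c).
apply: smooth_inD (smooth_inM (Cm 0 0) (Ch 1 1)).
apply: smooth_inD (smooth_inN (smooth_inM (Cm 1 0) (Ch 0 1))).
exact: smooth_inD (smooth_inM (Cm 1 1) (Ch 0 0)) (smooth_inN (smooth_inM (Cm 0 1) (Ch 1 0))).
Qed.

Lemma exists_mean_curvature nu : unit_normal v f nu ->
  exists2 H : M -> R, smooth H & forall c x, dom c x -> mean_curvature f nu c x = H x.
Proof.
move=> hnu; pose ch (x : M) := sval (cid (dom_cover x)).
have chP x : dom (ch x) x := svalP (cid (dom_cover x)).
have HE c x : dom c x -> mean_curvature f nu c x = mean_curvature f nu (ch x) x.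
  by move=> cx; exact: mean_curvature_eq.
exists (fun x => mean_curvature f nu (ch x) x) => // c.
exact: smooth_in_eq (HE c) (smooth_mean_curvature c hnu).
Qed.

End UnitNormal.

End SpaceFormSurface.

Theorem theorem3p13 (R : realType) (M : oriented_surface R)
    (sigma : M -> 'cV[R]_5) (v : 'cV[R]_5)
    (hsigma : @immersed_null_section R M 3 sigma)
    (hv : forall x, lor (sigma x) v != 0) :
  ((exists (q : @endform R M 3) (p : int -> M -> 'cV[R[i]]_5),
      [/\ constrained_willmore sigma q, conserved_quantity sigma q 1 p &
          forall x, laurent_eval 1 p 1 x = cplx v]) <->
   (exists H : R, has_cmc v (sigma_inf sigma v) H)) /\
  (forall (q : @endform R M 3) (p : int -> M -> 'cV[R[i]]_5),
     constrained_willmore sigma q -> conserved_quantity sigma q 1 p ->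
     (forall x, laurent_eval 1 p 1 x = cplx v) ->
     forall H : R, has_cmc v (sigma_inf sigma v) H ->
     forall c x, dom c x ->
       let vperp := projSperp sigma c x (cplx v) in
       (H ^+ 2)%:C = lor vperp vperp /\
       lor vperp vperp = (4 * lor (mxRe (p 1 x)) (mxRe (p 1 x)))%:C).
Proof.
pose rho x := - lor (sigma x) v.
have rho0 x : rho x != 0 by rewrite oppr_eq0.
have Csigma : smooth sigma by case: hsigma.
have Crho : smooth rho.
  move=> c; suff : smooth_in c rho by [].
  apply: smooth_inN; apply: smooth_in_eq (fun x _ => ipE (sigma x) v) _.
  by apply: smooth_in_lor (Csigma c) _; exact: smooth_in_cst.
have fE x : sigma_inf sigma v x = (rho x)^-1 *: sigma x by rewrite /sigma_inf invrN.
have Cf : smooth (sigma_inf sigma v).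
  move=> c; suff : smooth_in c (sigma_inf sigma v) by [].
  apply: smooth_in_eq (fun x _ => esym (fE x)) _.
  exact: smooth_inZ (smooth_inV (fun x _ => rho0 x) (Crho c)) (Csigma c).
have sigmaE x : sigma x = rho x *: sigma_inf sigma v x.
  by rewrite fE scalerA divff// scale1r.
have fv x : ip (sigma_inf sigma v x) v = -1.
  by rewrite fE lorZl ipE -[lor _ _]opprK -/(rho x) mulrN mulVf.
have Ccst (h : R) : smooth (fun _ : M => h).
  by move=> c; exact: (@smooth_in_cst _ _ c _ h).
split; [split|].
- move=> [q [p [CWq CQp pv]]].
  have [nu hnu] := exists_unit_normal hsigma Cf Crho rho0 sigmaE fv.
  have [H CH hH] := exists_mean_curvature hsigma Cf Crho rho0 sigmaE hnu.
  have Hc := constant_mean_curvature hsigma Cf Crho rho0 sigmaE fv hnu CH hH CWq CQp pv.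
  have [x0 _] := @surface_nonempty _ M.
  exists (H x0); exists nu => // c x cx.
  by rewrite (hH c x cx) (Hc x x0).
- move=> [h [nu hnu hH]].
  exists (cmc_multiplier (sigma_inf sigma v) nu (fun=> h) h).
  exists (cmc_quantity (sigma_inf sigma v) v nu (fun=> h) h); split.
  + exact: (cmc_constrained_willmore hsigma Cf Crho rho0 sigmaE fv hnu (Ccst h) hH).
  + exact: (cmc_conserved_quantity hsigma Cf Crho rho0 sigmaE fv hnu (Ccst h) hH).
  + by move=> x; exact: cmc_quantity_sum.
- move=> q p CWq CQp pv h [nu hnu hH] c x cx.
  exact: (perp_square hsigma Cf Crho rho0 sigmaE fv hnu (Ccst h) hH CQp pv cx).
Qed.
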